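(* For all $\gamma\in\sigma$, $$\frac{\bigl(E^+_{s(\gamma)},E^+_{s(\gamma)}\bigr)_{\underline t,q}}{(1,1)_{\underline t,q}}=\frac{w_+(\gamma_0^{-1};\underline{\tilde t};q)}{w_+(\gamma^{-1};\underline{\tilde t};q)}.$$
   Context: Parameters: $q\in\mathbb C$ with $0<|q|<1$ and a fixed square root $q^{1/2}$; $\underline t=(k_0,k_1,u_0,u_1)$ nonzero complex numbers with $k_0^2,k_1^2,u_1^2\notin\{\pm q^j:j\in\mathbb Z\}$. Set $a=k_1u_1$, $b=-k_1u_1^{-1}$, $c=q^{1/2}k_0u_0$, $d=-q^{1/2}k_0u_0^{-1}$; dual parameters $\underline{\tilde t}=(u_1,k_1,u_0,k_0)$ ($k_0$ and $u_1$ interchanged), $\tilde a=k_0k_1$, $\tilde b=-k_1k_0^{-1}$, $\tilde c=q^{1/2}u_0u_1$, $\tilde d=-q^{1/2}u_1u_0^{-1}$. Assume $ef\notin q^{\mathbb Z}$ for all $e,f\in\{a,b,c,d\}$ and for all $e,f\in\{\tilde a,\tilde b,\tilde c,\tilde d\}$. $\mathcal A=\mathbb C[x^{\pm1}]$. On $\mathcal A$ define $(T_1f)(x)=k_1f(x)+k_1^{-1}\frac{(1-k_1u_1x)(1+k_1u_1^{-1}x)}{1-x^2}\bigl(f(x^{-1})-f(x)\bigr)$ and $(T_0f)(x)=k_0f(x)+k_0^{-1}\frac{(1-q^{1/2}k_0u_0x^{-1})(1+q^{1/2}k_0u_0^{-1}x^{-1})}{1-qx^{-2}}\bigl(f(qx^{-1})-f(x)\bigr)$,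 $Y=T_1T_0$. Let $\epsilon(m)=1$ for $m\ge0$, $\epsilon(m)=-1$ for $m<0$, $\gamma_m=(k_0k_1)^{\epsilon(m)}q^m$, $\gamma_m'=\gamma_m^{-1}$, $\sigma=\{\gamma_m\}_{m\in\mathbb Z}$, $\sigma'=\{\gamma_m'\}_{m\in\mathbb Z}$, $s(\gamma)=\gamma+\gamma^{-1}$. Order the monomials by $1\prec x^{-1}\prec x\prec x^{-2}\prec x^2\prec\cdots$; $P_m$ ($m\in\mathbb Z$) is the unique Laurent polynomial $x^m+$ lower order terms w.r.t. $\preceq$ with $YP_m=\gamma_mP_m$. $P_m^+$ ($m\ge0$) is the unique element of $\mathrm{span}\{P_m,P_{-m}\}$ of the form $x^m+$ lower order terms with $T_1P_m^+=k_1P_m^+$ (equivalently, invariant under $x\mapsto x^{-1}$), and $E^+_{s(\gamma_m)}=E^+_{s(\gamma_{-m})}=P_m^+/P_m^+(k_1u_1)$ for $m\ge0$ (the denominators are nonzero). $(y;q)_\infty=\prod_{j\ge0}(1-yq^j)$, $(y_1,\dots,y_r;q)_\infty=\prod_i(y_i;q)_\infty$. The bilinear form is $$(f,g)_{\underline t,q}=\frac1{2\pi i}\int_{C}f(x)g(x^{-1})\Delta_+(x;\underline t;q)\frac{dx}{x},\qquad \Delta_+(x;\underline t;q)=\frac{(x^2,x^{-2};q)_\infty}{(ax,ax^{-1},bx,bx^{-1},cx,cx^{-1},dx,dx^{-1};q)_\infty},$$ where $C$ is a counterclockwise continuous rectifiable Jordan curve with $aq^k,bq^k,cq^k,dq^k$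 ($k\ge0$) in its interior and $a^{-1}q^{-k},b^{-1}q^{-k},c^{-1}q^{-k},d^{-1}q^{-k}$ ($k\ge0$) in its exterior. $\Delta_+(y;\underline{\tilde t};q)$ is the same expression with $a,b,c,d$ replaced by $\tilde a,\tilde b,\tilde c,\tilde d$. Define $w_+(\gamma;\underline{\tilde t};q)=\mathrm{sgn}(\gamma)\,\mathrm{Res}_{y=\gamma}\bigl(\Delta_+(y;\underline{\tilde t};q)/y\bigr)$ for $\gamma\in\sigma'$, where $\mathrm{sgn}(\gamma_m')=\epsilon(m)$. *)

(* Defs.v *)
(* The complex numbers are R[i] for R : realType. *)
From HB Require Import structures.
From mathcomp Require Import all_boot all_order all_algebra.
From mathcomp Require Import complex finmap.
From mathcomp Require Import all_classical all_reals all_analysis.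

Set Implicit Arguments.
Unset Strict Implicit.
Unset Printing Implicit Defensive.

Import Order.TTheory GRing.Theory Num.Theory.
Import numFieldNormedType.Exports.

Local Open Scope classical_set_scope.
Local Open Scope complex_scope.
Local Open Scope ring_scope.

(* The library equips every K : numClosedFieldType with the topology of its
   norm; these instances make that structure inferable on the type R[i]. *)
HB.instance Definition _ (R : realType) :=
  PseudoPointedMetric.copy R[i] (R[i] : numClosedFieldType)^o.
HB.instance Definition _ (R : realType) :=
  NormedModule.copy R[i] (R[i] : numClosedFieldType)^o.

(** * Curves in the complex plane, parametrized by [0, 1] *)

Definition curve_trace (R : realType) (g : R -> R[i]) : set R[i] :=
  g @` `[0, 1].

Definition jordan_curve (R : realType) (g : R -> R[i]) : Prop :=
  [/\ {within `[0, 1], continuous g},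
      g 0 = g 1
    & {in `[0, 1[ &, injective g}].

(* Same partition sums as [variation], which is limited to real functions. *)
Definition rectifiable (R : realType) (g : R -> R[i]) : Prop :=
  exists M : R, forall s : seq R, itv_partition 0 1 s ->
    let t := nth 1 (0 :: s) in
    \sum_(0 <= j < size s) `|g (t j.+1) - g (t j)| <= M%:C.

(* Riemann-Stieltjes definition of the integral of h along g: v is the limit of
   the sums over tagged partitions (tags tau j) as the mesh tends to 0. *)
Definition is_contour_integral (R : realType)
    (g : R -> R[i]) (h : R[i] -> R[i]) (v : R[i]) : Prop :=
  forall eps : R, 0 < eps -> exists2 delta : R, 0 < delta &
    forall (s : seq R) (tau : nat -> R), itv_partition 0 1 s ->
      let t := nth 1 (0 :: s) in
      (forall j, (j < size s)%N ->
         t j.+1 - t j < delta /\ t j <= tau j <= t j.+1) ->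
      `| \sum_(0 <= j < size s) h (g (tau j)) * (g (t j.+1) - g (t j)) - v |
        < eps%:C.

Definition contour_integral (R : realType)
    (g : R -> R[i]) (h : R[i] -> R[i]) : R[i] :=
  get [set v | is_contour_integral g h v].

Definition two_pi_i (R : realType) : R[i] := 0 +i* (2 * pi).

Definition winding (R : realType) (g : R -> R[i]) (z : R[i]) : R[i] :=
  (two_pi_i R)^-1 * contour_integral g (fun x => (x - z)^-1).

(* Interior (exterior) of a Jordan curve: union of the bounded (unbounded)
   connected components of the complement of its trace. *)
Definition jordan_interior (R : realType) (g : R -> R[i]) : set R[i] :=
  [set z | (~` curve_trace g) z /\
           bounded_set (connected_component (~` curve_trace g) z)].

Definition jordan_exterior (R : realType) (g : R -> R[i]) : set R[i] :=
  [set z | (~` curve_trace g) z /\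
           ~ bounded_set (connected_component (~` curve_trace g) z)].

Definition counterclockwise (R : realType) (g : R -> R[i]) : Prop :=
  forall z, jordan_interior g z -> winding g z = 1.

(** * Residues *)

Definition circle_path (R : realType) (p : R[i]) (r : R) : R -> R[i] :=
  fun t => p + r%:C * (cos (2 * pi * t) +i* sin (2 * pi * t)).

(* For F with an isolated singularity at p the integral over a circle of radius
   r around p is independent of r for small r. *)
Definition is_residue (R : realType) (F : R[i] -> R[i]) (p v : R[i]) : Prop :=
  exists2 rho : R, 0 < rho & forall r : R, 0 < r < rho ->
    is_contour_integral (circle_path p r) F (two_pi_i R * v).

Definition residue (R : realType) (F : R[i] -> R[i]) (p : R[i]) : R[i] :=
  get [set v | is_residue F p v].

(** * Laurent polynomials: finitely supported coefficient families on int *)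

Definition laurent (R : realType) : Type := {fsfun int -> R[i] for fun=> 0}.

Definition leval (R : realType) (p : laurent R) (x : R[i]) : R[i] :=
  \sum_(j <- finsupp p) p j * x ^ j.

Definition lzero (R : realType) : laurent R := [fsfun].

Definition lone (R : realType) : laurent R :=
  [fsfun j in [fset (0 : int)]%fset => (1 : R[i])].

Definition lscale (R : realType) (z : R[i]) (p : laurent R) : laurent R :=
  [fsfun j in finsupp p => z * p j].

(* Position of x^j in the order 1 < x^-1 < x < x^-2 < x^2 < ... *)
Definition mon_rank (j : int) : nat :=
  if 0 <= j then (2 * `|j|)%N else (2 * `|j|).-1.

(* Leading term x^m with coefficient 1, for the order of mon_rank. *)
Definition has_leading (R : realType) (m : int) (p : laurent R) : Prop :=
  p m = 1 /\ forall j : int, (mon_rank m < mon_rank j)%N -> p j = 0.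

(** * Askey-Wilson parameters; the scalar qh is the fixed square root of q *)

Record params (R : realType) := Params
  { k0 : R[i]; k1 : R[i]; u0 : R[i]; u1 : R[i] }.

Definition dual_params (R : realType) (t : params R) : params R :=
  Params (u1 t) (k1 t) (u0 t) (k0 t).

Definition aw_a (R : realType) (t : params R) : R[i] := k1 t * u1 t.
Definition aw_b (R : realType) (t : params R) : R[i] := - (k1 t * (u1 t)^-1).
Definition aw_c (R : realType) (qh : R[i]) (t : params R) : R[i] :=
  qh * k0 t * u0 t.
Definition aw_d (R : realType) (qh : R[i]) (t : params R) : R[i] :=
  - (qh * k0 t * (u0 t)^-1).

Definition aw_abcd (R : realType) (qh : R[i]) (t : params R) : seq R[i] :=
  [:: aw_a t; aw_b t; aw_c qh t; aw_d qh t].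

Definition generic_abcd (R : realType) (q qh : R[i]) (t : params R) : Prop :=
  forall e f : R[i], e \in aw_abcd qh t -> f \in aw_abcd qh t ->
  forall j : int, e * f != q ^ j.

(** * Difference-reflection operators and their eigenfunctions *)

(* The defining formulas make sense pointwise off finitely many points; the
   operator picks the Laurent polynomial which satisfies them at all others. *)
Definition opT1 (R : realType) (t : params R) (f : laurent R) : laurent R :=
  xget (lzero R) [set h : laurent R | forall x : R[i], x != 0 -> x ^+ 2 != 1 ->
    leval h x = k1 t * leval f x
      + (k1 t)^-1 * ((1 - k1 t * u1 t * x) * (1 + k1 t * (u1 t)^-1 * x)
                      / (1 - x ^+ 2))
        * (leval f x^-1 - leval f x)].

Definition opT0 (R : realType) (q qh : R[i]) (t : params R) (f : laurent R) :
    laurent R :=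
  xget (lzero R) [set h : laurent R | forall x : R[i], x != 0 -> x ^+ 2 != q ->
    leval h x = k0 t * leval f x
      + (k0 t)^-1 * ((1 - qh * k0 t * u0 t * x^-1)
                       * (1 + qh * k0 t * (u0 t)^-1 * x^-1)
                      / (1 - q * x^-1 ^+ 2))
        * (leval f (q * x^-1) - leval f x)].

Definition opY (R : realType) (q qh : R[i]) (t : params R) (f : laurent R) :
    laurent R :=
  opT1 t (opT0 q qh t f).

Definition sgnz (m : int) : int := if 0 <= m then 1 else -1.

Definition gam (R : realType) (q : R[i]) (t : params R) (m : int) : R[i] :=
  (k0 t * k1 t) ^ (sgnz m) * q ^ m.

Definition aw_sigma (R : realType) (q : R[i]) (t : params R) : set R[i] :=
  range (gam q t).

Definition sp (R : realType) (z : R[i]) : R[i] := z + z^-1.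

Definition nonsym_P (R : realType) (q qh : R[i]) (t : params R) (m : int) :
    laurent R :=
  xget (lzero R) [set p : laurent R |
    has_leading m p /\ opY q qh t p = lscale (gam q t m) p].

Definition sym_P (R : realType) (q qh : R[i]) (t : params R) (m : nat) :
    laurent R :=
  xget (lzero R) [set p : laurent R |
    [/\ exists al be : R[i], forall j : int,
          p j = al * nonsym_P q qh t m%:Z j + be * nonsym_P q qh t (- m%:Z) j,
        has_leading m%:Z p
      & opT1 t p = lscale (k1 t) p]].

(* E^+_z for z = s(gamma_m) = s(gamma_(-m)) *)
Definition Eplus (R : realType) (q qh : R[i]) (t : params R) (z : R[i]) :
    laurent R :=
  xget (lzero R) [set E : laurent R | exists m : nat, z = sp (gam q t m%:Z) /\
    E = lscale (leval (sym_P q qh t m) (k1 t * u1 t))^-1 (sym_P q qh t m)].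

(** * Weights and the bilinear form *)

Definition qpoch (R : realType) (q y : R[i]) : R[i] :=
  lim ((fun n : nat => \prod_(0 <= j < n) (1 - y * q ^+ j)) @ \oo).

Definition Delta_plus (R : realType) (q qh : R[i]) (t : params R) (x : R[i]) :
    R[i] :=
  qpoch q (x ^+ 2) * qpoch q (x ^- 2)
    / \prod_(e <- aw_abcd qh t) (qpoch q (e * x) * qpoch q (e * x^-1)).

(* The integrand of the form lives on the punctured plane, hence the condition
   that the curve avoids 0. *)
Definition admissible_contour (R : realType) (q qh : R[i]) (t : params R)
    (g : R -> R[i]) : Prop :=
  [/\ jordan_curve g, rectifiable g, counterclockwise g, (~` curve_trace g) 0
    & forall e : R[i], e \in aw_abcd qh t -> forall k : nat,
        jordan_interior g (e * q ^+ k) /\ jordan_exterior g (e^-1 * q ^- k)].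

Definition aw_form (R : realType) (q qh : R[i]) (t : params R) (g : R -> R[i])
    (f h : laurent R) : R[i] :=
  (two_pi_i R)^-1 *
  contour_integral g
    (fun x => leval f x * leval h x^-1 * Delta_plus q qh t x / x).

(* sgn on sigma' = {gamma_m^-1}: 1 on the gamma_m^-1 with m >= 0, -1 on those
   with m < 0 (the gamma_m are distinct for generic parameters). *)
Definition sgn_dual (R : realType) (q : R[i]) (t : params R) (y : R[i]) : R[i] :=
  if `[< exists m : int, 0 <= m /\ y = (gam q t m)^-1 >] then 1 else -1.

(* w_+(y; dual t; q) as a function of t *)
Definition w_plus_dual (R : realType) (q qh : R[i]) (t : params R) (y : R[i]) :
    R[i] :=
  sgn_dual q t y * residue (fun z => Delta_plus q qh (dual_params t) z / z) y.

(* Main.v *)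
(* On symmetric Laurent polynomials Y + 1/Y acts as the Askey-Wilson second order
   q-difference operator, so E^+_{s(gamma_n)} is the terminating 4phi3 series
   p_n, normalized by p_n(a) = 1. The integral I(a, b, c, d) of the weight is
   never evaluated: the symmetries x -> 1/x and x -> 1/(qx) give
     (1 - abcd) I(aq, b, c, d) = (1 - ab) (1 - ac) (1 - ad) I(a, b, c, d),
   hence the integrals of (ax, a/x)_k (bx, b/x)_l against the weight are explicit
   multiples of I, and (p_n, p_n) / (1, 1) is a terminating sum which q-finite
   differences evaluate in closed form. The same recurrence shrinks the parameters
   to 0 and reduces I <> 0 to the non-vanishing of the constant term of
   (x^2, x^-2; q)_oo. On the dual side the residues at the simple poles gamma_n^-1
   satisfy a first order recurrence in n, inverse to that of the norms. *)
Require Import Defs.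
From mathcomp Require Import all_boot all_order all_algebra.
From mathcomp Require Import complex finmap.
From mathcomp Require Import all_classical all_reals all_analysis.
From mathcomp Require Import ring lra zify.
Set Implicit Arguments.
Unset Strict Implicit.
Unset Printing Implicit Defensive.
Import Order.TTheory GRing.Theory Num.Theory.
Import numFieldNormedType.Exports.
Local Open Scope classical_set_scope.
Local Open Scope complex_scope.
Local Open Scope ring_scope.

(** * Contour integrals *)

(** The curve is an arbitrary rectifiable Jordan curve and the integral a limit of Riemann-Stieltjes
    sums, so contours are never deformed. Integrals are evaluated on rational functions by partial
    fractions: every power of [x - p] other than the inverse has a primitive, so only winding
    integrals survive, and these are constant on the components of the complement of the trace. The
    weight is a locally uniform limit of rational functions. The substitutions x -> 1/x and x ->
    1/(q x) also leave the curve where it is: they exchange the poles inside with the poles outside,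
    and this alone makes the integral of the pulled-back integrand over the same curve the opposite
    of the original one.

    The two sides of the theorem meet because [a b], [a c], [a d] and [a b c d / q] are the products
    of the dual parameter [k0 k1] with the other three dual parameters and with itself, so that
    norms and residues have the same factors. Negative indices reduce to positive ones because the
    dual weight is invariant under y -> 1/y while dy/y changes sign; the sign in [w_plus_dual]
    compensates this. *)

Section Modulus.
Variable R : realType.
Implicit Types x y z : R[i].

(** Norms of [R[i]] lie in [R[i]]; with a real-valued modulus all estimates take place in the
    ordered field [R]. *)
Definition cabs z : R := ComplexField.Normc.normc z.

Lemma normcabs z : `|z| = (cabs z)%:C. Proof. by []. Qed.

Lemma cabs_ge0 z : 0 <= cabs z.
Proof. by rewrite -lecR -normcabs normr_ge0. Qed.

Lemma cabsD x y : cabs (x + y) <= cabs x + cabs y.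
Proof. by rewrite -lecR rmorphD /= -!normcabs ler_normD. Qed.

Lemma cabsM x y : cabs (x * y) = cabs x * cabs y.
Proof. exact: ComplexField.Normc.normcM. Qed.

Lemma cabsN x : cabs (- x) = cabs x.
Proof. by apply: complexI; rewrite -!normcabs normrN. Qed.

Lemma cabsV x : cabs x^-1 = (cabs x)^-1.
Proof. exact: ComplexField.Normc.normcV. Qed.

Lemma cabs0 : cabs 0 = 0. Proof. exact: ComplexField.Normc.normc0. Qed.

Lemma cabs1 : cabs 1 = 1. Proof. exact: ComplexField.Normc.normc1. Qed.

Lemma cabsX x n : cabs (x ^+ n) = cabs x ^+ n.
Proof. by elim: n => [|n IH]; rewrite ?expr0 ?cabs1 // !exprS cabsM IH. Qed.

Lemma cabsB x y : cabs (x - y) = cabs (y - x).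
Proof. by rewrite -cabsN opprB. Qed.

Lemma cabs_eq0 x : (cabs x == 0) = (x == 0).
Proof.
by apply/eqP/eqP => [|->]; [exact: ComplexField.Normc.eq0_normc | exact: cabs0].
Qed.

Lemma cabs_gt0 x : (0 < cabs x) = (x != 0).
Proof. by rewrite lt_def cabs_ge0 andbT cabs_eq0. Qed.

Lemma cabs_le_dist x y : cabs x - cabs y <= cabs (x - y).
Proof. by have := cabsD (x - y) y; rewrite subrK; lra. Qed.

Lemma cabs_sum I (r : seq I) (P : pred I) (F : I -> R[i]) :
  cabs (\sum_(i <- r | P i) F i) <= \sum_(i <- r | P i) cabs (F i).
Proof.
elim/big_ind2 : _ => [|a b c d ha hb|i _]; rewrite ?cabs0 //.
by apply: le_trans (cabsD _ _) _; apply: lerD.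
Qed.

Lemma cabs_prod I (r : seq I) (P : pred I) (F : I -> R[i]) :
  cabs (\prod_(i <- r | P i) F i) = \prod_(i <- r | P i) cabs (F i).
Proof. by apply: (big_morph _ cabsM cabs1). Qed.

Lemma cabs_real (r : R) : cabs r%:C = `|r|.
Proof. by rewrite /cabs /= expr0n /= addr0 sqrtr_sqr. Qed.

Lemma cabs_Re z : `|complex.Re z| <= cabs z.
Proof. by rewrite -lecR -normcabs normc_ge_Re. Qed.

Lemma cabs_i : cabs (0 +i* 1) = 1.
Proof. by rewrite /cabs /= expr0n /= add0r expr1n sqrtr1. Qed.

Lemma cabs_Im z : `|complex.Im z| <= cabs z.
Proof.
have := cabs_Re ((0 +i* (- 1)) * z); rewrite cabsM.
have -> : (0 +i* (- 1)) = - (0 +i* 1) :> R[i] by simpc.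
rewrite cabsN cabs_i mul1r; case: z => a b /=.
by simpc; rewrite /= ?opprK.
Qed.

Lemma cabs_ReIm z : cabs z <= `|complex.Re z| + `|complex.Im z|.
Proof.
case: z => a b; have -> : a +i* b = a%:C + (0 +i* 1) * b%:C by simpc.
apply: le_trans (cabsD _ _) _; rewrite cabsM !cabs_real cabs_i mul1r /=.
by simpc.
Qed.

(* Existence of limits is reduced to real Cauchy sequences. *)
Lemma cabs_cauchy_cvg (u : nat -> R[i]) :
  (forall e : R, 0 < e -> exists N, forall n m, (N <= n)%N -> (N <= m)%N ->
     cabs (u n - u m) <= e) ->
  exists l, forall e : R, 0 < e -> exists N, forall n, (N <= n)%N ->
     cabs (u n - l) <= e.
Proof.
move=> hu.
have real_case (v : nat -> R) :
    (forall e : R, 0 < e -> exists N, forall n m, (N <= n)%N -> (N <= m)%N ->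
      `|v n - v m| <= e) ->
    exists l, forall e : R, 0 < e -> exists N, forall n, (N <= n)%N ->
      `|v n - l| <= e.
  move=> hv.
  have /cauchy_cvgP cv : cauchy (v @ \oo).
    apply: cauchy_exP => e /= e0.
    have [N hN] := hv (e / 2) ltac:(lra).
    exists (v N); exists N => //= n /= hn; rewrite -ball_normE /ball_ /=.
    by apply: le_lt_trans (hN N n (leqnn _) hn) _; lra.
  exists (lim (v @ \oo)) => e e0.
  move/cvgrPdist_le : cv => /(_ e e0) [N _ hN].
  by exists N => n /hN /=; rewrite distrC.
have [a ha] : exists l, forall e : R, 0 < e -> exists N, forall n, (N <= n)%N ->
      `|complex.Re (u n) - l| <= e.
  apply: real_case => e /hu [N hN]; exists N => n m hn hm.
  by apply: le_trans (hN n m hn hm); have := cabs_Re (u n - u m); rewrite raddfB.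
have [b hb] : exists l, forall e : R, 0 < e -> exists N, forall n, (N <= n)%N ->
      `|complex.Im (u n) - l| <= e.
  apply: real_case => e /hu [N hN]; exists N => n m hn hm.
  by apply: le_trans (hN n m hn hm); have := cabs_Im (u n - u m); rewrite raddfB.
exists (a +i* b) => e e0.
have [N1 h1] := ha (e / 2) ltac:(lra).
have [N2 h2] := hb (e / 2) ltac:(lra).
exists (maxn N1 N2) => n; rewrite geq_max => /andP[/h1 k1 /h2 k2].
apply: le_trans (cabs_ReIm _) _; move: k1 k2; case: (u n) => c d /=; lra.
Qed.

Lemma cvg_cabs (u : nat -> R[i]) (l : R[i]) :
  (forall e : R, 0 < e -> exists N, forall n, (N <= n)%N ->
     cabs (u n - l) <= e) -> lim (u @ \oo) = l.
Proof.
move=> h; apply: cvg_lim; first exact: norm_hausdorff.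
apply/cvgrPdist_lt => e e0.
(* A positive element of [R[i]] is real, so real radii suffice. *)
have eE : e = (complex.Re e)%:C by rewrite RRe_real // gtr0_real.
have e0' : 0 < complex.Re e by rewrite -ltcR -eE.
have [N hN] := h (complex.Re e / 2) ltac:(lra).
exists N => //= n /= hn; rewrite normcabs eE ltcR cabsB.
by apply: le_lt_trans (hN _ hn) _; lra.
Qed.

End Modulus.

Section Curves.
Variable R : realType.
Implicit Types (g : R -> R[i]) (p : R[i]).

(** Compactness of [[0, 1]] against the filter of positive numbers tending to 0: if near each point
    all small parameters are good, one parameter is good everywhere. Uniform continuity, boundedness
    and positive distance to a point are three choices of [P]. *)
Lemma unit_interval_uniform (P : R -> R -> Prop) :
  (forall s, 0 <= s <= 1 -> exists2 d : R, 0 < d & forall s' e, 0 <= s' <= 1 ->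
     `|s - s'| < d -> 0 < e < d -> P e s') ->
  exists2 e : R, 0 < e & forall s, 0 <= s <= 1 -> P e s.
Proof.
move=> h.
have /compact_near_coveringP nc := @segment_compact R 0 1.
have := nc R (0^'+)
  (fun e s => 0 <= s <= 1 -> P e s) _.
case.
  move=> s; rewrite /= in_itv /= => hs.
  have [d d0 hd] := h s hs.
  exists ([set s' | `|s - s'| < d], [set e | 0 < e < d]) => /=.
    split; first by exists d => //= y; rewrite /ball_ /=.
    exists d => //= y; rewrite /ball_ /= sub0r normrN => hy y0.
    by rewrite y0 -(gtr0_norm y0).
  by move=> [s' e] /= [h1 h2] h3; apply: hd.
move=> d /= d0 hd.
exists (d / 2); first by lra.
move=> s hs; have h2 : 0 < d / 2 by lra.
apply: (hd (d / 2)) => //.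
by rewrite /ball_ /= sub0r normrN gtr0_norm //; lra.
Qed.

Lemma within_continuous_modulus g : {within `[0, 1], continuous g} ->
  forall s, 0 <= s <= 1 -> forall e : R, 0 < e -> exists2 d : R, 0 < d &
    forall s', 0 <= s' <= 1 -> `|s - s'| < d -> cabs (g s - g s') < e.
Proof.
move=> /subspace_continuousP cg s hs e e0.
have hs' : s \in `[0, 1] by rewrite in_itv.
have := cg s hs' => /cvgrPdist_lt /(_ e%:C).
rewrite ltcR => /(_ e0) [d /= d0 hd]; exists d => // s' hs1 hd1.
have /= := hd s' hd1; rewrite in_itv /= => /(_ hs1).
by rewrite normcabs ltcR.
Qed.

Lemma curve_unif_continuous g : {within `[0, 1], continuous g} ->
  forall e : R, 0 < e -> exists2 d : R, 0 < d &
    forall s s', 0 <= s <= 1 -> 0 <= s' <= 1 -> `|s - s'| < d ->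
      cabs (g s - g s') < e.
Proof.
move=> cg e e0.
have [] := @unit_interval_uniform (fun d s => forall s', 0 <= s' <= 1 ->
  `|s - s'| < d -> cabs (g s - g s') < e).
  move=> s hs; have [d d0 hd] := within_continuous_modulus cg hs (e := e / 2) ltac:(lra).
  exists (d / 2); first by lra.
  move=> s1 r hs1 h1 h2 s2 hs2 h3.
  have k1 := hd s1 hs1 ltac:(lra).
  have h4 : `|s - s2| < d.
    have -> : s - s2 = (s - s1) + (s1 - s2) by ring.
    by apply: le_lt_trans (ler_normD _ _) _; lra.
  have k2 := hd s2 hs2 h4.
  have -> : g s1 - g s2 = (g s - g s2) - (g s - g s1) by ring.
  by apply: le_lt_trans (cabsD _ _) _; rewrite cabsN; lra.
by move=> d d0 hd; exists d => // s s' hs hs' h; apply: hd.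
Qed.

Lemma curve_bounded g : {within `[0, 1], continuous g} ->
  exists2 B : R, 0 < B & forall x, curve_trace g x -> cabs x <= B.
Proof.
move=> cg.
(* Taking the bound to be the inverse of the small parameter puts boundedness into the required
   form. *)
have [] := @unit_interval_uniform (fun d s => cabs (g s) <= d^-1).
  move=> s hs; have [d d0 hd] := within_continuous_modulus cg hs (e := 1) ltac:(lra).
  pose B := cabs (g s) + 1; have B0 : 0 < B by have := cabs_ge0 (g s); rewrite /B; lra.
  exists (Num.min d B^-1); first by rewrite lt_min d0 invr_gt0.
  move=> s1 r hs1; rewrite lt_min => /andP[h1 _] /andP[r0].
  rewrite lt_min => /andP[_ h2].
  have k1 := hd s1 hs1 h1.
  have : cabs (g s1) <= B by rewrite /B; have := cabs_le_dist (g s1) (g s); rewrite cabsB; lra.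
  by move/le_trans; apply; rewrite -[B]invrK ltW // ltf_pV2 ?qualifE //= invr_gt0.
move=> d d0 hd; exists d^-1; first by rewrite invr_gt0.
by move=> _ [s /= hs <-]; apply: hd; move: hs; rewrite in_itv.
Qed.

Lemma curve_dist g p : {within `[0, 1], continuous g} -> ~ curve_trace g p ->
  exists2 m : R, 0 < m & forall x, curve_trace g x -> m <= cabs (x - p).
Proof.
move=> cg np.
have [] := @unit_interval_uniform (fun d s => d <= cabs (g s - p)).
  move=> s hs.
  have e0 : 0 < cabs (g s - p).
    rewrite cabs_gt0 subr_eq0; apply/eqP => h; apply: np.
    by exists s => //=; rewrite in_itv.
  have [d d0 hd] := within_continuous_modulus cg hs (e := cabs (g s - p) / 2) ltac:(lra).
  exists (Num.min d (cabs (g s - p) / 2)); first by rewrite lt_min d0; lra.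
  move=> s1 r hs1; rewrite !lt_min => /andP[h1 _] /andP[r0] /andP[_ h2].
  have k1 := hd s1 hs1 h1.
  have k2 := cabs_le_dist (g s - p) (g s - g s1).
  have -> : g s1 - p = (g s - p) - (g s - g s1) by ring.
  by lra.
move=> d d0 hd; exists d => //.
by move=> _ [s /= hs <-]; apply: hd; move: hs; rewrite in_itv.
Qed.

Lemma fine_partition (d : R) : 0 < d -> exists s : seq R, itv_partition 0 1 s /\
  let t := nth 1 (0 :: s) in forall j, (j < size s)%N -> t j.+1 - t j < d.
Proof.
move=> d0.
have [n n0 hn] : exists2 n : nat, 0 < n%:R :> R & n%:R^-1 < d.
  exists (Num.truncn d^-1).+1; first by rewrite ltr0n.
  have h : d^-1 < (Num.truncn d^-1).+1%:R by apply: Num.Theory.truncnS_gt.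
  by rewrite -[ltRHS]invrK ltf_pV2 ?qualifE //= ?invr_gt0 // ltr0n.
have [s [szs tE]] : exists s, size s = n /\
    forall j, (j <= n)%N -> nth 1 (0 :: s) j = j%:R / n%:R :> R.
  exists [seq i.+1%:R / n%:R : R | i <- iota 0 n].
  split=> [|[|j] hj]; first by rewrite size_map size_iota.
    by rewrite /= mul0r.
  by rewrite /= (nth_map 0%N) ?size_iota // nth_iota.
exists s; split; [split|].
- apply/(pathP 1) => i; rewrite szs => hi.
  have := tE i (ltnW hi); have /= := tE i.+1 hi.
  by move=> -> ->; rewrite ltr_pM2r ?invr_gt0 // ltr_nat.
- by rewrite (last_nth 1) szs tE // divff // gt_eqF.
- move=> /= j; rewrite szs => hj.
  have := tE j (ltnW hj); have /= := tE j.+1 hj => -> ->.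
  by rewrite -mulrBl -natrB // subSnn mul1r.
Qed.

Lemma partition_01 (s : seq R) j : itv_partition 0 1 s -> (j <= size s)%N ->
  0 <= nth 1 (0 :: s) j <= 1.
Proof.
by move=> hs hj; rewrite (itv_partition_nth_ge _ hs) ?(itv_partition_nth_le _ hs).
Qed.

Lemma partition_le (s : seq R) j : itv_partition 0 1 s -> (j < size s)%N ->
  nth 1 (0 :: s) j < nth 1 (0 :: s) j.+1.
Proof. by move=> [/(pathP 1) h _] /h. Qed.

End Curves.

Section ContourIntegrals.
Variable R : realType.
Variable g : R -> R[i].
Hypothesis g_cont : {within `[0, 1], continuous g}.
Hypothesis g_closed : g 0 = g 1.
Hypothesis g_rect : rectifiable g.
Implicit Types (h f : R[i] -> R[i]) (v w : R[i]) (s : seq R) (tau : nat -> R).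

Local Notation tr := (curve_trace g).
Local Notation ci := (is_contour_integral g).
Local Notation pt s := (nth 1 (0 :: s)).
Local Notation csum h s tau :=
  (\sum_(0 <= j < size s) h (g (tau j)) * (g (pt s j.+1) - g (pt s j))).

Let tagged d s tau := itv_partition 0 1 s /\ forall j, (j < size s)%N ->
  pt s j.+1 - pt s j < d /\ pt s j <= tau j <= pt s j.+1.

Lemma ciP h v : ci h v <-> forall e : R, 0 < e -> exists2 d : R, 0 < d &
  forall s tau, tagged d s tau -> cabs (csum h s tau - v) < e.
Proof.
split=> H e /H [d d0 hd]; exists d => //.
  by move=> s tau [h1 h2]; rewrite -ltcR -normcabs; apply: hd.
by move=> s tau hs t h2; rewrite normcabs ltcR; apply: hd.
Qed.

Lemma tagged_exists d : 0 < d -> exists s tau, tagged d s tau.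
Proof.
move=> /fine_partition [s [hs hd]]; exists s, (pt s); split=> // j hj.
by rewrite hd // lexx ltW // partition_le.
Qed.

Lemma tagged_le d d' s tau : d <= d' -> tagged d s tau -> tagged d' s tau.
Proof.
move=> hd [h1 h2]; split=> // j /h2 [h3 h4]; split=> //.
exact: lt_le_trans hd.
Qed.

Let tagged_minl d d' s tau : tagged (Num.min d d') s tau -> tagged d s tau.
Proof. by apply: tagged_le; rewrite ge_min lexx. Qed.

Let tagged_minr d d' s tau : tagged (Num.min d d') s tau -> tagged d' s tau.
Proof. by apply: tagged_le; rewrite ge_min lexx orbT. Qed.

Lemma tagged_trace d s tau j : tagged d s tau -> (j < size s)%N ->
  [/\ tr (g (tau j)), tr (g (pt s j)) & tr (g (pt s j.+1))].
Proof.
move=> [h1 h2] hj; have [_ /andP[h3 h4]] := h2 j hj.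
have /andP[k1 _] := partition_01 h1 (ltnW hj).
have /andP[_ k2] := partition_01 h1 hj.
split; [exists (tau j)|exists (pt s j)|exists (pt s j.+1)] => //=;
  rewrite in_itv /=; apply/andP; split=> //.
- exact: le_trans h3.
- exact: le_trans k2.
- exact: le_trans (le_trans h3 h4) k2.
- exact: le_trans k1 (le_trans h3 h4).
Qed.

Lemma curve_length : exists2 M : R, 0 < M & forall s, itv_partition 0 1 s ->
  \sum_(0 <= j < size s) cabs (g (pt s j.+1) - g (pt s j)) <= M.
Proof.
have [M hM] := g_rect.
have M0 : 0 <= M.
  have h1 : itv_partition (0 : R) 1 [:: 1] by exact: itv_partition1.
  have := hM _ h1; rewrite /= big_nat1 normcabs lecR => /(le_trans _); apply.
  exact: cabs_ge0.
exists (M + 1); first by lra.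
move=> s /hM /=.
under eq_bigr => j _ do rewrite normcabs.
by rewrite -rmorph_sum lecR => h; apply: le_trans h _; lra.
Qed.

Lemma csum_lin a h1 h2 s tau :
  csum (fun x => a * h1 x + h2 x) s tau = a * csum h1 s tau + csum h2 s tau.
Proof.
rewrite mulr_sumr -big_split /=; apply: eq_bigr => j _.
by rewrite mulrDl !mulrA.
Qed.

Lemma csum_bound M h s tau e : 
  itv_partition 0 1 s ->
  (forall s, itv_partition 0 1 s ->
    \sum_(0 <= j < size s) cabs (g (pt s j.+1) - g (pt s j)) <= M) ->
  0 <= e -> (forall j, (j < size s)%N -> cabs (h (g (tau j))) <= e) ->
  cabs (csum h s tau) <= e * M.
Proof.
move=> hs hM e0 hh; apply: le_trans (cabs_sum _ _ _) _.
apply: (@le_trans _ _ (e * \sum_(0 <= j < size s) cabs (g (pt s j.+1) - g (pt s j)))).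
  rewrite mulr_sumr; apply: ler_sum_nat => j /andP[_ hj].
  by rewrite cabsM ler_wpM2r ?cabs_ge0 // hh.
by rewrite ler_wpM2l // hM.
Qed.

Lemma ci_lin a h1 h2 v1 v2 : ci h1 v1 -> ci h2 v2 ->
  ci (fun x => a * h1 x + h2 x) (a * v1 + v2).
Proof.
move=> /ciP c1 /ciP c2; apply/ciP => e e0.
have a0 := cabs_ge0 a.
have e1 : 0 < e / 2 / (cabs a + 1) by rewrite !divr_gt0 //; lra.
have [d1 d10 hd1] := c1 _ e1.
have [d2 d20 hd2] := c2 (e / 2) ltac:(lra).
exists (Num.min d1 d2); first by rewrite lt_min d10.
move=> s tau ht.
have k1 := hd1 _ _ (tagged_minl ht).
have k2 := hd2 _ _ (tagged_minr ht).
rewrite csum_lin; set A := csum h1 s tau in k1 *; set B := csum h2 s tau in k2 *.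
have -> : a * A + B - (a * v1 + v2) = a * (A - v1) + (B - v2) by ring.
apply: le_lt_trans (cabsD _ _) _; rewrite cabsM.
suff : cabs a * cabs (A - v1) <= e / 2 by lra.
apply: (@le_trans _ _ ((cabs a + 1) * (e / 2 / (cabs a + 1)))).
  by apply: ler_pM; rewrite ?cabs_ge0 //; lra.
by rewrite mulrC mulfVK //; lra.
Qed.

Lemma ci_ext h1 h2 v : (forall x, tr x -> h1 x = h2 x) -> ci h1 v -> ci h2 v.
Proof.
move=> h12 /ciP c; apply/ciP => e /c [d d0 hd]; exists d => // s tau ht.
have <- : csum h1 s tau = csum h2 s tau; last exact: hd.
rewrite !big_nat; apply: eq_bigr => j /andP[_ hj].
by have [k _ _] := tagged_trace ht hj; rewrite h12.
Qed.

(** Tagged partitions of arbitrarily small mesh exist, so two limits of the same sums agree. *)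
Lemma ci_unique h v w : ci h v -> ci h w -> v = w.
Proof.
move=> /ciP cv /ciP cw; apply/eqP; rewrite -subr_eq0 -cabs_eq0.
apply: contraT => hn.
have e0 : 0 < cabs (v - w) / 2.
  by rewrite divr_gt0 // lt_def hn cabs_ge0.
have [d1 d10 hd1] := cv _ e0.
have [d2 d20 hd2] := cw _ e0.
have [s [tau ht]] := @tagged_exists (Num.min d1 d2) ltac:(by rewrite lt_min d10).
have k1 := hd1 _ _ (tagged_minl ht).
have k2 := hd2 _ _ (tagged_minr ht).
move: k1 k2; set A := csum h s tau => k1 k2.
have := cabsD (A - w) (- (A - v)); rewrite cabsN.
have -> : A - w + - (A - v) = v - w by ring.
by lra.
Qed.

Lemma contour_integralE h v : ci h v -> contour_integral g h = v.
Proof.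
move=> cv; rewrite /contour_integral.
apply: (@ci_unique h) => //.
exact: (@getPex _ [set v | ci h v] (ex_intro _ v cv)).
Qed.

Lemma ci_bound M h v e : (forall s, itv_partition 0 1 s ->
    \sum_(0 <= j < size s) cabs (g (pt s j.+1) - g (pt s j)) <= M) ->
  0 <= e -> (forall x, tr x -> cabs (h x) <= e) -> ci h v -> cabs v <= e * M.
Proof.
move=> hM e0 hh /ciP cv; apply/ler_addgt0Pr => r /cv [d d0 hd].
have [s [tau ht]] := tagged_exists d0.
have k := hd _ _ ht.
have [hs _] := ht.
have k2 : cabs (csum h s tau) <= e * M.
  apply: (@csum_bound M h s tau e) => // j hj.
  by have [k3 _ _] := tagged_trace ht hj; apply: hh.
move: k k2; set A := csum h s tau => k k2.
by have := cabs_le_dist v A; rewrite cabsB; lra.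
Qed.

(** Whatever the partition, the sums of two integrands at uniform distance [r] differ by at most [r]
    times the length of the curve, so integrals pass to uniform limits. *)
Lemma ci_unif h v :
  (forall e : R, 0 < e -> exists h' v', [/\ ci h' v',
    (forall x, tr x -> cabs (h x - h' x) <= e) & cabs (v - v') <= e]) -> ci h v.
Proof.
move=> H; apply/ciP => e e0.
have [M M0 hM] := curve_length.
have e1 : 0 < e / 4 / (M + 1) by rewrite !divr_gt0 //; lra.
have [h' [v' [/ciP c hh hv]]] := H _ e1.
have [d d0 hd] := c (e / 4) ltac:(lra).
exists d => // s tau ht; have k1 := hd _ _ ht.
have [hs _] := ht.
have k2 : cabs (csum (fun x => h x - h' x) s tau) <= e / 4 / (M + 1) * M.
  apply: (@csum_bound M (fun x => h x - h' x) s tau) => //; first exact: ltW.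
  by move=> j hj; have [k3 _ _] := tagged_trace ht hj; apply: hh.
have k3 : e / 4 / (M + 1) * M <= e / 4.
  rewrite -mulrA ler_piMr //; first by lra.
  by rewrite mulrC ler_pdivrMr; lra.
have k4 : e / 4 / (M + 1) <= e / 4.
  by rewrite ler_pdivrMr; have := mulr_ge0 (x := e) (y := M); lra.
have E : csum (fun x => h x - h' x) s tau = csum h s tau - csum h' s tau.
  by rewrite -sumrB; apply: eq_bigr => j _; rewrite mulrBl.
move: k1 k2; rewrite E; set A := csum h' s tau; set B := csum h s tau => k1 k2.
have -> : B - v = (B - A) + ((A - v') - (v - v')) by ring.
apply: le_lt_trans (cabsD _ _) _.
have := cabsD (A - v') (- (v - v')); rewrite cabsN; lra.
Qed.

(** Here the value is not known beforehand: the integrals of approximants at distance 1/(n + 1) form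
    a Cauchy sequence by [ci_bound]. *)
Lemma ci_unif_ex h :
  (forall e : R, 0 < e -> exists h' v', ci h' v' /\
    forall x, tr x -> cabs (h x - h' x) <= e) -> exists v, ci h v.
Proof.
move=> H.
have [M M0 hM] := curve_length.
have /choice [F hF] : forall n : nat, exists fv : (R[i] -> R[i]) * R[i],
   ci fv.1 fv.2 /\ forall x, tr x -> cabs (h x - fv.1 x) <= n.+1%:R^-1.
  by move=> n; have [|h' [v' hv]] := H n.+1%:R^-1;
     [rewrite invr_gt0 ltr0n | exists (h', v')].
have small (e : R) : 0 < e -> exists N, forall n, (N <= n)%N -> n.+1%:R^-1 <= e.
  move=> e0; exists (Num.truncn e^-1) => n hn.
  have k : e^-1 < (Num.truncn e^-1).+1%:R by apply: Num.Theory.truncnS_gt.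
  rewrite -[leRHS]invrK lef_pV2 ?qualifE //= ?invr_gt0 ?ltr0n //.
  by apply: le_trans (ltW k) _; rewrite ler_nat.
have [|v hv] := @cabs_cauchy_cvg _ (fun n => (F n).2).
  move=> e e0; have [|N hN] := small (e / 2 / M); first by rewrite !divr_gt0.
  exists N => n m /hN kn /hN km.
  have [c1 b1] := hF n; have [c2 b2] := hF m.
  have := ci_bound (e := e / M) hM _ _ (ci_lin (-1) c2 c1).
  rewrite mulfVK ?gt_eqF // addrC mulN1r; apply; first by rewrite ltW // divr_gt0.
  move=> x hx; have -> : -1 * (F m).1 x + (F n).1 x = 
      (h x - (F m).1 x) - (h x - (F n).1 x) by ring.
  apply: le_trans (cabsD _ _) _; rewrite cabsN.
  have -> : e / M = e / 2 / M + e / 2 / M by field; rewrite gt_eqF.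
  by apply: lerD; [apply: le_trans (b2 x hx) _ | apply: le_trans (b1 x hx) _].
exists v; apply: ci_unif => e e0.
have [N1 h1] := small e e0; have [N2 h2] := hv e e0.
have [c b] := hF (maxn N1 N2).
exists (F (maxn N1 N2)).1, (F (maxn N1 N2)).2; split=> //.
  by move=> x /b k; apply: le_trans k _; apply: h1; rewrite leq_maxl.
by rewrite cabsB; apply: h2; rewrite leq_maxr.
Qed.

(* G' = f on the trace, uniformly and in the strict sense: the increments of G
   are compared with f at a nearby third point. *)
Definition primitive_on (G f : R[i] -> R[i]) : Prop :=
  (exists B : R, forall x, tr x -> cabs (G x) <= B /\ cabs (f x) <= B) /\
  forall e : R, 0 < e -> exists2 d : R, 0 < d & forall a b c, tr a -> tr b -> tr c ->
    cabs (a - c) < d -> cabs (b - c) < d ->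
    cabs (G b - G a - f c * (b - a)) <= e * cabs (b - a).

(** The increments of [G] telescope to 0 on a closed curve, and the errors in the strict derivative
    add up to at most [e] times the length. *)
Lemma ci_primitive G f : primitive_on G f -> ci f 0.
Proof.
move=> [_ H]; apply/ciP => e e0.
have [M M0 hM] := curve_length.
have e1 : 0 < e / 2 / M by rewrite !divr_gt0.
have [d d0 hd] := H _ e1.
have [r r0 hr] := curve_unif_continuous g_cont d0.
exists r => // s tau ht; rewrite subr0.
have [hs hst] := ht.
have tel : \sum_(0 <= j < size s) (G (g (pt s j.+1)) - G (g (pt s j))) = 0.
  rewrite (telescope_sumr (fun j => G (g (pt s j)))) //.
  by rewrite (itv_partition_nth_size 1 hs) /= g_closed subrr.
have -> : csum f s tau = - \sum_(0 <= j < size s) (G (g (pt s j.+1)) - G (g (pt s j))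
    - f (g (tau j)) * (g (pt s j.+1) - g (pt s j))).
  by rewrite sumrB tel sub0r opprK.
rewrite cabsN; apply: le_lt_trans (cabs_sum _ _ _) _.
apply: (@le_lt_trans _ _ (e / 2)); last by lra.
apply: (@le_trans _ _ (e / 2 / M * \sum_(0 <= j < size s) cabs (g (pt s j.+1) - g (pt s j)))).
  rewrite mulr_sumr; apply: ler_sum_nat => j /andP[_ hj].
  have [k1 k2 k3] := tagged_trace ht hj.
  have [k4 /andP[k5 k6]] := hst j hj.
  have p1 := partition_01 hs (ltnW hj).
  have p2 := partition_01 hs hj.
  have p3 : 0 <= tau j <= 1 by lra.
  apply: hd => //; apply: hr => //.
    by rewrite ler0_norm; lra.
  by rewrite ger0_norm; lra.
apply: le_trans (ler_wpM2l (ltW e1) (hM _ hs)) _.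
by rewrite mulfVK // gt_eqF.
Qed.

Lemma primitive_lin a G1 f1 G2 f2 : primitive_on G1 f1 -> primitive_on G2 f2 ->
  primitive_on (fun x => a * G1 x + G2 x) (fun x => a * f1 x + f2 x).
Proof.
move=> [[B1 hB1] H1] [[B2 hB2] H2]; split.
  exists (cabs a * B1 + B2) => x hx.
  have [k1 k2] := hB1 x hx; have [k3 k4] := hB2 x hx.
  by split; apply: le_trans (cabsD _ _) _; rewrite cabsM; apply: lerD => //;
    rewrite ler_wpM2l ?cabs_ge0.
move=> e e0; have a0 := cabs_ge0 a.
have [d1 d10 hd1] := H1 (e / 2 / (cabs a + 1)) ltac:(by rewrite !divr_gt0 //; lra).
have [d2 d20 hd2] := H2 (e / 2) ltac:(lra).
exists (Num.min d1 d2); first by rewrite lt_min d10.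
move=> x y c hx hy hc; rewrite !lt_min => /andP[k1 k2] /andP[k3 k4].
have k5 := hd1 x y c hx hy hc k1 k3; have k6 := hd2 x y c hx hy hc k2 k4.
have -> : a * G1 y + G2 y - (a * G1 x + G2 x) - (a * f1 c + f2 c) * (y - x) =
  a * (G1 y - G1 x - f1 c * (y - x)) + (G2 y - G2 x - f2 c * (y - x)) by ring.
apply: le_trans (cabsD _ _) _; rewrite cabsM.
have yx0 := cabs_ge0 (y - x).
have k7 : cabs a * cabs (G1 y - G1 x - f1 c * (y - x)) <= e / 2 * cabs (y - x).
  apply: (@le_trans _ _ ((cabs a + 1) * (e / 2 / (cabs a + 1) * cabs (y - x)))).
    by apply: ler_pM; rewrite ?cabs_ge0 //; lra.
  by rewrite mulrA [_ * (_ / _)]mulrC mulfVK //; lra.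
by lra.
Qed.

Lemma primitive_continuous G f : primitive_on G f -> forall e : R, 0 < e ->
  exists2 d : R, 0 < d & forall a c, tr a -> tr c -> cabs (a - c) < d ->
    cabs (G a - G c) <= e.
Proof.
move=> [[B hB] H] e e0; have [d d0 hd] := H 1 ltac:(lra).
pose B' := `|B| + 1; have B'0 : 0 < B' by rewrite /B'; have := normr_ge0 B; lra.
exists (Num.min d (e / (1 + B'))); first by rewrite lt_min d0 divr_gt0 //; lra.
move=> a c ha hc; rewrite lt_min => /andP[k1 k2].
have k3 := hd c a c hc ha hc ltac:(by rewrite subrr cabs0) k1.
have [_ k4] := hB c hc.
have -> : G a - G c = (G a - G c - f c * (a - c)) + f c * (a - c) by ring.
apply: le_trans (cabsD _ _) _; rewrite cabsM.
have k5 : cabs (f c) <= B' by rewrite /B'; have := ler_norm B; lra.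
have k6 : cabs (f c) * cabs (a - c) <= B' * cabs (a - c).
  by rewrite ler_wpM2r ?cabs_ge0.
have : cabs (a - c) * (1 + B') < e by rewrite -ltr_pdivlMr //; lra.
by lra.
Qed.

Lemma primitive_mul G1 f1 G2 f2 : primitive_on G1 f1 -> primitive_on G2 f2 ->
  primitive_on (fun x => G1 x * G2 x) (fun x => f1 x * G2 x + G1 x * f2 x).
Proof.
move=> P1 P2; have C2 := primitive_continuous P2; have C1 := primitive_continuous P1.
move: P1 P2 => [[B1 hB1] H1] [[B2 hB2] H2].
pose B := `|B1| + `|B2| + 1.
have B0 : 1 <= B by have := normr_ge0 B1; have := normr_ge0 B2; rewrite /B; lra.
have b1 x : tr x -> cabs (G1 x) <= B /\ cabs (f1 x) <= B.
  move=> /hB1 [k1 k2]; have := normr_ge0 B2; have := ler_norm B1; rewrite /B; lra.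
have b2 x : tr x -> cabs (G2 x) <= B /\ cabs (f2 x) <= B.
  move=> /hB2 [k1 k2]; have := normr_ge0 B1; have := ler_norm B2; rewrite /B; lra.
split.
  exists (B * B + B * B) => x hx; have [k1 k2] := b1 x hx; have [k3 k4] := b2 x hx.
  have p X Y : cabs X <= B -> cabs Y <= B -> cabs (X * Y) <= B * B.
    by move=> *; rewrite cabsM; apply: ler_pM; rewrite ?cabs_ge0.
  split; first by apply: le_trans (p _ _ k1 k3) _; have := mulr_ge0 (y := B) (x := B); lra.
  by apply: le_trans (cabsD _ _) _; apply: lerD; apply: p.
move=> e e0.
pose r := e / 4 / B.
have r0 : 0 < r by rewrite !divr_gt0 //; lra.
have [d1 d10 k1] := H1 r r0; have [d2 d20 k2] := H2 r r0.
have [d3 d30 k3] := C1 r r0; have [d4 d40 k4] := C2 r r0.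
exists (Num.min (Num.min d1 d2) (Num.min d3 d4)).
  by rewrite !lt_min d10 d20 d30.
move=> x y c hx hy hc; rewrite !lt_min.
move=> /andP[/andP[x1 x2] /andP[x3 x4]] /andP[/andP[y1 y2] /andP[y3 y4]].
have q1 := k1 x y c hx hy hc x1 y1; have q2 := k2 x y c hx hy hc x2 y2.
have q3 := k3 x c hx hc x3; have q4 := k4 y c hy hc y4.
(* Four error terms: one from each derivative, and two from moving a factor to its value at [c].
   Each is at most a quarter of [e] times [cabs (y - x)]. *)
have -> : G1 y * G2 y - G1 x * G2 x - (f1 c * G2 c + G1 c * f2 c) * (y - x) =
  (G1 y - G1 x - f1 c * (y - x)) * G2 y + f1 c * (G2 y - G2 c) * (y - x)
  + (G1 x * (G2 y - G2 x - f2 c * (y - x)) + (G1 x - G1 c) * f2 c * (y - x)) by ring.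
have L0 := cabs_ge0 (y - x); set L := cabs (y - x) in L0 q1 q2 *.
have E : B * (r * L) = e / 4 * L by rewrite /r; field; lra.
have E' : B * r * L = e / 4 * L by rewrite -mulrA.
apply: le_trans (cabsD _ _) _.
have u1 : cabs ((G1 y - G1 x - f1 c * (y - x)) * G2 y) <= e / 4 * L.
  rewrite cabsM -E mulrC; apply: ler_pM; rewrite ?cabs_ge0 //; exact: (b2 y hy).1.
have u2 : cabs (f1 c * (G2 y - G2 c) * (y - x)) <= e / 4 * L.
  rewrite !cabsM -E' ler_wpM2r //; apply: ler_pM; rewrite ?cabs_ge0 //; exact: (b1 c hc).2.
have u3 : cabs (G1 x * (G2 y - G2 x - f2 c * (y - x))) <= e / 4 * L.
  rewrite cabsM -E; apply: ler_pM; rewrite ?cabs_ge0 //; exact: (b1 x hx).1.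
have u4 : cabs ((G1 x - G1 c) * f2 c * (y - x)) <= e / 4 * L.
  rewrite !cabsM -E' [_ * cabs (f2 c)]mulrC ler_wpM2r //.
  apply: ler_pM; rewrite ?cabs_ge0 //; exact: (b2 c hc).2.
have := cabsD ((G1 y - G1 x - f1 c * (y - x)) * G2 y) (f1 c * (G2 y - G2 c) * (y - x)).
have := cabsD (G1 x * (G2 y - G2 x - f2 c * (y - x))) ((G1 x - G1 c) * f2 c * (y - x)).
by lra.
Qed.

Lemma primitive_ext G f G' f' : (forall x, tr x -> G x = G' x) ->
  (forall x, tr x -> f x = f' x) -> primitive_on G f -> primitive_on G' f'.
Proof.
move=> hG hf [[B hB] H]; split.
  by exists B => x hx; rewrite -hG -?hf //; apply: hB.
move=> e /H [d d0 hd]; exists d => // a b c ha hb hc.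
by rewrite -!hG -?hf //; apply: hd.
Qed.

Lemma primitive_cst k : primitive_on (fun=> k) (fun=> 0).
Proof.
split; first by exists (cabs k) => x _; rewrite cabs0 cabs_ge0.
move=> e e0; exists 1 => // a b c _ _ _ _ _.
by rewrite subrr mul0r subr0 cabs0 mulr_ge0 ?cabs_ge0 // ltW.
Qed.

Lemma primitive_id : primitive_on id (fun=> 1).
Proof.
split.
  have [B B0 hB] := curve_bounded g_cont; exists (B + 1) => x /hB k.
  by rewrite cabs1; split; lra.
move=> e e0; exists 1 => // a b c _ _ _ _ _.
by rewrite mul1r subrr cabs0 mulr_ge0 ?cabs_ge0 // ltW.
Qed.

Lemma primitive_pow G f n : primitive_on G f ->
  primitive_on (fun x => G x ^+ n) (fun x => n%:R * G x ^+ n.-1 * f x).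
Proof.
move=> P; elim: n => [|n IH].
  apply: primitive_ext (primitive_cst 1) => x _; first by rewrite expr0.
  by rewrite !mul0r.
apply: primitive_ext (primitive_mul P IH) => x _; first by rewrite exprS.
case: n {IH} => [|n] /=; first by rewrite !expr0; ring.
by rewrite !exprS -[n.+2%:R]natr1; ring.
Qed.

Lemma primitive_inv p : ~ tr p ->
  primitive_on (fun x => (x - p)^-1) (fun x => - (x - p) ^- 2).
Proof.
move=> np; have [m m0 hm] := curve_dist g_cont np.
have nz x : tr x -> x - p != 0.
  by move=> /hm k; rewrite -cabs_gt0; apply: lt_le_trans k.
have iv x : tr x -> cabs (x - p)^-1 <= m^-1.
  move=> hx; rewrite cabsV lef_pV2 ?qualifE //= ?cabs_gt0 ?nz //.
  exact: hm.
split.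
  exists (m^-1 + m^-1 ^+ 2) => x hx; have k1 := iv x hx.
  have m1 : 0 < m^-1 by rewrite invr_gt0.
  split; first by apply: le_trans k1 _; rewrite lerDl sqr_ge0.
  rewrite cabsN -exprVn cabsX; apply: (@le_trans _ _ (m^-1 ^+ 2)); last by lra.
  by rewrite ler_pXn2r // qualifE /= ?cabs_ge0 // ltW.
(* The error splits into two terms, each a small difference times three inverse distances bounded by
   [m^-1]; hence the cube. *)
move=> e e0; exists (e * m ^+ 3 / 2); first by rewrite divr_gt0 // mulr_gt0 // exprn_gt0.
move=> a b c ha hb hc k1 k2.
have a0 := nz a ha; have b0 := nz b hb; have c0 := nz c hc.
have -> : (b - p)^-1 - (a - p)^-1 - - (c - p) ^- 2 * (b - a) =
  (b - a) * (((b - c) * (a - p) + (c - p) * (a - c)) * ((c - p)^-1 * (c - p)^-1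
      * ((a - p)^-1 * (b - p)^-1))).
  by field; rewrite a0 b0 c0.
have -> : ((b - c) * (a - p) + (c - p) * (a - c)) * ((c - p)^-1 * (c - p)^-1
      * ((a - p)^-1 * (b - p)^-1)) = (b - c) * ((c - p)^-1 * ((c - p)^-1 * (b - p)^-1))
    + (a - c) * ((c - p)^-1 * ((a - p)^-1 * (b - p)^-1)).
  by field; rewrite a0 b0 c0.
rewrite cabsM mulrC ler_wpM2r ?cabs_ge0 //.
have t x y z u r : tr x -> tr y -> tr z -> cabs u < r * m ^+ 3 ->
    cabs (u * ((x - p)^-1 * ((y - p)^-1 * (z - p)^-1))) <= r.
  move=> hx hy hz hu; rewrite !cabsM.
  have -> : r = r * m ^+ 3 * (m^-1 * (m^-1 * m^-1)) by field; rewrite gt_eqF.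
  apply: ler_pM; rewrite ?mulr_ge0 ?cabs_ge0 //; first exact: ltW.
  apply: ler_pM; rewrite ?mulr_ge0 ?cabs_ge0 // ?iv //.
  by apply: ler_pM; rewrite ?cabs_ge0 // ?iv.
apply: le_trans (cabsD _ _) _.
have -> : e = e / 2 + e / 2 by lra.
by apply: lerD; apply: t => //; rewrite mulrAC.
Qed.

Lemma ci_monomial p k : ci (fun x => (x - p) ^+ k) 0.
Proof.
have P : primitive_on (fun x => x - p) (fun=> 1).
  apply: primitive_ext (primitive_lin 1 primitive_id (primitive_cst (- p))) => x _ /=.
    by rewrite mul1r.
  by rewrite mul1r addr0.
apply: ci_ext (ci_primitive (primitive_lin k.+1%:R^-1 (primitive_pow k.+1 P)
   (primitive_cst 0))) => x _ /=.
by rewrite mulr1 addr0 mulrA mulVf ?mul1r // pnatr_eq0.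
Qed.

Lemma ci_inv_pow p k : ~ tr p -> ci (fun x => (x - p) ^- k.+2) 0.
Proof.
move=> np.
have := ci_primitive (primitive_lin (- k.+1%:R^-1)
  (primitive_pow k.+1 (primitive_inv np)) (primitive_cst 0)).
apply: ci_ext => x hx /=.
rewrite addr0 mulNr !mulrN opprK -!exprVn !mulrA mulVf ?pnatr_eq0 // mul1r.
by rewrite -!exprSr.
Qed.

End ContourIntegrals.

(** * Rational functions and partial fractions *)

Section RationalFunctions.
Variable R : realType.
Implicit Types (S : set R[i]) (F : R[i] -> R[i]) (P : {poly R[i]}) (s : seq R[i]).

Definition roots_prod s (x : R[i]) : R[i] := \prod_(p <- s) (x - p).

Lemma roots_prod_cons p s x : roots_prod (p :: s) x = (x - p) * roots_prod s x.
Proof. by rewrite /roots_prod big_cons. Qed.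

Lemma roots_prod_neq0 S s x : (forall p, p \in s -> S p) -> ~ S x ->
  roots_prod s x != 0.
Proof.
move=> hs hx; rewrite /roots_prod prodf_seq_neq0; apply/allP => p hp /=.
by rewrite subr_eq0; apply/eqP => xp; apply: hx; rewrite xp; apply: hs.
Qed.

Lemma horner_roots_prod s x : (\prod_(p <- s) ('X - p%:P)).[x] = roots_prod s x.
Proof. by rewrite horner_prod; apply: eq_bigr => p _; rewrite hornerXsubC. Qed.

Definition rational S F := exists P s, (forall p, p \in s -> S p) /\
  forall x, ~ S x -> F x = P.[x] / roots_prod s x.

(** Partial fraction decomposition as an induction principle: a property stable under linear
    combinations need only be checked on monomials and on negative powers of [x - p]. *)
Lemma partial_fractions_ind S (Q : (R[i] -> R[i]) -> Prop) :
  (forall f h, (forall x, ~ S x -> f x = h x) -> Q f -> Q h) ->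
  (forall a f h, Q f -> Q h -> Q (fun x => a * f x + h x)) ->
  (forall k, Q (fun x => x ^+ k)) ->
  (forall p k, S p -> Q (fun x => (x - p) ^- k.+1)) ->
  forall F, rational S F -> Q F.
Proof.
move=> Qext Qlin Qmon Qinv.
have Q0 : Q (fun=> 0).
  by apply: Qext (Qlin (-1) _ _ (Qmon 0%N) (Qmon 0%N)) => x _; rewrite !expr0; ring.
have Qscale a f : Q f -> Q (fun x => a * f x).
  by move=> qf; apply: Qext (Qlin a _ _ qf Q0) => x _; rewrite addr0.
have Qdiv n : forall s, size s = n.+1 -> (forall p, p \in s -> S p) ->
    Q (fun x => (roots_prod s x)^-1).
  elim: n => [|n IH] s.
    case: s => [|p [|//]] // _ hs.
    apply: Qext (Qinv p 0%N (hs p (mem_head _ _))) => x _.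
    by rewrite /roots_prod big_seq1 expr1.
  case: s => [//|p [//|p' s]] [sz] hs.
  (* Either all factors coincide, or some [r] differs from [p], and 1/((x - p)(x - r)) = (1/(x - p)
     - 1/(x - r))/(p - r) leaves two products with one factor less. *)
  have [hall|/allPn[r rs rp]] := boolP (all (pred1 p) (p' :: s)).
    have : all (pred1 p) (p :: p' :: s) by rewrite [all _ _]/= eqxx.
    move=> /all_pred1P -> ; rewrite [size _]/=.
    apply: Qext (Qinv p (size s).+1 (hs p (mem_head _ _))) => x _.
    by rewrite /roots_prod big_nseq iter_mulr_1.
  pose s' := rem r (p' :: s).
  have szs' : size s' = n by rewrite size_rem //= sz.
  have mem z : z \in s' -> S z.
    by move=> /mem_rem hz; apply: hs; rewrite inE hz orbT.
  have Sp : S p by apply: hs; rewrite mem_head.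
  have Sr : S r by apply: hs; rewrite inE rs orbT.
  have q1 : Q (fun x => (roots_prod (p :: s') x)^-1).
    apply: IH; first by rewrite /= szs'.
    by move=> z; rewrite inE => /predU1P[->|/mem].
  have q2 : Q (fun x => (roots_prod (r :: s') x)^-1).
    apply: IH; first by rewrite /= szs'.
    by move=> z; rewrite inE => /predU1P[->|/mem].
  apply: Qext (Qlin (p - r)^-1 _ _ q1 (Qscale (- (p - r)^-1) _ q2)) => x hx.
  rewrite !roots_prod_cons.
  have -> : (x - p') * roots_prod s x = (x - r) * roots_prod s' x.
    by rewrite -!roots_prod_cons /roots_prod; apply: perm_big; apply: perm_to_rem.
  have n0 := roots_prod_neq0 mem hx.
  have n1 : x - p != 0 by rewrite subr_eq0; apply/eqP => h; apply: hx; rewrite h.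
  have n2 : x - r != 0 by rewrite subr_eq0; apply/eqP => h; apply: hx; rewrite h.
  have n3 : p - r != 0 by rewrite subr_eq0 eq_sym.
  by field; rewrite n0 n1 n2 n3.
move=> F [P [s [hs hF]]]; apply: (Qext _ _ (fun x hx => esym (hF x hx))).
elim: s P hs {hF} => [|p s IH] P hs.
  elim/poly_ind: P => [|P c IHP].
    by apply: Qext Q0 => x _; rewrite horner0 mul0r.
  have QX f : Q f -> (exists P, forall x, f x = P.[x]) -> Q (fun x => f x * x).
    move=> _ [T hT]; suff : Q (fun x => T.[x] * x).
      by apply: Qext => x _; rewrite hT.
    have -> : (fun x => T.[x] * x) = (fun x => \sum_(i < size T) T`_i * x ^+ i.+1).
      apply/funext => x; rewrite horner_coef mulr_suml; apply: eq_bigr => i _.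
      by rewrite -mulrA -exprSr.
    elim: (size T) => [|n IHn].
      by apply: Qext Q0 => x _; rewrite big_ord0.
    apply: Qext (Qlin T`_n _ _ (Qmon n.+1) IHn) => x _.
    by rewrite big_ord_recr /= addrC.
  have := QX _ IHP; move=> /(_ _) q.
  have {}q : Q (fun x => P.[x] * x).
    apply: Qext (q _) => [x _|]; first by rewrite /roots_prod big_nil divr1.
    by exists P => x; rewrite /roots_prod big_nil divr1.
  apply: Qext (Qlin c _ _ (Qmon 0%N) q) => x _.
  by rewrite /roots_prod big_nil divr1 !hornerE addrC.
have hs' z : z \in s -> S z by move=> zs; apply: hs; rewrite inE zs orbT.
have Sp : S p by apply: hs; rewrite mem_head.
(* Division of the numerator by [X - p]: the quotient cancels one factor of the denominator, and the
   remainder [P.[p]] is a constant numerator. *)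
have /factor_theorem [T hT] : root (P - (P.[p])%:P) p.
  by rewrite /root !hornerE subrr.
apply: Qext (Qlin P.[p] _ _ (@Qdiv (size s) (p :: s) erefl hs) (IH T hs')) => x hx.
have -> : P = T * ('X - p%:P) + (P.[p])%:P by rewrite -hT subrK.
have n0 := roots_prod_neq0 hs' hx.
have n1 : x - p != 0 by rewrite subr_eq0; apply/eqP => h; apply: hx; rewrite h.
by rewrite roots_prod_cons !hornerE subrr mulr0 add0r; field; rewrite n0 n1.
Qed.

Lemma rational_ext S F F' : (forall x, ~ S x -> F x = F' x) -> rational S F ->
  rational S F'.
Proof. by move=> h [P [s [hs hF]]]; exists P, s; split=> // x hx; rewrite -h ?hF. Qed.

Lemma rational_sub S S' F : S `<=` S' -> rational S F -> rational S' F.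
Proof.
move=> h [P [s [hs hF]]]; exists P, s; split=> [p /hs /h //|x hx].
by apply: hF => /h.
Qed.

Lemma rational_poly S P : rational S (fun x => P.[x]).
Proof.
by exists P, [::]; split=> // x _; rewrite /roots_prod big_nil divr1.
Qed.

Lemma rational_cst S c : rational S (fun=> c).
Proof. by apply: rational_ext (rational_poly S c%:P) => x _; rewrite hornerC. Qed.

Lemma rational_id S : rational S id.
Proof. by apply: rational_ext (rational_poly S 'X) => x _; rewrite hornerX. Qed.

Lemma rational_mul S F F' : rational S F -> rational S F' ->
  rational S (fun x => F x * F' x).
Proof.
move=> [P [s [hs hF]]] [P' [s' [hs' hF']]].
exists (P * P'), (s ++ s'); split.
  by move=> p; rewrite mem_cat => /orP[/hs|/hs'].
move=> x hx; rewrite hF // hF' // hornerM /roots_prod big_cat /=.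
by rewrite invfM mulrACA.
Qed.

Lemma rational_invB S p : S p -> rational S (fun x => (x - p)^-1).
Proof.
move=> Sp; exists 1, [:: p]; split.
  by move=> r; rewrite inE => /eqP ->.
by move=> x _; rewrite /roots_prod big_seq1 hornerC mul1r.
Qed.

Lemma rational_prod S (I : Type) (r : seq I) (F : I -> R[i] -> R[i]) :
  (forall i, rational S (F i)) -> rational S (fun x => \prod_(i <- r) F i x).
Proof.
move=> h; elim: r => [|i r IH].
  by apply: rational_ext (rational_cst S 1) => x _; rewrite big_nil.
by apply: rational_ext (rational_mul (h i) IH) => x _; rewrite big_cons.
Qed.

End RationalFunctions.

(** * Winding integrals and the components of the complement of the trace *)

Section Winding.
Variable R : realType.

Lemma geometric_small (r e : R) : 0 <= r < 1 -> 0 < e ->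
  exists N, forall n, (N <= n)%N -> r ^+ n <= e.
Proof.
move=> /andP[r0 r1] e0.
have := @cvg_expr R r; rewrite ger0_norm // => /(_ r1).
move=> /cvgrPdist_le /(_ e e0) [N _ hN]; exists N => n hn.
have := hN n hn; rewrite /= sub0r normrN ger0_norm //.
exact: exprn_ge0.
Qed.

Variable g : R -> R[i].
Hypothesis g_cont : {within `[0, 1], continuous g}.
Hypothesis g_closed : g 0 = g 1.
Hypothesis g_rect : rectifiable g.

Local Notation tr := (curve_trace g).
Local Notation ci := (is_contour_integral g).

Lemma ci_scale a h v : ci h v -> ci (fun x => a * h x) (a * v).
Proof.
move=> c; have := ci_lin a c (ci_monomial g_cont g_closed g_rect 0 0).
move=> /(ci_lin (-1) (ci_monomial g_cont g_closed g_rect 0 0)).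
rewrite mulr0 addr0 add0r; apply: ci_ext => x _.
by rewrite expr0; ring.
Qed.

Lemma ci_sum (I : Type) (s : seq I) (h : I -> R[i] -> R[i]) (v : I -> R[i]) :
  (forall i, ci (h i) (v i)) ->
  ci (fun x => \sum_(i <- s) h i x) (\sum_(i <- s) v i).
Proof.
move=> H; elim: s => [|i s IH].
  have := ci_scale 0 (ci_monomial g_cont g_closed g_rect 0 0).
  by rewrite mul0r big_nil; apply: ci_ext => x _; rewrite big_nil mul0r.
rewrite big_cons -[v i]mul1r.
by apply: ci_ext (ci_lin 1 (H i) IH) => x _; rewrite big_cons mul1r.
Qed.

(* Geometric expansion of 1/(x - p') around p: all terms but the first have a
   primitive. *)
Lemma winding_near m p p' v : (forall x, tr x -> m <= cabs (x - p)) -> 0 < m ->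
  cabs (p' - p) <= m / 2 -> ci (fun x => (x - p)^-1) v -> ci (fun x => (x - p')^-1) v.
Proof.
move=> hm m0 hp cp.
have np : ~ tr p by move=> /hm; rewrite subrr cabs0; lra.
have nz x : tr x -> x - p != 0.
  by move=> /hm k; rewrite -cabs_gt0; apply: lt_le_trans k.
have nz' x : tr x -> m / 2 <= cabs (x - p').
  move=> /hm k; have := cabs_le_dist (x - p) (p' - p).
  have -> : x - p - (p' - p) = x - p' by ring.
  by lra.
apply: ci_unif => // e e0.
have [N hN] := @geometric_small (1 / 2) (e * (m / 2)) ltac:(lra) ltac:(by rewrite mulr_gt0 //; lra).
exists (fun x => \sum_(k < N.+1) (p' - p) ^+ k * (x - p) ^- k.+1), v; split.
- elim: {hN} N => [|N IH].
    by apply: ci_ext cp => x _; rewrite big_ord1 expr0 mul1r expr1.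
  have := ci_lin ((p' - p) ^+ N.+1) (ci_inv_pow g_cont g_closed g_rect N np) IH.
  by rewrite mulr0 add0r; apply: ci_ext => x _; rewrite [RHS]big_ord_recr addrC.
- move=> x hx.
  have x1 := nz x hx.
  have x2 : x - p' != 0 by rewrite -cabs_gt0; have := nz' x hx; lra.
  have E n : (x - p')^-1 - \sum_(k < n) (p' - p) ^+ k * (x - p) ^- k.+1 =
      ((p' - p) / (x - p)) ^+ n * (x - p')^-1.
    elim: n => [|n IH]; first by rewrite big_ord0 subr0 mul1r.
    rewrite big_ord_recr /= opprD addrA IH !exprS expr_div_n invfM -exprVn.
    by field; rewrite x1 x2.
  rewrite E cabsM cabsX cabsM !cabsV.
  have r1 : cabs (p' - p) / cabs (x - p) <= 1 / 2.
    rewrite ler_pdivrMr ?cabs_gt0 //; have := hm x hx; lra.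
  have r0 : 0 <= cabs (p' - p) / cabs (x - p) by rewrite divr_ge0 ?cabs_ge0.
  rewrite ler_pdivrMr ?cabs_gt0 //.
  apply: (@le_trans _ _ ((1 / 2) ^+ N.+1)).
    by rewrite lerXn2r // qualifE /=; lra.
  apply: le_trans (hN N.+1 (leqnSn N)) _.
  by rewrite ler_wpM2l ?(ltW e0) // nz'.
- by rewrite subrr cabs0 ltW.
Qed.

(** Geometric expansion in powers of [(x - c) / (p - c)]: every partial sum is a polynomial in [x],
    so it integrates to 0. *)
Lemma winding_far c rho p : (forall x, tr x -> cabs (x - c) <= rho) ->
  rho < cabs (p - c) -> ci (fun x => (x - p)^-1) 0.
Proof.
move=> hr hp.
have [x0 hx0] : exists x, tr x by exists (g 0); exists 0 => //=; rewrite in_itv /= lexx ler01.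
have rho0 : 0 <= rho by apply: le_trans (hr _ hx0); apply: cabs_ge0.
have pc0 : 0 < cabs (p - c) by lra.
have dist x : tr x -> cabs (p - c) - rho <= cabs (x - p).
  move=> /hr k; have := cabs_le_dist (p - c) (x - c).
  have -> : p - c - (x - c) = p - x by ring.
  by rewrite (cabsB p x); lra.
apply: ci_unif => // e e0.
have hr1 : 0 <= rho / cabs (p - c) < 1.
  by rewrite divr_ge0 ?cabs_ge0 //= ltr_pdivrMr // mul1r.
have [N hN] := geometric_small hr1 (e := e * (cabs (p - c) - rho)) ltac:(by rewrite mulr_gt0 // subr_gt0).
exists (fun x => \sum_(k < N) (- (p - c) ^- k.+1) * (x - c) ^+ k), 0; split.
- have := @ci_sum _ (index_enum 'I_N) (fun k x => (- (p - c) ^- k.+1) * (x - c) ^+ k) (fun=> 0).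
  rewrite big1 //; apply=> k.
  by rewrite -[0](mulr0 (- (p - c) ^- k.+1)); apply: ci_scale; apply: ci_monomial.
- move=> x hx.
  have x1 : p - c != 0 by rewrite -cabs_gt0.
  have x2 : x - p != 0 by rewrite -cabs_gt0; have := dist x hx; lra.
  have E n : (x - p)^-1 - \sum_(k < n) (- (p - c) ^- k.+1) * (x - c) ^+ k =
      ((x - c) / (p - c)) ^+ n * (x - p)^-1.
    elim: n => [|n IH]; first by rewrite big_ord0 subr0 mul1r.
    rewrite big_ord_recr /= opprD addrA IH !exprS expr_div_n invfM -exprVn.
    by field; rewrite x1 x2.
  rewrite E cabsM cabsX cabsM !cabsV.
  rewrite ler_pdivrMr ?cabs_gt0 //.
  apply: (@le_trans _ _ ((rho / cabs (p - c)) ^+ N)).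
    have q0 : 0 <= cabs (x - c) / cabs (p - c) by rewrite divr_ge0 ?cabs_ge0.
    have q1 : cabs (x - c) / cabs (p - c) <= rho / cabs (p - c).
      by rewrite ler_pM2r ?invr_gt0 // hr.
    by case/andP: hr1 => q2 _; rewrite lerXn2r // qualifE /=.
  apply: le_trans (hN N (leqnn N)) _.
  by rewrite ler_wpM2l ?(ltW e0) // dist.
- by rewrite subrr cabs0 ltW.
Qed.

Lemma open_cabs (A : set R[i]) :
  (forall p, A p -> exists2 d : R, 0 < d & forall p', cabs (p' - p) < d -> A p') ->
  open A.
Proof.
move=> h; rewrite openE => p /h [d d0 hd].
apply/nbhs_ballP; exists d%:C => /=; first by rewrite ltcR.
move=> p'; rewrite -ball_normE /ball_ /= normcabs ltcR cabsB; exact: hd.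
Qed.

Lemma winding_locally p : ~ tr p -> exists2 d : R, 0 < d & forall p',
  cabs (p' - p) < d -> ~ tr p' /\
  forall v, ci (fun x => (x - p)^-1) v <-> ci (fun x => (x - p')^-1) v.
Proof.
move=> np; have [m m0 hm] := curve_dist g_cont np.
(* With this radius the roles of [p] and [p'] can be exchanged: the trace stays at distance
   [2 m / 3] from [p'], and [m / 3] is half of that, as [winding_near] demands. *)
exists (m / 3); first by lra.
move=> p' hp.
have hm' x : tr x -> m * 2 / 3 <= cabs (x - p').
  move=> /hm k; have := cabs_le_dist (x - p) (p' - p).
  have -> : x - p - (p' - p) = x - p' by ring.
  by lra.
split; first by move=> /hm'; rewrite subrr cabs0; lra.
move=> v; split; first by apply: winding_near hm _ _ => //; lra.
by apply: winding_near hm' _ _; rewrite 1?cabsB; lra.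
Qed.

(** The points with winding integral [v] form a subset of the component that is both open and
    closed. Its complement is described by the failure of the integral to be [v], which covers the
    points where no integral is yet known to exist. *)
Lemma winding_component p p' v : ~ tr p -> ci (fun x => (x - p)^-1) v ->
  connected_component (~` tr) p p' -> ci (fun x => (x - p')^-1) v.
Proof.
move=> np cp hp'.
set A := connected_component (~` tr) p.
have hA : A `<=` ~` tr := @connected_component_sub _ _ _.
suff hB : [set z | A z /\ ci (fun x => (x - z)^-1) v] = A.
  by have : A p' by []; rewrite -hB => -[].
apply: component_connected.
- by exists p; split=> //; apply: connected_component_refl.
- exists [set z | ~ tr z /\ ci (fun x => (x - z)^-1) v].
    apply: open_cabs => z [nz cz]; have [d d0 hd] := winding_locally nz.
    by exists d => // z' /hd [h1 h2]; split=> //; apply/h2.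
  by apply/seteqP; split=> z [h1 h2]; split=> //; [split=> //; apply: hA | case: h2].
- exists (~` [set z | ~ tr z /\ ~ ci (fun x => (x - z)^-1) v]).
    apply: open_closedC; apply: open_cabs => z [nz cz].
    have [d d0 hd] := winding_locally nz.
    by exists d => // z' /hd [h1 h2]; split=> // k; apply: cz; apply/h2.
  apply/seteqP; split=> z [h1 h2]; split=> //; first by move=> [].
  by apply: contrapT => k; apply: h2; split=> //; apply: hA.
Qed.

(** An unbounded component has a point outside a disc that holds the trace, where [winding_far]
    applies; the value is then transported along the component. *)
Lemma winding_exterior p : jordan_exterior g p -> ci (fun x => (x - p)^-1) 0.
Proof.
move=> [np nb].
have [B B0 hB] := curve_bounded g_cont.
have [p' hp' bp'] : exists2 p', connected_component (~` tr) p p' & B < cabs p'.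
  apply: contrapT => h; apply: nb.
  exists B%:C; split; first by apply: ger0_real; rewrite ler0c ltW.
  move=> M hM z hz /=; rewrite normcabs; apply: le_trans (ltW hM).
  rewrite lecR leNgt; apply/negP => k; apply: h; by exists z.
have hc : ci (fun x => (x - p')^-1) 0.
  by apply: (@winding_far 0 B) => [x /hB|]; rewrite subr0.
apply: winding_component hc _; last exact: connected_component_sym.
exact: (@connected_component_sub _ _ _ _ hp').
Qed.

Lemma winding_interior p : counterclockwise g -> jordan_interior g p ->
  ci (fun x => (x - p)^-1) (two_pi_i R).
Proof.
move=> cc hp; have := cc p hp; rewrite /winding.
have pi0 : two_pi_i R != 0.
  rewrite /two_pi_i eq_complex /= eqxx /= mulf_neq0 ?pnatr_eq0 //.
  by rewrite gt_eqF // pi_gt0.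
have [[v hv]|hn] := pselect (exists v, ci (fun x => (x - p)^-1) v).
  rewrite (contour_integralE hv) => h.
  suff -> : two_pi_i R = v by [].
  by apply: (mulfI (invr_neq0 pi0)); rewrite h mulVf.
(* If the integral did not exist, [contour_integral] would be the default value 0, against winding
   number 1. *)
rewrite /contour_integral getPN; last by move=> v hv; apply: hn; exists v.
have -> : point = 0 :> R[i] by [].
by rewrite mulr0 => /esym /eqP; rewrite oner_eq0.
Qed.

End Winding.

(** * The substitution x -> 1/(r x) along a fixed curve *)

Section Reflection.
Variable R : realType.
Variable g : R -> R[i].
Hypothesis g_cont : {within `[0, 1], continuous g}.
Hypothesis g_closed : g 0 = g 1.
Hypothesis g_rect : rectifiable g.
Local Notation tr := (curve_trace g).
Local Notation ci := (is_contour_integral g).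

(* The differential F dx pulled back along x |-> 1 / (r x). *)
Definition reflect r (F : R[i] -> R[i]) (x : R[i]) := - F ((r * x)^-1) / (r * x ^+ 2).

Variables (S : set R[i]) (r w0 : R[i]).
Hypothesis r_neq0 : r != 0.
Hypothesis S_tr : forall p, S p -> ~ tr p.
Hypothesis S0 : S 0.
Hypothesis S0_winding : ci (fun x => x^-1) w0.
(* The reflection exchanges the inside and the outside of the curve. *)
Hypothesis S_winding : forall p, S p -> p != 0 -> S (r * p)^-1 /\
  exists w w', [/\ ci (fun x => (x - p)^-1) w, ci (fun x => (x - (r * p)^-1)^-1) w'
   & w + w' = w0].

Lemma trace_neq0 x : tr x -> x != 0.
Proof. by move=> hx; apply/eqP => x0; apply: (S_tr S0); rewrite -x0. Qed.

Lemma reflect_trace x : tr x -> ~ S (r * x)^-1.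
Proof.
move=> hx hS; have x0 := trace_neq0 hx.
have h0 : (r * x)^-1 != 0 by rewrite invr_neq0 // mulf_neq0.
have [+ _] := S_winding hS h0; rewrite invfM invrK mulrA mulVf // mul1r.
by move=> /S_tr.
Qed.

(** Checked on partial fractions. With s = 1/(r p), the pull-back of dx/(x - p) is -dx/x + dx/(x -
    s), whose integral is -w0 + w' = -w; for p = 0 it is -dx/x. All other powers integrate to 0 on
    both sides. *)
Lemma ci_reflect F : rational S F -> exists v, ci F v /\ ci (reflect r F) (- v).
Proof.
move: F; apply: partial_fractions_ind.
- move=> f h fh [v [c1 c2]]; exists v; split.
    by apply: ci_ext c1 => x hx; apply: fh => /S_tr.
  apply: ci_ext c2 => x hx; rewrite /reflect fh //; exact: reflect_trace.
- move=> a f h [v [c1 c2]] [w [c3 c4]]; exists (a * v + w); split.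
    exact: ci_lin.
  have := ci_lin a c2 c4; rewrite mulrN -opprD.
  by apply: ci_ext => x _; rewrite /reflect; ring.
- move=> k; exists 0; split.
    by apply: ci_ext (ci_monomial g_cont g_closed g_rect 0 k) => x _; rewrite subr0.
  have := ci_scale g_cont g_closed g_rect (- r ^- k.+1) (ci_inv_pow g_cont g_closed g_rect k (S_tr S0)).
  rewrite mulr0 oppr0; apply: ci_ext => x hx; have x0 := trace_neq0 hx.
  rewrite /reflect /= ?subr0 ?addr0 -!exprVn !exprS invfM exprMn.
  by field; rewrite x0 r_neq0.
move=> p k Sp; have [->|p0] := eqVneq p 0.
  case: k => [|k].
    exists w0; split; first by apply: ci_ext S0_winding => x _; rewrite subr0 expr1.
    have -> : - w0 = -1 * w0 by ring.
    apply: ci_ext (ci_scale g_cont g_closed g_rect (-1) S0_winding) => x hx.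
    have x0 := trace_neq0 hx.
    by rewrite /reflect /= ?subr0 ?addr0 expr1 invrK; field; rewrite x0 r_neq0.
  exists 0; split; first exact: (ci_inv_pow g_cont g_closed g_rect k (S_tr S0)).
  have := ci_scale g_cont g_closed g_rect (- r ^+ k.+1) (ci_monomial g_cont g_closed g_rect 0 k).
  rewrite mulr0 oppr0; apply: ci_ext => x hx; have x0 := trace_neq0 hx.
  rewrite /reflect /= ?subr0 ?addr0 -exprVn invrK !exprS exprMn.
  by field; rewrite x0 r_neq0.
have [Ss [w [w' [c1 c2 ww]]]] := S_winding Sp p0.
set s := (r * p)^-1 in Ss c2.
have s0 : s != 0 by rewrite invr_neq0 // mulf_neq0.
have xs x : tr x -> x - s != 0.
  by move=> hx; rewrite subr_eq0; apply/eqP => h; apply: (S_tr Ss); rewrite -h.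
have pE : p = (r * s)^-1 by rewrite /s invfM invrK mulrA mulVf // mul1r.
have refl_factor x : tr x -> (r * x)^-1 - p = (r * s * x)^-1 * (s - x).
  by move=> hx; rewrite pE; field; rewrite s0 r_neq0 trace_neq0.
case: k => [|k].
  exists w; split; first by apply: ci_ext c1 => x _; rewrite expr1.
  have -> : - w = -1 * w0 + w' by rewrite -ww; ring.
  apply: ci_ext (ci_lin (-1) S0_winding c2) => x hx.
  rewrite /reflect expr1 refl_factor //.
  have x1 := xs x hx; have x2 : s - x != 0 by rewrite -opprB oppr_eq0.
  have x0 := trace_neq0 hx.
  by field; rewrite x0 x1 x2 s0 r_neq0.
exists 0; split; first exact: (ci_inv_pow g_cont g_closed g_rect k (S_tr Sp)).
(* The function [- s ^+ 2 / (x - s) - s] equals [s x / (s - x)], and [r] times it is the inverse of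
   [(r x)^-1 - p]. The primitive built from it is therefore -(y - p)^-(k+1)/(k+1) with y = 1/(r x)
   substituted. *)
have P := primitive_lin (- s ^+ 2) (primitive_inv g_cont (S_tr Ss))
   (@primitive_cst _ g (- s)).
have := ci_primitive g_cont g_closed g_rect
  (primitive_lin (- r ^+ k.+1 / k.+1%:R) (primitive_pow k.+1 P) (@primitive_cst _ g 0)).
rewrite oppr0; apply: ci_ext => x hx /=.
have x1 := xs x hx; have x2 : s - x != 0 by rewrite -opprB oppr_eq0.
have x0 := trace_neq0 hx.
rewrite !addr0 /reflect refl_factor //.
have -> : - s ^+ 2 / (x - s) - s = s * x / (s - x) by field; rewrite x1 x2.
have -> : (r * s * x)^-1 * (s - x) = (r * (s * x / (s - x)))^-1.
  by field; rewrite x0 x2 s0 r_neq0.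
rewrite -[(_^-1) ^- k.+2]exprVn invrK [(_ * _) ^+ k.+2]exprMn.
rewrite !(exprS _ k.+1) !(exprS _ k).
have k0 : k.+1%:R != 0 :> R[i] by rewrite pnatr_eq0.
move: (k.+1%:R) k0 => n n0.
move: ((s * x / (s - x)) ^+ k) => y; move: (r ^+ k) => z.
by field; rewrite ?x0 ?x1 ?x2 ?r_neq0 ?n0.
Qed.

End Reflection.

(** * Infinite products and locally uniform limits of rational functions *)

Section QPochhammer.
Variable R : realType.
Variable q : R[i].
Hypothesis q_lt1 : cabs q < 1.
Implicit Types (y : R[i]) (n m : nat).

Definition qpn n y : R[i] := \prod_(0 <= j < n) (1 - y * q ^+ j).

Lemma qpn0 y : qpn 0 y = 1.
Proof. by rewrite /qpn big_geq. Qed.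

Lemma qpnSr n y : qpn n.+1 y = qpn n y * (1 - y * q ^+ n).
Proof. by rewrite /qpn big_nat_recr. Qed.

Lemma qpnS n y : qpn n.+1 y = (1 - y) * qpn n (y * q).
Proof.
rewrite /qpn big_nat_recl //= expr0 mulr1; congr (_ * _).
by apply: eq_bigr => j _; rewrite exprS mulrA.
Qed.

Lemma qpnD n m y : qpn (n + m) y = qpn n y * qpn m (y * q ^+ n).
Proof.
elim: n y => [|n IH] y; first by rewrite add0n qpn0 mul1r expr0 mulr1.
by rewrite addSn !qpnS IH mulrA exprS mulrA.
Qed.

Let cq0 : 0 <= cabs q := cabs_ge0 q.

Lemma geometric_sum_le n : \sum_(0 <= j < n) cabs q ^+ j <= (1 - cabs q)^-1.
Proof.
have h : 0 < 1 - cabs q by rewrite subr_gt0.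
rewrite -[leRHS]mul1r ler_pdivlMr //.
suff -> : (\sum_(0 <= j < n) cabs q ^+ j) * (1 - cabs q) = 1 - cabs q ^+ n.
  by have := exprn_ge0 n cq0; lra.
elim: n => [|n IH]; first by rewrite big_geq // mul0r expr0 subrr.
by rewrite big_nat_recr //= mulrDl IH exprSr; ring.
Qed.

(** The inequality [1 + x <= expR x] in each factor and a geometric series give a bound uniform in
    [n]. *)
Lemma qpn_bounded (rho : R) : 0 <= rho -> exists2 B : R, 1 <= B &
  forall n y, cabs y <= rho -> cabs (qpn n y) <= B.
Proof.
have ql := q_lt1.
move=> r0; exists (expR (rho * (1 - cabs q)^-1)).
  by rewrite -[leLHS]expR0 ler_expR mulr_ge0 // invr_ge0; lra.
move=> n y hy; rewrite /qpn cabs_prod.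
apply: (@le_trans _ _ (\prod_(0 <= j < n) expR (rho * cabs q ^+ j))).
  apply: ler_prod => j _; rewrite cabs_ge0 /=.
  apply: le_trans (cabsD _ _) _; rewrite cabs1 cabsN cabsM cabsX.
  apply: le_trans (expR_ge1Dx _); rewrite lerD2l ler_wpM2r ?exprn_ge0 //.
rewrite -expR_sum -mulr_sumr ler_expR ler_wpM2l //.
exact: geometric_sum_le.
Qed.

Lemma qpn_near1 (rho : R) : 0 <= rho -> exists2 B : R, 0 < B &
  forall n y, cabs y <= rho -> cabs (qpn n y - 1) <= B * cabs y.
Proof.
have ql := q_lt1.
move=> r0; have [B B1 hB] := qpn_bounded r0.
exists (B * (1 - cabs q)^-1).
  by rewrite mulr_gt0 ?invr_gt0; lra.
move=> n y hy.
apply: (@le_trans _ _ (B * cabs y * \sum_(0 <= j < n) cabs q ^+ j)); last first.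
  rewrite -!mulrA [_^-1 * _]mulrC ler_wpM2l ?ler_wpM2l ?cabs_ge0 ?geometric_sum_le //.
  by apply: le_trans B1; exact: ler01.
elim: n => [|n IH]; first by rewrite qpn0 subrr cabs0 big_geq // mulr0.
rewrite big_nat_recr //= mulrDr qpnSr.
have -> : qpn n y * (1 - y * q ^+ n) - 1 = (qpn n y - 1) + - (qpn n y * (y * q ^+ n)) by ring.
apply: le_trans (cabsD _ _) _; apply: lerD => //.
rewrite cabsN !cabsM cabsX mulrA ler_wpM2r ?exprn_ge0 //.
by rewrite ler_wpM2r ?cabs_ge0 // hB.
Qed.

(** The factors after the first [N] form a finite q-factorial at [y q^N], which [qpn_near1] keeps
    close to 1 uniformly in [y]. *)
Lemma qpn_cauchy (rho e : R) : 0 <= rho -> 0 < e -> exists N, forall n m y,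
  (N <= n)%N -> (N <= m)%N -> cabs y <= rho -> cabs (qpn n y - qpn m y) <= e.
Proof.
have ql := q_lt1.
move=> r0 e0; have [B B0 hB] := qpn_near1 r0; have [B' B1 hB'] := qpn_bounded r0.
have C0 : 0 < 2 * (B' * (B * (rho + 1))) by rewrite !mulr_gt0 //; lra.
have hq : 0 <= cabs q < 1 by rewrite cq0.
have [N hN] := @geometric_small _ _ (e / (2 * (B' * (B * (rho + 1))))) hq ltac:(by rewrite divr_gt0).
have half n y : (N <= n)%N -> cabs y <= rho -> cabs (qpn n y - qpn N y) <= e / 2.
  move=> hn hy; rewrite -(subnKC hn) qpnD.
  have -> : forall a b : R[i], a * b - a = a * (b - 1) by move=> a b; ring.
  have qN : cabs q ^+ N <= 1 by rewrite exprn_ile1 // ltW.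
  have y0 := cabs_ge0 y; have qN0 := exprn_ge0 N cq0.
  have hyq : cabs (y * q ^+ N) <= rho.
    by rewrite cabsM cabsX; apply: le_trans hy; rewrite ler_piMr.
  rewrite cabsM.
  apply: (@le_trans _ _ (B' * (B * (cabs y * cabs q ^+ N)))).
    apply: ler_pM; rewrite ?cabs_ge0 ?hB' //.
    by apply: le_trans (hB _ _ hyq) _; rewrite cabsM cabsX.
  apply: (@le_trans _ _ (B' * (B * ((rho + 1) * (e / (2 * (B' * (B * (rho + 1)))))))) ).
    rewrite !ler_wpM2l //; try lra.
    apply: ler_pM => //; try lra.
    exact: hN.
  rewrite le_eqVlt; apply/orP; left; apply/eqP; field.
  by rewrite !gt_eqF //; lra.
exists N => n m y hn hm hy.
have h1 := half n y hn hy; have h2 := half m y hm hy.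
have -> : qpn n y - qpn m y = (qpn n y - qpn N y) - (qpn m y - qpn N y) by ring.
by apply: le_trans (cabsD _ _) _; rewrite cabsN; lra.
Qed.

Lemma qpoch_unif (rho e : R) : 0 <= rho -> 0 < e -> exists N, forall n y,
  (N <= n)%N -> cabs y <= rho -> cabs (qpn n y - qpoch q y) <= e.
Proof.
have ql := q_lt1.
move=> r0 e0; have [N hN] := qpn_cauchy r0 (e := e / 2) ltac:(lra).
exists N => n y hn hy.
have [|l hl] := @cabs_cauchy_cvg _ (fun n => qpn n y).
  move=> e' e'0; have [M hM] := qpn_cauchy r0 e'0.
  by exists M => a b ha hb; apply: hM.
have -> : qpoch q y = l by apply: cvg_cabs hl.
have [M hM] := hl (e / 2) ltac:(lra).
have h1 := hN n (maxn N M) y hn (leq_maxl _ _) hy.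
have h2 := hM (maxn N M) (leq_maxr _ _).
have -> : qpn n y - l = (qpn n y - qpn (maxn N M) y) + (qpn (maxn N M) y - l) by ring.
by apply: le_trans (cabsD _ _) _; lra.
Qed.

Lemma qpn_cvg y (e : R) : 0 < e -> exists N, forall n, (N <= n)%N ->
  cabs (qpn n y - qpoch q y) <= e.
Proof.
move=> e0; have [N hN] := qpoch_unif (cabs_ge0 y) e0.
by exists N => n hn; apply: hN.
Qed.

Lemma cabs_small_eq0 y : (forall e : R, 0 < e -> cabs y <= e) -> y = 0.
Proof.
move=> h; apply/eqP; rewrite -cabs_eq0; apply: contraT => hn.
have y0 : 0 < cabs y by rewrite lt_def hn cabs_ge0.
by have := h (cabs y / 2) ltac:(lra); lra.
Qed.

Lemma qpochS y : qpoch q y = (1 - y) * qpoch q (y * q).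
Proof.
apply/eqP; rewrite -subr_eq0; apply/eqP; apply: cabs_small_eq0 => e e0.
have c0 := cabs_ge0 (1 - y).
have e1 : 0 < e / 2 / (cabs (1 - y) + 1) by rewrite !divr_gt0 //; lra.
have [N1 h1] := qpn_cvg y (e := e / 2) ltac:(lra).
have [N2 h2] := qpn_cvg (y * q) e1.
have k1 := h1 (maxn N1 N2).+1 ltac:(by apply: leqW; exact: leq_maxl).
have k2 := h2 (maxn N1 N2) ltac:(exact: leq_maxr).
move: k1; rewrite qpnS; set a := qpn _ _ in k2 * => k1.
have -> : qpoch q y - (1 - y) * qpoch q (y * q) =
  - ((1 - y) * a - qpoch q y) + (1 - y) * (a - qpoch q (y * q)) by ring.
apply: le_trans (cabsD _ _) _; rewrite cabsN cabsM.
suff : cabs (1 - y) * cabs (a - qpoch q (y * q)) <= e / 2 by lra.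
apply: (@le_trans _ _ ((cabs (1 - y) + 1) * (e / 2 / (cabs (1 - y) + 1)))).
  by apply: ler_pM; rewrite ?cabs_ge0 //; lra.
by rewrite mulrC mulfVK //; lra.
Qed.

Lemma qpoch_split n y : qpoch q y = qpn n y * qpoch q (y * q ^+ n).
Proof.
elim: n => [|n IH]; first by rewrite qpn0 mul1r expr0 mulr1.
by rewrite qpnSr IH [qpoch q (y * q ^+ n)]qpochS exprSr !mulrA.
Qed.

Lemma qpoch_bounded (rho : R) : 0 <= rho -> exists2 B : R, 0 < B &
  forall y, cabs y <= rho -> cabs (qpoch q y) <= B.
Proof.
move=> r0; have [B B1 hB] := qpn_bounded r0.
have [N hN] := @qpoch_unif rho 1 r0 ltr01.
exists (B + 1); first by lra.
move=> y hy; have k1 := hN N y (leqnn _) hy; have k2 := hB N y hy.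
by have := cabs_le_dist (qpoch q y) (qpn N y); rewrite cabsB; lra.
Qed.

Lemma qpoch_near1 : exists2 d : R, 0 < d & forall y, cabs y <= d ->
  1 / 2 <= cabs (qpoch q y).
Proof.
have [B B0 hB] := @qpn_near1 1 ler01.
exists (Num.min 1 (1 / 4 / B)); first by rewrite lt_min ltr01 !divr_gt0.
move=> y; rewrite le_min => /andP[y1 y2].
have [N hN] := @qpoch_unif 1 (1 / 4) ler01 ltac:(lra).
have k1 := hN N y (leqnn _) y1; have k2 := hB N y y1.
have k3 : B * cabs y <= 1 / 4 by rewrite mulrC -ler_pdivlMr.
have := cabs_le_dist 1 (qpn N y); have := cabs_le_dist (qpn N y) (qpoch q y).
by rewrite cabs1 (cabsB 1); lra.
Qed.

Lemma expr_small (rho e : R) : 0 <= rho -> 0 < e ->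
  exists N, forall n, (N <= n)%N -> rho * cabs q ^+ n <= e.
Proof.
have ql := q_lt1.
move=> r0 e0; have hq : 0 <= cabs q < 1 by rewrite cq0.
have [N hN] := @geometric_small _ _ (e / (rho + 1)) hq ltac:(by rewrite divr_gt0 //; lra).
exists N => n /hN k.
apply: (@le_trans _ _ ((rho + 1) * (e / (rho + 1)))).
  by apply: ler_pM; rewrite ?exprn_ge0 //; lra.
by rewrite mulrC mulfVK //; lra.
Qed.

Lemma qpoch_neq0 y : (forall j, y * q ^+ j != 1) -> qpoch q y != 0.
Proof.
move=> hy; have [d d0 hd] := qpoch_near1.
have [N hN] := expr_small (cabs_ge0 y) d0.
rewrite (qpoch_split N) mulf_neq0 //.
  by rewrite /qpn prodf_seq_neq0; apply/allP => j _ /=; rewrite subr_eq0 eq_sym.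
rewrite -cabs_gt0; have := hd (y * q ^+ N).
by rewrite cabsM cabsX => /(_ (hN N (leqnn _))); lra.
Qed.

End QPochhammer.

Section UniformRational.
Variable R : realType.
Implicit Types (S K : set R[i]) (F u : R[i] -> R[i]).

(** A substitute for compactness inside the complement of [S]; it is applied to the trace, to the
    trace with one point added, and to the trace together with its image under a reflection. *)
Definition separated S K := (exists B : R, forall x, K x -> cabs x <= B) /\
  forall p, S p -> exists2 m : R, 0 < m & forall x, K x -> m <= cabs (x - p).

Definition bounded_on K F := exists B : R, forall x, K x -> cabs (F x) <= B.

Definition brational S F :=
  rational S F /\ forall K, separated S K -> bounded_on K F.

(* Locally uniform limits of rational functions with poles in S, on which
   contour integrals can be computed by partial fractions. *)
Definition approx S F := forall K, separated S K -> bounded_on K F /\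
  forall e : R, 0 < e -> exists2 F', rational S F' &
    forall x, K x -> cabs (F x - F' x) <= e.

Lemma separated_notin S K x : separated S K -> K x -> ~ S x.
Proof. by move=> [_ h] hx /h [m m0 /(_ x hx)]; rewrite subrr cabs0; lra. Qed.

Lemma bounded_on_ge0 K F : bounded_on K F -> exists2 B : R, 0 < B &
  forall x, K x -> cabs (F x) <= B.
Proof.
move=> [B hB]; exists (`|B| + 1); first by have := normr_ge0 B; lra.
by move=> x /hB; have := ler_norm B; lra.
Qed.

Lemma bounded_on_mul K F F' : bounded_on K F -> bounded_on K F' ->
  bounded_on K (fun x => F x * F' x).
Proof.
move=> [B hB] [B' hB']; exists (B * B') => x hx.
by rewrite cabsM; apply: ler_pM; rewrite ?cabs_ge0 // ?hB ?hB'.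
Qed.

Lemma bounded_on_ext S K F F' : separated S K -> (forall x, ~ S x -> F x = F' x) ->
  bounded_on K F -> bounded_on K F'.
Proof.
move=> hK h [B hB]; exists B => x hx; rewrite -h; first exact: hB.
exact: separated_notin hx.
Qed.

Lemma approx_brational S F : brational S F -> approx S F.
Proof.
move=> [h1 h2] K hK; split; first exact: h2.
by move=> e e0; exists F => // x _; rewrite subrr cabs0 ltW.
Qed.

Lemma brational_ext S F F' : (forall x, ~ S x -> F x = F' x) -> brational S F ->
  brational S F'.
Proof.
move=> h [h1 h2]; split; first exact: rational_ext h1.
by move=> K hK; apply: bounded_on_ext h (h2 K hK).
Qed.

Lemma approx_ext S F F' : (forall x, ~ S x -> F x = F' x) -> approx S F ->
  approx S F'.
Proof.
move=> h hF K hK; have [h1 h2] := hF K hK; split.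
  exact: bounded_on_ext h h1.
move=> e /h2 [G hG hh]; exists G => // x hx; rewrite -h ?hh //.
exact: separated_notin hx.
Qed.

Lemma brational_cst S c : brational S (fun=> c).
Proof. by split; [exact: rational_cst | exists (cabs c)]. Qed.

Lemma brational_id S : brational S id.
Proof. by split; [exact: rational_id | move=> K []]. Qed.

Lemma brational_mul S F F' : brational S F -> brational S F' ->
  brational S (fun x => F x * F' x).
Proof.
move=> [h1 h2] [h1' h2']; split; first exact: rational_mul.
by move=> K hK; apply: bounded_on_mul; [apply: h2 | apply: h2'].
Qed.

Lemma brational_1B S F : brational S F -> brational S (fun x => 1 - F x).
Proof.
move=> [[P [s [hs hF]]] h2]; split.
  exists (\prod_(p <- s) ('X - p%:P) - P), s; split=> // x hx.
  rewrite hF // hornerD hornerN horner_roots_prod.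
  by rewrite mulrBl divff //; apply: roots_prod_neq0 hs hx.
move=> K /h2 [B hB]; exists (1 + B) => x hx.
by apply: le_trans (cabsD _ _) _; rewrite cabs1 cabsN lerD2l hB.
Qed.

Lemma brational_invB S p : S p -> brational S (fun x => (x - p)^-1).
Proof.
move=> Sp; split; first exact: rational_invB.
move=> K [_ /(_ p Sp) [m m0 hm]]; exists m^-1 => x hx.
have k := hm x hx.
by rewrite cabsV lef_pV2 ?qualifE //=; apply: lt_le_trans k.
Qed.

Lemma brational_inv S : S 0 -> brational S (fun x => x^-1).
Proof.
by move=> /brational_invB; apply: brational_ext => x _; rewrite subr0.
Qed.

Lemma approx_mul S F F' : approx S F -> approx S F' ->
  approx S (fun x => F x * F' x).
Proof.
move=> hF hF' K hK; have [b1 h1] := hF K hK; have [b2 h2] := hF' K hK.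
split; first exact: bounded_on_mul.
have [B1 B10 hB1] := bounded_on_ge0 b1; have [B2 B20 hB2] := bounded_on_ge0 b2.
move=> e e0.
have [G rG hG] := h1 (e / 2 / (B2 + 1)) ltac:(by rewrite !divr_gt0 //; lra).
have [G' rG' hG'] := h2 (Num.min 1 (e / 2 / B1)) ltac:(by rewrite lt_min ltr01 !divr_gt0).
exists (fun x => G x * G' x); first exact: rational_mul.
move=> x hx.
have := hG' x hx; rewrite le_min => /andP[k1 k2].
have k3 := hG x hx; have k4 := hB1 x hx; have k5 := hB2 x hx.
have k6 : cabs (G' x) <= B2 + 1.
  by have := cabs_le_dist (G' x) (F' x); rewrite cabsB; lra.
have -> : F x * F' x - G x * G' x = F x * (F' x - G' x) + (F x - G x) * G' x by ring.
apply: le_trans (cabsD _ _) _; rewrite !cabsM.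
have q1 : cabs (F x) * cabs (F' x - G' x) <= B1 * (e / 2 / B1).
  by apply: ler_pM; rewrite ?cabs_ge0.
have q2 : cabs (F x - G x) * cabs (G' x) <= (e / 2 / (B2 + 1)) * (B2 + 1).
  by apply: ler_pM; rewrite ?cabs_ge0.
move: q1 q2; rewrite mulfVK ?gt_eqF //; last by lra.
rewrite [B1 * _]mulrC mulfVK ?gt_eqF //; lra.
Qed.

Variable q : R[i].
Hypothesis q_lt1 : cabs q < 1.

Lemma rational_qpn S u n : brational S u -> rational S (fun x => qpn q n (u x)).
Proof.
move=> hu; apply: rational_prod => j.
have [] // := brational_1B (brational_mul hu (brational_cst S (q ^+ j))).
Qed.

Lemma approx_qpoch S u : brational S u -> approx S (fun x => qpoch q (u x)).
Proof.
move=> hu K hK; have [_ /(_ K hK) /bounded_on_ge0 [B B0 hB]] := hu.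
split.
  have [B' B'0 hB'] := qpoch_bounded q_lt1 (ltW B0).
  by exists B' => x /hB /hB'.
move=> e e0; have [N hN] := qpoch_unif q_lt1 (ltW B0) e0.
exists (fun x => qpn q N (u x)); first exact: rational_qpn.
by move=> x /hB hx; rewrite cabsB; apply: hN.
Qed.

(** What matters is a lower bound for the product on [K]: the first [N] factors have bounded
    inverses by assumption, and the remaining infinite product has modulus at least 1/2. Convergence
    of the partial products then passes to their inverses. *)
Lemma approx_qpoch_inv S u : brational S u ->
  (forall x j, ~ S x -> 1 - u x * q ^+ j != 0) ->
  (forall j, brational S (fun x => (1 - u x * q ^+ j)^-1)) ->
  approx S (fun x => (qpoch q (u x))^-1).
Proof.
move=> hu hn hi K hK; have [_ /(_ K hK) /bounded_on_ge0 [B B0 hB]] := hu.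
have [c c0 hc] : exists2 c : R, 0 < c & forall x, K x -> c <= cabs (qpoch q (u x)).
  have [d d0 hd] := qpoch_near1 q_lt1.
  have [N hN] := expr_small q_lt1 (ltW B0) d0.
  have [c c0 hc] : exists2 c : R, 0 < c & forall x, K x -> c <= cabs (qpn q N (u x)).
    elim: (N) => [|n [c c0 hc]].
      by exists 1 => // x _; rewrite qpn0 cabs1.
    have [_ /(_ K hK) /bounded_on_ge0 [b b0 hb]] := hi n.
    exists (c * b^-1); first by rewrite divr_gt0.
    move=> x hx; rewrite qpnSr cabsM.
    apply: ler_pM; rewrite ?(ltW c0) ?invr_ge0 ?(ltW b0) ?hc //.
    have h0 : 0 < cabs (1 - u x * q ^+ n).
      by rewrite cabs_gt0 hn //; apply: separated_notin hx.
    have := hb x hx; rewrite cabsV => k.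
    by rewrite -[leRHS]invrK lef_pV2 ?qualifE //= invr_gt0.
  exists (c * (1 / 2)); first by lra.
  move=> x hx; rewrite (qpoch_split q_lt1 N) cabsM; apply: ler_pM; rewrite ?hc ?(ltW c0) //.
  apply: hd; rewrite cabsM cabsX; apply: le_trans (hN N (leqnn _)).
  by rewrite ler_wpM2r ?exprn_ge0 ?cabs_ge0 ?hB.
split.
  exists c^-1 => x hx; have k := hc x hx.
  by rewrite cabsV lef_pV2 ?qualifE //=; apply: lt_le_trans k.
move=> e e0.
have e1 : 0 < Num.min (c / 2) (e * (c * (c / 2))).
  by rewrite lt_min !mulr_gt0 //; lra.
have [N hN] := qpoch_unif q_lt1 (ltW B0) e1.
exists (fun x => (qpn q N (u x))^-1).
  apply: (@rational_ext _ S (fun x => \prod_(0 <= j < N) (1 - u x * q ^+ j)^-1)).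
    by move=> x _; rewrite /qpn prodfV.
  by apply: rational_prod => j; have [] := hi j.
move=> x hx; have := hN N (u x) (leqnn _) (hB x hx).
rewrite le_min => /andP[k1 k2]; have k3 := hc x hx.
have k4 : c / 2 <= cabs (qpn q N (u x)).
  by have := cabs_le_dist (qpoch q (u x)) (qpn q N (u x)); rewrite cabsB; lra.
have n1 : qpoch q (u x) != 0 by rewrite -cabs_gt0; lra.
have n2 : qpn q N (u x) != 0 by rewrite -cabs_gt0; lra.
have -> : (qpoch q (u x))^-1 - (qpn q N (u x))^-1 =
  (qpn q N (u x) - qpoch q (u x)) / (qpoch q (u x) * qpn q N (u x)).
  by field; rewrite n1 n2.
rewrite cabsM cabsV cabsM ler_pdivrMr ?mulr_gt0 ?cabs_gt0 //.
apply: le_trans k2 _; rewrite ler_wpM2l ?(ltW e0) //.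
by apply: ler_pM; lra.
Qed.

Lemma approx_qpoch_inv_scale S c : (forall j, S (c * q ^+ j)^-1) ->
  c != 0 -> q != 0 -> approx S (fun x => (qpoch q (c * x))^-1).
Proof.
move=> hS c0 q0.
have nz j : c * q ^+ j != 0 by rewrite mulf_neq0 ?expf_neq0.
have E x j : 1 - c * x * q ^+ j = - (c * q ^+ j) * (x - (c * q ^+ j)^-1).
  by rewrite mulrBr mulNr mulNr divff //; ring.
apply: approx_qpoch_inv.
- exact: brational_mul (brational_cst S c) (brational_id S).
- move=> x j hx; rewrite E mulf_neq0 ?oppr_eq0 // subr_eq0.
  by apply/eqP => h; apply: hx; rewrite h.
- move=> j; apply: brational_ext (brational_mul
    (brational_cst S (- (c * q ^+ j))^-1) (brational_invB (hS j))) => x _.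
  by rewrite E [RHS]invfM.
Qed.

Lemma approx_qpoch_inv_div S c : (forall j, S (c * q ^+ j)) -> S 0 ->
  approx S (fun x => (qpoch q (c / x))^-1).
Proof.
move=> hS S0.
have nz x : ~ S x -> x != 0 by move=> hx; apply/eqP => x0; apply: hx; rewrite x0.
have E x j : x != 0 -> 1 - c / x * q ^+ j = x^-1 * (x - c * q ^+ j).
  by move=> x0; field.
apply: approx_qpoch_inv.
- exact: brational_mul (brational_cst S c) (brational_inv S0).
- move=> x j hx; have x0 := nz x hx; rewrite E // mulf_neq0 ?invr_neq0 // subr_eq0.
  by apply/eqP => h; apply: hx; rewrite h.
- move=> j; apply: brational_ext (brational_mul
    (brational_id S) (brational_invB (hS j))) => x hx.
  by rewrite (E _ _ (nz x hx)) [RHS]invfM invrK.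
Qed.

End UniformRational.

Section ApproxIntegrals.
Variable R : realType.
Variable g : R -> R[i].
Hypothesis g_cont : {within `[0, 1], continuous g}.
Hypothesis g_closed : g 0 = g 1.
Hypothesis g_rect : rectifiable g.
Local Notation tr := (curve_trace g).
Local Notation ci := (is_contour_integral g).

Lemma separated_trace (S : set R[i]) : (forall p, S p -> ~ tr p) -> separated S tr.
Proof.
move=> h; split; first by have [B _ hB] := curve_bounded g_cont; exists B.
by move=> p /h np; apply: curve_dist.
Qed.

Lemma ci_rational_holomorphic (S : set R[i]) F : (forall p, S p -> ~ tr p) ->
  (forall p, S p -> ci (fun x => (x - p)^-1) 0) -> rational S F -> ci F 0.
Proof.
move=> hS hw; move: F; apply: partial_fractions_ind.
- by move=> f h fh; apply: ci_ext => x hx; apply: fh => /hS.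
- by move=> a f h c1 c2; have := ci_lin a c1 c2; rewrite mulr0 addr0.
- move=> k; apply: ci_ext (ci_monomial g_cont g_closed g_rect 0 k) => x _.
  by rewrite subr0.
- move=> p [|k] Sp; last exact: (ci_inv_pow g_cont g_closed g_rect k (hS _ Sp)).
  by apply: ci_ext (hw p Sp) => x _; rewrite expr1.
Qed.

(** Cauchy's integral formula. For rational [G] the difference [G x - G p] is divisible by [x - p],
    and the quotient has all its poles in [S], around which the curve does not wind; the general
    case is a uniform limit. *)
Lemma ci_cauchy (S : set R[i]) F p w : (forall z, S z -> ~ tr z) ->
  (forall z, S z -> ci (fun x => (x - z)^-1) 0) -> ~ S p -> ~ tr p ->
  ci (fun x => (x - p)^-1) w -> approx S F -> ci (fun x => F x / (x - p)) (w * F p).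
Proof.
move=> hS hw Sp np cw hF.
have rat G : rational S G -> ci (fun x => G x / (x - p)) (w * G p).
  move=> [P [s [hs hG]]].
  have /factor_theorem [T hT] : root (P - (G p) *: \prod_(z <- s) ('X - z%:P)) p.
    rewrite /root !hornerE horner_roots_prod.
    by rewrite hG // mulfVK ?subrr //; apply: roots_prod_neq0 hs Sp.
  have hT' x : P.[x] = T.[x] * (x - p) + G p * roots_prod s x.
    have := congr1 (fun Q => Q.[x]) hT; rewrite !hornerE horner_roots_prod.
    by move=> <-; ring.
  have c0 := @ci_rational_holomorphic S (fun x => T.[x] / roots_prod s x) hS hw
     (ex_intro _ T (ex_intro _ s (conj hs (fun _ _ => erefl)))).
  have := ci_lin (G p) cw c0; rewrite addr0 [G p * w]mulrC.
  apply: ci_ext => x hx; have xS : ~ S x by move=> /hS.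
  have n1 := roots_prod_neq0 hs xS.
  have n2 : x - p != 0 by rewrite subr_eq0; apply/eqP => h; apply: np; rewrite -h.
  by rewrite [G x]hG // hT'; field; rewrite n1 n2.
have [m m0 hm] := curve_dist g_cont np.
(* The approximants must be close to [F] at [p] too, since the claimed value involves [F p]. *)
have hK : separated S [set x | tr x \/ x = p].
  have [[B hB] h2] := separated_trace hS; split.
    exists (Num.max B (cabs p)) => x [/hB k|->]; rewrite le_max ?k ?lexx ?orbT //.
  move=> z Sz; have [d d0 hd] := h2 z Sz.
  have pz : 0 < cabs (p - z).
    by rewrite cabs_gt0 subr_eq0; apply/eqP => h; apply: Sp; rewrite h.
  exists (Num.min d (cabs (p - z))); first by rewrite lt_min d0.
  by move=> x [/hd k|->]; rewrite ge_min ?k ?lexx ?orbT.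
have [_ hap] := hF _ hK.
apply: ci_unif => // e e0.
have w0 := cabs_ge0 w.
have [G rG hG] := hap (Num.min (e * m) (e / (cabs w + 1)))
  ltac:(by rewrite lt_min mulr_gt0 // divr_gt0 //; lra).
exists (fun x => G x / (x - p)), (w * G p); split; first exact: rat.
  move=> x hx; have := hG x (or_introl hx); rewrite le_min => /andP[k _].
  rewrite -mulrBl cabsM cabsV.
  have k2 := hm x hx.
  have n2 : 0 < cabs (x - p) by lra.
  rewrite ler_pdivrMr //; apply: le_trans k _.
  by rewrite ler_wpM2l ?(ltW e0).
have := hG p (or_intror erefl); rewrite le_min => /andP[_ k].
rewrite -mulrBr cabsM.
apply: (@le_trans _ _ ((cabs w + 1) * (e / (cabs w + 1)))).
  by apply: ler_pM; rewrite ?cabs_ge0 //; lra.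
by rewrite mulrC mulfVK //; lra.
Qed.

Variables (S : set R[i]) (r w0 : R[i]).
Hypothesis r_neq0 : r != 0.
Hypothesis S_tr : forall p, S p -> ~ tr p.
Hypothesis S0 : S 0.
Hypothesis S0_winding : ci (fun x => x^-1) w0.
Hypothesis S_winding : forall p, S p -> p != 0 -> S (r * p)^-1 /\
  exists w w', [/\ ci (fun x => (x - p)^-1) w, ci (fun x => (x - (r * p)^-1)^-1) w'
   & w + w' = w0].

Lemma ci_reflect_approx F : approx S F ->
  exists v, ci F v /\ ci (reflect r F) (- v).
Proof.
move=> hF.
have [m m0 hm0] := curve_dist g_cont (S_tr S0).
have hm x : tr x -> m <= cabs x by move=> /hm0; rewrite subr0.
have [B B0 hB] := curve_bounded g_cont.
have r0 : 0 < cabs r by rewrite cabs_gt0.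
have nz x : tr x -> x != 0 by move=> /hm k; rewrite -cabs_gt0; lra.
(* The reflected integrand evaluates [F] on the image of the trace, so one approximant must serve
   both sets. *)
have hK : separated S [set y | tr y \/ exists2 x, tr x & y = (r * x)^-1].
  split.
    exists (Num.max B (cabs r * m)^-1) => y [/hB k|[x hx ->]]; rewrite le_max ?k //.
    rewrite cabsV cabsM lef_pV2 ?qualifE //= ?mulr_gt0 ?cabs_gt0 ?(nz x hx) //.
    by rewrite ler_pM2l // (hm x hx) orbT.
  move=> p Sp.
  have [d d0 hd] := curve_dist g_cont (S_tr Sp).
  have [c c0 hc] : exists2 c : R, 0 < c & forall x, tr x -> c <= cabs ((r * x)^-1 - p).
    have [->|p0] := eqVneq p 0.
      exists (cabs r * B)^-1; first by rewrite invr_gt0 mulr_gt0.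
      move=> x hx; rewrite subr0 cabsV cabsM lef_pV2 ?qualifE //= ?mulr_gt0 ?cabs_gt0 ?(nz x hx) //.
      by rewrite ler_pM2l // hB.
    have [Ss _] := S_winding Sp p0; set s := (r * p)^-1 in Ss.
    have s0 : s != 0 by rewrite invr_neq0 // mulf_neq0.
    have cs0 : 0 < cabs s by rewrite cabs_gt0.
    have [a a0 ha] := curve_dist g_cont (S_tr Ss).
    exists ((cabs r * cabs s * B)^-1 * a).
      by rewrite mulr_gt0 ?invr_gt0 ?mulr_gt0.
    move=> x hx.
    have -> : (r * x)^-1 - p = (r * s * x)^-1 * (s - x).
      by rewrite /s; field; rewrite p0 r_neq0 (nz x hx).
    rewrite cabsM cabsV !cabsM (cabsB s); apply: ler_pM; rewrite ?(ltW a0) ?ha //.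
      by rewrite invr_ge0 !mulr_ge0 // ltW.
    rewrite lef_pV2 ?qualifE //= ?mulr_gt0 ?cabs_gt0 ?(nz x hx) //.
    by rewrite ler_pM2l ?mulr_gt0 // hB.
  exists (Num.min d c); first by rewrite lt_min d0.
  by move=> y [/hd k|[x /hc k ->]]; rewrite ge_min k ?orbT.
have [_ hap] := hF _ hK.
have [v hv] : exists v, ci F v.
  apply: ci_unif_ex => // e /hap [G rG hG].
  have [v [cv _]] := ci_reflect g_cont g_closed g_rect r_neq0 S_tr S0 S0_winding S_winding rG.
  by exists G, v; split=> // x hx; apply: hG; left.
exists v; split=> //.
have [M M0 hM] := curve_length g_rect.
apply: ci_unif => // e e0.
pose c := cabs r * m ^+ 2.
have c0 : 0 < c by rewrite mulr_gt0 // exprn_gt0.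
have [G rG hG] := hap (Num.min (e * c) (e / M)) ltac:(by rewrite lt_min mulr_gt0 // divr_gt0).
have [w [cw1 cw2]] := ci_reflect g_cont g_closed g_rect r_neq0 S_tr S0 S0_winding S_winding rG.
exists (reflect r G), (- w); split=> //.
  move=> x hx.
  have := hG (r * x)^-1; rewrite le_min => /(_ (or_intror _ (ex_intro2 _ _ x hx erefl))).
  move=> /andP[k _].
  have -> : reflect r F x - reflect r G x = - ((F (r * x)^-1 - G (r * x)^-1) / (r * x ^+ 2)).
    by rewrite /reflect; ring.
  have cx : c <= cabs (r * x ^+ 2).
    rewrite cabsM cabsX ler_wpM2l ?(ltW r0) // ler_pXn2r ?hm // qualifE /= ?cabs_ge0 //.
    exact: ltW.
  rewrite cabsN cabsM cabsV ler_pdivrMr; last by lra.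
  by apply: le_trans k _; rewrite ler_wpM2l // ltW.
have -> : - v - - w = - (-1 * w + v) by ring.
rewrite cabsN.
have := ci_bound (e := e / M) hM _ _ (ci_lin (-1) cw1 hv).
rewrite mulfVK ?gt_eqF //; apply; first by rewrite ltW // divr_gt0.
move=> x hx; rewrite mulN1r addrC.
by have := hG x (or_introl hx); rewrite le_min => /andP[_].
Qed.

End ApproxIntegrals.

(** * The Askey-Wilson integral *)

Section ConstantTerm.
Variables (F : fieldType) (q : F).

Lemma coef_comp_scale (P : {poly F}) c i : (P \Po (c *: 'X))`_i = c ^+ i * P`_i.
Proof.
rewrite comp_polyE coef_sum.
have [iP|Pi] := ltnP i (size P); last first.
  rewrite nth_default // mulr0 big1 // => j _.
  rewrite exprZn coefZ coefZ coefXn; case: eqP => [ij|]; last by rewrite !mulr0.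
  by have := ltn_ord j; rewrite ltnNge -ij Pi.
rewrite (bigD1 (Ordinal iP)) //= big1 ?addr0.
  by rewrite exprZn coefZ coefZ coefXn eqxx mulr1 mulrC.
move=> j ji; rewrite exprZn !coefZ coefXn; case: eqP => [ij|]; last by rewrite !mulr0.
by move/eqP: ji; case; apply: val_inj.
Qed.

(** This is y^(n+1) (y, 1/y; q)_(n+1) with one factor [X - 1] removed. Without it the zeros are the
    consecutive powers q^-n, ..., q^n, each simple, so that scaling by [q] affects only the two end
    factors. *)
Let T n : {poly F} := \prod_(0 <= j < n) ('X - (q ^+ j.+1)%:P) *
  \prod_(0 <= j < n.+1) (1 - q ^+ j *: 'X).

(* The q-binomial theorem for a shifted product, in the form of its
   functional equation. *)
Let T_scale n : (T n \Po (q *: 'X)) * ('X - (q ^+ n)%:P) =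
  - (q ^+ n) *: (T n * (1 - q ^+ n.+1 *: 'X)).
Proof.
rewrite /T rmorphM /= !rmorph_prod /=.
have -> : \prod_(0 <= j < n) (('X - (q ^+ j.+1)%:P) \Po (q *: 'X)) =
   q ^+ n *: \prod_(0 <= j < n) ('X - (q ^+ j)%:P).
  elim: n => [|n IH]; first by rewrite !big_geq // scale1r.
  rewrite !big_nat_recr //= IH comp_polyB comp_polyX comp_polyC exprS polyCM.
  by rewrite -!mul_polyC polyCM; ring.
have -> : \prod_(0 <= j < n.+1) ((1 - q ^+ j *: 'X) \Po (q *: 'X)) =
  \prod_(0 <= j < n.+1) (1 - q ^+ j.+1 *: 'X).
  apply: eq_bigr => j _.
  by rewrite comp_polyB comp_polyZ comp_polyX comp_polyC scalerA -exprSr.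
have E1 : (\prod_(0 <= j < n) ('X - (q ^+ j)%:P)) * ('X - (q ^+ n)%:P) =
  ('X - 1) * \prod_(0 <= j < n) ('X - (q ^+ j.+1)%:P).
  rewrite -(big_nat_recr _ _ (fun j => 'X - (q ^+ j)%:P)) //=.
  by rewrite big_nat_recl //= expr0.
have E2 : \prod_(0 <= j < n.+1) (1 - q ^+ j *: 'X) =
   (1 - 'X) * \prod_(0 <= j < n) (1 - q ^+ j.+1 *: 'X) :> {poly F}.
  by rewrite big_nat_recl //= expr0 scale1r.
rewrite E2 big_nat_recr //= -!mul_polyC rmorphN /=.
set A := \prod_(0 <= j < n) ('X - (q ^+ j)%:P) in E1 *.
transitivity ((q ^+ n)%:P * (A * ('X - (q ^+ n)%:P)) *
  (\prod_(0 <= j < n) (1 - q ^+ j.+1 *: 'X) * (1 - (q ^+ n.+1)%:P * 'X))).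
  by ring.
by rewrite E1; ring.
Qed.

Hypothesis q_neq0 : q != 0.
Hypothesis q_nroot : forall i, q ^+ i.+1 != 1.

Let T_rec n i : (T n)`_i.+1 * q ^+ n * (1 - q ^+ i.+1) =
  (T n)`_i * (q ^+ (n.*2.+1) - q ^+ i).
Proof.
have := congr1 (fun P : {poly F} => P`_i.+1) (T_scale n).
rewrite mulrBr coefB coefMX coefMC !coef_comp_scale /=.
rewrite coefZ mulrBr mulr1 coefB -scalerAr coefZ coefMX /=.
have -> : q ^+ n.*2.+1 = q ^+ n * q ^+ n.+1 by rewrite -exprD addnS addnn.
move=> /eqP; rewrite -subr_eq0 => /eqP h; apply/eqP; rewrite -subr_eq0; apply/eqP.
by rewrite -[RHS]h; ring.
Qed.

(** The coefficient is twice the Gaussian binomial of 2n + 1 over n, stated without division;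
    [T_rec] produces the coefficients of [T n] successively from the lowest one. *)
Lemma constant_term n :
  (\prod_(0 <= j < n.+1) (1 - q ^+ j *: 'X) *
   \prod_(0 <= j < n.+1) ('X - (q ^+ j)%:P) : {poly F})`_n.+1 *
  \prod_(0 <= i < n) (1 - q ^+ i.+1) = 2 * \prod_(0 <= i < n) (1 - q ^+ (n.*2.+1 - i)).
Proof.
have -> : \prod_(0 <= j < n.+1) (1 - q ^+ j *: 'X) *
   \prod_(0 <= j < n.+1) ('X - (q ^+ j)%:P) = T n * ('X - 1) :> {poly F}.
  by rewrite [X in _ * X]big_nat_recl //= expr0 /T; ring.
have q1 i : 1 - q ^+ i.+1 != 0 by rewrite subr_eq0 eq_sym.
(* The two middle coefficients of [T n] are opposite, so multiplication by [X - 1] adds them up;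
   this is the origin of the factor 2. *)
have mid : (T n)`_n.+1 = - (T n)`_n.
  apply: (@mulIf _ (q ^+ n * (1 - q ^+ n.+1))); first by rewrite mulf_neq0 ?expf_neq0.
  by rewrite mulrA T_rec -addnn -addnS exprD; ring.
rewrite mulrBr mulr1 coefB coefMX /= mid opprK.
transitivity (2 * ((T n)`_n * \prod_(0 <= i < n) (1 - q ^+ i.+1))); first by ring.
congr (_ * _).
have h k : (k <= n)%N -> (T n)`_k * \prod_(0 <= i < k) (1 - q ^+ i.+1) * q ^+ (n * k) =
  (\prod_(0 <= i < n) - q ^+ i.+1) * \prod_(0 <= i < k) - (q ^+ i * (1 - q ^+ (n.*2.+1 - i))).
  elim: k => [|k IH] hk.
    rewrite !(big_geq (m := 0) (n := 0)) // muln0 expr0 !mulr1.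
    rewrite -horner_coef0 /T hornerM !horner_prod.
    rewrite [X in _ * X]big1 ?mulr1; last by move=> j _; rewrite !hornerE ?mulr0 ?subr0.
    by apply: eq_bigr => j _; rewrite !hornerE ?add0r ?sub0r.
  rewrite [in LHS]big_nat_recr // [X in _ = _ * X]big_nat_recr //= [RHS]mulrA -IH ?(ltnW hk) //.
  have -> : q ^+ k * (1 - q ^+ (n.*2.+1 - k)) = q ^+ k - q ^+ n.*2.+1.
    by rewrite mulrBr mulr1 -exprD subnKC // -addnn; lia.
  rewrite mulnS exprD.
  have := T_rec n k.
  set a := (T n)`_k.+1; set b := (T n)`_k => hab.
  transitivity (a * q ^+ n * (1 - q ^+ k.+1) * (\prod_(0 <= i < k) (1 - q ^+ i.+1) * q ^+ (n * k))).
    by ring.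
  by rewrite hab; ring.
have := h n (leqnn n).
have -> : \prod_(0 <= i < n) - (q ^+ i * (1 - q ^+ (n.*2.+1 - i))) =
  (\prod_(0 <= i < n) - q ^+ i) * \prod_(0 <= i < n) (1 - q ^+ (n.*2.+1 - i)).
  by rewrite -big_split /=; apply: eq_bigr => i _; rewrite mulNr.
have -> : q ^+ (n * n) = (\prod_(0 <= i < n) - q ^+ i.+1) * \prod_(0 <= i < n) - q ^+ i.
  rewrite [X in _ * X]big_nat_rev /= -big_split /=.
  rewrite (eq_big_nat _ _ (F2 := fun=> q ^+ n)); last first.
    move=> i /andP[_ hi]; rewrite mulrNN -exprD; congr (_ ^+ _); lia.
  by rewrite prodr_const_nat subn0 -exprM.
set A := \prod_(0 <= i < n) - q ^+ i.+1; set B := \prod_(0 <= i < n) - q ^+ i => hm.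
have nz (f : nat -> nat) : \prod_(0 <= i < n) - q ^+ f i != 0.
  by rewrite prodf_seq_neq0; apply/allP => i _ /=; rewrite oppr_eq0 expf_neq0.
apply: (@mulIf _ (A * B)); first by rewrite mulf_neq0 // nz.
by rewrite hm; ring.
Qed.

End ConstantTerm.

(** The weight for an arbitrary list of parameters: the recurrences shift one parameter at a time
    and then permute the list. *)
Definition aw_weight (R : realType) (q : R[i]) (es : seq R[i]) (x : R[i]) : R[i] :=
  qpoch q (x ^+ 2) * qpoch q (x ^- 2)
    / \prod_(e <- es) (qpoch q (e * x) * qpoch q (e * x^-1)).

Section AWIdentities.
Variables (F : fieldType).

(* (1 - e4) (x + 1/x) - (e1 - e3), with ei the elementary symmetric functions *)
Definition aw_kernel (a b c d x : F) : F :=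
  (1 - a * b * c * d) * (x + x^-1)
  - (a + b + c + d - (a * b * c + a * b * d + a * c * d + b * c * d)).

(** Symmetrization under x -> 1/x of a product of four linear factors. It serves twice: for the
    vanishing integral of the kernel, and for the action of the q-difference operator on the
    products (a x, a/x; q)_k. *)
Lemma aw_kernel_sym a b c d x : x != 0 ->
  x^-1 * (1 - x ^- 2) * ((1 - a * x) * (1 - b * x) * (1 - c * x) * (1 - d * x))
  + x * (1 - x ^+ 2) * ((1 - a / x) * (1 - b / x) * (1 - c / x) * (1 - d / x))
  = aw_kernel a b c d x * ((1 - x ^+ 2) * (1 - x ^- 2)).
Proof. by move=> x0; rewrite /aw_kernel; field. Qed.

(** Modulo the kernel, the factor that shifts [a] to [a q] is a constant; since the kernel
    integrates to 0, this constant is the ratio in the recurrence. *)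
Lemma aw_kernel_shift a b c d x : x != 0 ->
  (1 - a * b * c * d) * ((1 - a * x) * (1 - a / x)) =
  (1 - a * b) * (1 - a * c) * (1 - a * d) - a * aw_kernel a b c d x.
Proof. by move=> x0; rewrite /aw_kernel; field. Qed.

End AWIdentities.

Local Opaque qpoch.

(** * Existence and recurrences of the integral of the weight *)

Section AWIntegral.
Variable R : realType.
Variable g : R -> R[i].
Hypothesis g_cont : {within `[0, 1], continuous g}.
Hypothesis g_closed : g 0 = g 1.
Hypothesis g_rect : rectifiable g.
Local Notation tr := (curve_trace g).
Local Notation ci := (is_contour_integral g).
Variables (q w0 : R[i]).
Hypothesis q_neq0 : q != 0.
Hypothesis q_lt1 : cabs q < 1.
Hypothesis tr0 : ~ tr 0.
Hypothesis winding0 : ci (fun x => x^-1) w0.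
Implicit Types (es : seq R[i]) (a b c d x : R[i]).

(** The contour condition in terms of winding integrals only: [w0] around the points that must lie
    inside, 0 around those that must lie outside. *)
Definition separating es := forall e, e \in es -> e != 0 /\ forall k : nat,
  [/\ ~ tr (e * q ^+ k), ~ tr (e * q ^+ k)^-1,
      ci (fun x => (x - e * q ^+ k)^-1) w0 & ci (fun x => (x - (e * q ^+ k)^-1)^-1) 0].

Lemma separating_shift a es k : separating (a :: es) -> separating (a * q ^+ k :: es).
Proof.
move=> h e; rewrite inE => /predU1P[->|he]; last first.
  have he' : e \in a :: es by rewrite inE he orbT.
  exact: (h e he').
have [a0 ha] := h a (mem_head _ _).
split; first by rewrite mulf_neq0 ?expf_neq0.
by move=> j; have := ha (k + j)%N; rewrite exprD mulrA.
Qed.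

Arguments separating_shift [a es] k _.

Lemma separating_perm es es' : perm_eq es es' -> separating es -> separating es'.
Proof.
move=> /perm_mem h H e he; have he' : e \in es by rewrite h.
exact: (H e he').
Qed.

(** A set of possible poles stable under x -> 1/(q^s x); [s] is 0 for the weight and 1 for the
    auxiliary integrand with half of its denominator shifted. *)
Let poles s es : set R[i] := [set p | p = 0 \/ exists2 e, e \in es &
  exists k : nat, p = e * q ^+ k \/ p = (e * q ^+ (k + s))^-1].

Let poles_tr s es : separating es -> forall p, poles s es p -> ~ tr p.
Proof.
move=> h p [->//|[e he [k [->|->]]]]; have [_ H] := h e he.
  by have [] := H k.
by have [] := H (k + s)%N.
Qed.

Let poles_winding s es : separating es -> forall p, poles s es p -> p != 0 ->
  poles s es (q ^+ s * p)^-1 /\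
  exists w w', [/\ ci (fun x => (x - p)^-1) w,
     ci (fun x => (x - (q ^+ s * p)^-1)^-1) w' & w + w' = w0].
Proof.
move=> h p [->|[e he [k [->|->]]] _]; first by rewrite eqxx.
  have [e0 H] := h e he.
  have -> : q ^+ s * (e * q ^+ k) = e * q ^+ (k + s) by rewrite exprD; ring.
  split; first by right; exists e => //; exists k; right.
  exists w0, 0; have [_ _ c1 _] := H k; have [_ _ _ c2] := H (k + s)%N.
  by rewrite addr0.
have [e0 H] := h e he.
have -> : (q ^+ s * (e * q ^+ (k + s))^-1)^-1 = e * q ^+ k.
  by rewrite exprD; field; rewrite e0 !expf_neq0.
split; first by right; exists e => //; exists k; left.
exists 0, w0; have [_ _ c1 _] := H k; have [_ _ _ c2] := H (k + s)%N.
by rewrite add0r.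
Qed.

Let approx_sqr s es c : approx (poles s es) (fun x => qpoch q (c * x ^+ 2)).
Proof.
apply: approx_qpoch => //; apply: brational_mul (brational_cst _ _) _.
exact: brational_mul (brational_id _) (brational_id _).
Qed.

Let approx_sqrV s es : approx (poles s es) (fun x => qpoch q (x ^- 2)).
Proof.
apply: approx_qpoch => //.
have h := @brational_inv _ (poles s es) (or_introl erefl).
by apply: brational_ext (brational_mul h h) => x _; rewrite -exprVn.
Qed.

Let approx_den s es : separating es ->
  approx (poles s es) (fun x => (\prod_(e <- es) (qpoch q (e * q ^+ s * x) * qpoch q (e / x)))^-1).
Proof.
move=> h.
have H (es' : seq R[i]) : (forall e, e \in es' -> e \in es) ->
   approx (poles s es) (fun x => (\prod_(e <- es') (qpoch q (e * q ^+ s * x) * qpoch q (e / x)))^-1).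
  elim: es' => [|e es' IH] hes.
    apply: approx_ext (approx_brational (brational_cst _ 1)) => x _.
    by rewrite big_nil invr1.
  have he : e \in es by apply: hes; rewrite mem_head.
  have [e0 _] := h e he.
  apply: approx_ext (approx_mul (approx_mul (@approx_qpoch_inv_scale _ _ q_lt1 (poles s es) (e * q ^+ s) _ _ q_neq0)
    (@approx_qpoch_inv_div _ _ q_lt1 (poles s es) e _ (or_introl erefl))) (IH _)).
  - by move=> x _; rewrite big_cons !invfM.
  - by move=> j; right; exists e => //; exists j; right; rewrite addnC exprD mulrA.
  - by rewrite mulf_neq0 ?expf_neq0.
  - by move=> j; right; exists e => //; exists j; left.
  - by move=> z hz; apply: hes; rewrite inE hz orbT.
exact: H.
Qed.

Lemma ci_aw_weight_ex es : separating es -> exists v, ci (fun x => aw_weight q es x / x) v.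
Proof.
move=> h.
have inv0 : approx (poles 0 es) (fun x => x^-1).
  by apply: approx_brational; apply: brational_inv; left.
have A := approx_mul (approx_mul (approx_mul (@approx_sqr 0 es 1) (@approx_sqrV 0 es))
   (@approx_den 0 es h)) inv0.
have q10 : (q ^+ 0 : R[i]) != 0 by rewrite expf_neq0.
have [v [c _]] := ci_reflect_approx g_cont g_closed g_rect q10 (poles_tr h)
   (or_introl erefl) winding0 (poles_winding h) A.
exists v; apply: ci_ext c => x _; rewrite /aw_weight mul1r.
by under eq_bigr => e _ do rewrite expr0 mulr1.
Qed.

Definition aw_integral es := contour_integral g (fun x => aw_weight q es x / x).

Lemma ci_aw_weight es : separating es ->
  ci (fun x => aw_weight q es x / x) (aw_integral es).
Proof.
by move=> /ci_aw_weight_ex [v hv]; rewrite /aw_integral (contour_integralE hv).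
Qed.

Lemma aw_integral_perm es es' : perm_eq es es' -> aw_integral es = aw_integral es'.
Proof.
move=> h; rewrite /aw_integral; congr contour_integral; apply/funext => x.
by rewrite /aw_weight (perm_big _ h).
Qed.

Lemma tr_neq0 x : tr x -> x != 0.
Proof. by move=> hx; apply/eqP => x0; apply: tr0; rewrite -x0. Qed.

Lemma separating_neq es x e k : separating es -> tr x -> e \in es ->
  1 - e * q ^+ k * x != 0 /\ 1 - e * q ^+ k / x != 0.
Proof.
move=> h hx he; have [e0 /(_ k) [h1 h2 _ _]] := h e he.
have x0 := tr_neq0 hx.
have n0 : e * q ^+ k != 0 by rewrite mulf_neq0 ?expf_neq0.
split; rewrite subr_eq0 eq_sym; apply/eqP => E.
  by apply: h2; rewrite -[_^-1]mulr1 -E mulKf.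
by apply: h1; rewrite -[_ * _](mulfVK x0) E mul1r.
Qed.

Lemma separating_qpn es x e k : separating es -> tr x -> e \in es ->
  qpn q k (e * x) != 0 /\ qpn q k (e / x) != 0.
Proof.
move=> h hx he; split; rewrite /qpn prodf_seq_neq0; apply/allP => j _ /=.
  by have [+ _] := separating_neq j h hx he; rewrite mulrAC.
by have [_ +] := separating_neq j h hx he; rewrite mulrAC.
Qed.

Lemma aw_weight_shift a es k x : separating (a :: es) -> tr x ->
  aw_weight q (a * q ^+ k :: es) x =
  qpn q k (a * x) * qpn q k (a / x) * aw_weight q (a :: es) x.
Proof.
move=> h hx; have [n1 n2] := separating_qpn k h hx (mem_head _ _).
rewrite /aw_weight !big_cons; move: (qpoch q (x ^+ 2) * qpoch q (x ^- 2)) => W.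
rewrite (qpoch_split q_lt1 k (a * x)) (qpoch_split q_lt1 k (a / x)).
rewrite (mulrAC a x) (mulrAC a _ (q ^+ k)) !invfM.
move: (qpn q k (a * x)) (qpn q k (a / x)) n1 n2 => A B n1 n2.
transitivity ((A / A) * (B / B) * (W *
  ((qpoch q (a * q ^+ k * x))^-1 * (qpoch q (a * q ^+ k / x))^-1 *
   (\prod_(j <- es) (qpoch q (j * x) * qpoch q (j / x)))^-1))).
  by rewrite !divff // !mul1r.
by ring.
Qed.

(* x |-> 1/(q x) sends G to -G and exchanges the two families of poles, so that
   the integral of G(x)/x vanishes; x |-> 1/x turns it into that of G(1/x)/x. *)
Lemma ci_aw_kernel a b c d : separating [:: a; b; c; d] ->
  ci (fun x => aw_kernel a b c d x * aw_weight q [:: a; b; c; d] x / x) 0.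
Proof.
set es := [:: a; b; c; d] => h.
(* With [e x] replaced by [e q x] in half of the denominator, x -> 1/(q x) exchanges the two
   halves. *)
pose G x := x^-1 * (qpoch q (q * x ^+ 2) * qpoch q (x ^- 2))
  * (\prod_(e <- es) (qpoch q (e * q ^+ 1 * x) * qpoch q (e / x)))^-1.
have H1 : approx (poles 1 es) (fun x => G x / x).
  have inv0 : approx (poles 1 es) (fun x => x^-1).
    by apply: approx_brational; apply: brational_inv; left.
  exact: approx_mul (approx_mul (approx_mul inv0 (approx_mul (@approx_sqr 1 es q)
    (@approx_sqrV 1 es))) (@approx_den 1 es h)) inv0.
(* The same integrand is also reflected by x -> 1/x, which requires the larger pole set. *)
have sub01 : poles 1 es `<=` poles 0 es.
  move=> p [->|[e he [k [->|->]]]]; [by left|right; exists e => //..].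
    by exists k; left.
  by exists (k + 1)%N; right; rewrite addn0.
have H0 : approx (poles 0 es) (fun x => G x / x).
  have inv0 : approx (poles 0 es) (fun x => x^-1).
    by apply: approx_brational; apply: brational_inv; left.
  have den : approx (poles 0 es)
     (fun x => (\prod_(e <- es) (qpoch q (e * q ^+ 1 * x) * qpoch q (e / x)))^-1).
    move=> K [K1 K2]; have [] := @approx_den 1 es h K.
      by split=> // p /sub01; exact: K2.
    move=> bd ap; split=> // e /ap [F' hF hh]; exists F' => //.
    exact: rational_sub sub01 hF.
  exact: approx_mul (approx_mul (approx_mul inv0 (approx_mul (@approx_sqr 0 es q)
    (@approx_sqrV 0 es))) den) inv0.
have q11 : (q ^+ 1 : R[i]) != 0 by rewrite expr1.
have q10 : (q ^+ 0 : R[i]) != 0 by rewrite expr0 oner_eq0.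
have [v [c1 c2]] := ci_reflect_approx g_cont g_closed g_rect q11 (poles_tr h)
   (or_introl erefl) winding0 (poles_winding h) H1.
have Ganti x : x != 0 -> G (q * x)^-1 = - G x.
  move=> x0.
  (* In this form every factor is invariant under y -> 1/(q y) except [y^-1 - q * y], which changes
     sign. *)
  have gE y : y != 0 -> G y = (y^-1 - q * y) * (qpoch q (q ^+ 2 * y ^+ 2) * qpoch q (y ^- 2))
     * (\prod_(e <- es) (qpoch q (e * q * y) * qpoch q (e / y)))^-1.
    move=> y0; rewrite /G expr1 (qpochS q_lt1 (q * y ^+ 2)).
    have -> : q * y ^+ 2 * q = q ^+ 2 * y ^+ 2 by ring.
    by congr (_ * _); field.
  rewrite !gE ?invr_neq0 ?mulf_neq0 //.
  have -> : q ^+ 2 * (q * x)^-1 ^+ 2 = x ^- 2 by field; rewrite x0 q_neq0.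
  have -> : (q * x)^-1 ^- 2 = q ^+ 2 * x ^+ 2 by field; rewrite x0 q_neq0.
  have -> : \prod_(e <- es) (qpoch q (e * q * (q * x)^-1) * qpoch q (e / (q * x)^-1)) =
      \prod_(e <- es) (qpoch q (e * q * x) * qpoch q (e / x)).
    apply: eq_bigr => e _; rewrite mulrC; congr (qpoch q _ * qpoch q _).
      by field; rewrite x0 q_neq0.
    by field; rewrite x0 q_neq0.
  by rewrite invrK; move: (\prod_(e <- es) _)^-1 => D; field; rewrite x0 q_neq0.
have v0 : v = 0.
  have : v = - v.
    apply: (@ci_unique _ g (fun x => G x / x)) => //.
    apply: ci_ext c2 => x hx; have x0 := tr_neq0 hx.
    by rewrite /reflect expr1 Ganti //; field; rewrite x0 q_neq0.
  by move/eqP; rewrite -addr_eq0 -mulr2n mulrn_eq0 /= => /eqP.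
have [w [c3 c4]] := ci_reflect_approx g_cont g_closed g_rect q10 (poles_tr h)
   (or_introl erefl) winding0 (poles_winding h) H0.
have w0' : w = 0 by rewrite -v0; apply: ci_unique c3 c1.
move: c4; rewrite w0' oppr0 => c4.
have := ci_lin (-1) c4 c3; rewrite w0' mulr0 addr0.
apply: ci_ext => x hx; have x0 := tr_neq0 hx.
rewrite /reflect expr0 mul1r.
have -> : -1 * (- (G x^-1 / x^-1) / (1 * x ^+ 2)) + G x / x = (G x + G x^-1) / x.
  by field.
congr (_ / _).
have den (f f' : R[i] -> R[i]) : (\prod_(e <- es) (f e * f' e))^-1 =
    (f a)^-1 * (f b)^-1 * (f c)^-1 * (f d)^-1 * ((f' a)^-1 * (f' b)^-1 * (f' c)^-1 * (f' d)^-1).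
  by rewrite /es !big_cons big_nil mulr1 !invfM; ring.
have q2 y : qpoch q y = (1 - y) * qpoch q (q * y) by rewrite (qpochS q_lt1) mulrC [y * q]mulrC mulrC.
have ia : a \in es by rewrite inE eqxx.
have ib : b \in es by rewrite !inE eqxx orbT.
have ic : c \in es by rewrite !inE eqxx !orbT.
have id : d \in es by rewrite !inE eqxx !orbT.
pose S := qpoch q (q * x ^+ 2) * qpoch q (q * x ^- 2) /
   \prod_(e <- es) (qpoch q (e * x) * qpoch q (e * x^-1)).
have E1 : G x = x^-1 * (1 - x ^- 2) * ((1 - a * x) * (1 - b * x) * (1 - c * x) * (1 - d * x)) * S.
  rewrite /G /S (q2 (x ^- 2)) !den !expr1.
  have sp e : e \in es -> (qpoch q (e * q * x))^-1 = (1 - e * x) * (qpoch q (e * x))^-1.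
    move=> he; have [n1 _] := separating_neq 0 h hx he.
    rewrite (qpochS q_lt1 (e * x)) (mulrAC e x) invfM mulrA divff ?mul1r //.
    by move: n1; rewrite expr0 mulr1.
  rewrite (sp a ia) (sp b ib) (sp c ic) (sp d id).
  by ring.
have E2 : G x^-1 = x * (1 - x ^+ 2) * ((1 - a / x) * (1 - b / x) * (1 - c / x) * (1 - d / x)) * S.
  rewrite /G /S !exprVn !invrK (q2 (x ^+ 2)) !den !expr1.
  have sp e : e \in es -> (qpoch q (e * q / x))^-1 = (1 - e / x) * (qpoch q (e / x))^-1.
    move=> he; have [_ n1] := separating_neq 0 h hx he.
    rewrite (qpochS q_lt1 (e / x)) (mulrAC e _ q) invfM mulrA divff ?mul1r //.
    by move: n1; rewrite expr0 mulr1.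
  rewrite (sp a ia) (sp b ib) (sp c ic) (sp d id).
  by ring.
rewrite E1 E2 -mulrDl aw_kernel_sym // -mulrA; congr (_ * _).
rewrite /S /aw_weight (q2 (x ^+ 2)) (q2 (x ^- 2)).
by ring.
Qed.

Lemma aw_integral_shift a b c d : separating [:: a; b; c; d] ->
  (1 - a * b * c * d) * aw_integral [:: a * q; b; c; d] =
  (1 - a * b) * (1 - a * c) * (1 - a * d) * aw_integral [:: a; b; c; d].
Proof.
move=> h.
have c1 := ci_aw_weight h.
have h' : separating [:: a * q; b; c; d] by have := separating_shift 1 h.
have c2 := ci_scale g_cont g_closed g_rect (1 - a * b * c * d) (ci_aw_weight h').
apply: ci_unique c2 _.
have := ci_lin ((1 - a * b) * (1 - a * c) * (1 - a * d)) c1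
  (ci_scale g_cont g_closed g_rect (- a) (ci_aw_kernel h)).
rewrite mulr0 addr0; apply: ci_ext => x hx.
have := @aw_weight_shift a [:: b; c; d] 1 x h hx.
rewrite expr1 => ->; rewrite !qpnSr !qpn0 !mul1r expr0 !mulr1.
rewrite !mulrA -[(1 - a * b * c * d) * (1 - a * x) * _]mulrA aw_kernel_shift ?tr_neq0 //.
by ring.
Qed.

Lemma aw_integral_shiftn a b c d k : separating [:: a; b; c; d] ->
  qpn q k (a * b * c * d) * aw_integral [:: a * q ^+ k; b; c; d] =
  qpn q k (a * b) * qpn q k (a * c) * qpn q k (a * d) * aw_integral [:: a; b; c; d].
Proof.
move=> h; elim: k => [|k IH]; first by rewrite !qpn0 expr0 mulr1 !mul1r.
have E := aw_integral_shift (separating_shift k h).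
have aq : a * q ^+ k * q = a * q ^+ k.+1 by rewrite exprSr mulrA.
rewrite aq in E; rewrite !qpnSr -mulrA.
have -> : 1 - a * b * c * d * q ^+ k = 1 - a * q ^+ k * b * c * d by ring.
rewrite E mulrCA IH; ring.
Qed.

(** After [a] has been shifted by [q^k], shifting [b] meets the product [a b q^k], so the factors in
    [a b] accumulate to length [k + l]; likewise for [a b c d]. *)
Lemma aw_integral_shift2 a b c d k l : separating [:: a; b; c; d] ->
  qpn q (k + l) (a * b * c * d) * aw_integral [:: a * q ^+ k; b * q ^+ l; c; d] =
  qpn q (k + l) (a * b) * qpn q k (a * c) * qpn q k (a * d) *
  qpn q l (b * c) * qpn q l (b * d) * aw_integral [:: a; b; c; d].
Proof.
move=> h; have := aw_integral_shiftn k h => E1.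
have pm (x y : R[i]) : perm_eq [:: x; y; c; d] [:: y; x; c; d].
  by apply/permP => P /=; rewrite addnCA.
have h' : separating [:: b; a * q ^+ k; c; d].
  by apply: separating_perm (pm _ _) _; exact: separating_shift.
have := aw_integral_shiftn l h'.
rewrite (aw_integral_perm (pm b (a * q ^+ k))).
rewrite (aw_integral_perm (pm (b * q ^+ l) (a * q ^+ k))) => E2.
rewrite !qpnD -mulrA.
have -> : a * b * c * d * q ^+ k = b * (a * q ^+ k) * c * d by ring.
rewrite E2.
have -> : b * (a * q ^+ k) = a * b * q ^+ k by ring.
transitivity (qpn q l (a * b * q ^+ k) * qpn q l (b * c) * qpn q l (b * d) *
  (qpn q k (a * b * c * d) * aw_integral [:: a * q ^+ k; b; c; d])); first by ring.
by rewrite E1; ring.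
Qed.

(** Multiplication by this product turns the weight with parameter [a] into the one with [a q^k], so
    its integrals are shifted integrals. *)
Definition aw_phi a k x : R[i] := qpn q k (a * x) * qpn q k (a / x).

Lemma ci_aw_phi2 a b c d k l : separating [:: a; b; c; d] ->
  ci (fun x => aw_phi a k x * aw_phi b l x * aw_weight q [:: a; b; c; d] x / x)
    (aw_integral [:: a * q ^+ k; b * q ^+ l; c; d]).
Proof.
move=> h.
have pm (x y : R[i]) : perm_eq [:: x; y; c; d] [:: y; x; c; d].
  by apply/permP => P /=; rewrite addnCA.
have h1 : separating [:: b; a; c; d] by apply: separating_perm (pm _ _) h.
have h2 : separating [:: a; b * q ^+ l; c; d].
  by apply: separating_perm (pm _ _) _; exact: separating_shift.
have := ci_aw_weight (separating_shift k h2).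
apply: ci_ext => x hx.
have wp y z : aw_weight q [:: y; z; c; d] x = aw_weight q [:: z; y; c; d] x.
  by rewrite /aw_weight; congr (_ / _); apply: perm_big; exact: pm.
rewrite (aw_weight_shift k h2 hx) (wp a (b * q ^+ l)) (aw_weight_shift l h1 hx) (wp b).
by move: (aw_weight _ _ _) => W; rewrite /aw_phi !mulrA.
Qed.

End AWIntegral.

(** * Non-vanishing of the integral of the weight *)

Section AWNonzero.
Variable R : realType.
Variable g : R -> R[i].
Hypothesis g_cont : {within `[0, 1], continuous g}.
Hypothesis g_closed : g 0 = g 1.
Hypothesis g_rect : rectifiable g.
Local Notation tr := (curve_trace g).
Local Notation ci := (is_contour_integral g).
Variables (q w0 : R[i]).
Hypothesis q_neq0 : q != 0.
Hypothesis q_lt1 : cabs q < 1.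
Hypothesis tr0 : ~ tr 0.
Hypothesis w0_neq0 : w0 != 0.
Hypothesis winding0 : ci (fun x => x^-1) w0.

Lemma q_nroot i : q ^+ i.+1 != 1.
Proof.
apply/eqP => h; have : cabs q ^+ i.+1 < 1 by rewrite exprn_ilt1 ?cabs_ge0.
by rewrite -cabsX h cabs1 ltxx.
Qed.

Let tends1 (F : nat -> R[i] -> R[i]) := forall e : R, 0 < e -> exists N, forall k x,
  (N <= k)%N -> tr x -> cabs (F k x - 1) <= e.

Let tends1_mul F F' : tends1 F -> tends1 F' -> tends1 (fun k x => F k x * F' k x).
Proof.
move=> h h' e e0.
have [N hN] := h (Num.min 1 (e / 2)) ltac:(by rewrite lt_min ltr01 /=; lra).
have [N' hN'] := h' (e / 4) ltac:(lra).
exists (maxn N N') => k x; rewrite geq_max => /andP[k1 k2] hx.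
have := hN k x k1 hx; rewrite le_min => /andP[b1 b2]; have b3 := hN' k x k2 hx.
have -> : F k x * F' k x - 1 = F k x * (F' k x - 1) + (F k x - 1) by ring.
apply: le_trans (cabsD _ _) _; rewrite cabsM.
have b4 : cabs (F k x) <= 2.
  by have := cabs_le_dist (F k x) 1; rewrite cabs1; lra.
have : cabs (F k x) * cabs (F' k x - 1) <= 2 * (e / 4).
  by apply: ler_pM; rewrite ?cabs_ge0.
by lra.
Qed.

Let tends1_inv F : tends1 F -> tends1 (fun k x => (F k x)^-1).
Proof.
move=> h e e0.
have [N hN] := h (Num.min (1 / 2) (e / 2)) ltac:(by rewrite lt_min; apply/andP; split; lra).
exists N => k x hk hx; have := hN k x hk hx; rewrite le_min => /andP[b1 b2].
have b3 : 1 / 2 <= cabs (F k x).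
  by have := cabs_le_dist 1 (F k x); rewrite cabs1 cabsB; lra.
have n0 : F k x != 0 by rewrite -cabs_gt0; lra.
have -> : (F k x)^-1 - 1 = - ((F k x - 1) / F k x) by field.
rewrite cabsN cabsM cabsV ler_pdivrMr; last by lra.
by apply: le_trans b2 _; rewrite ler_wpM2l //; lra.
Qed.

Let tends1_qpoch (u : R[i] -> R[i]) : bounded_on tr u ->
  tends1 (fun k x => qpoch q (u x * q ^+ k)).
Proof.
move=> /bounded_on_ge0 [B B0 hB] e e0.
have [C C0 hC] := @qpn_near1 _ _ q_lt1 B (ltW B0).
have d0 : 0 < e / 2 / C by rewrite !divr_gt0.
have [N hN] := expr_small q_lt1 (ltW B0) d0.
have [M hM] := qpoch_unif q_lt1 (ltW B0) (e := e / 2) ltac:(lra).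
exists N => k x hk hx.
have b1 : cabs (u x * q ^+ k) <= e / 2 / C.
  rewrite cabsM cabsX; apply: le_trans (hN k hk).
  by rewrite ler_wpM2r ?exprn_ge0 ?cabs_ge0 ?hB.
have b2 : cabs (u x * q ^+ k) <= B.
  rewrite cabsM cabsX; apply: le_trans (hB x hx); rewrite ler_piMr ?cabs_ge0 //.
  by rewrite exprn_ile1 ?cabs_ge0 // ltW.
have b3 := hC M _ b2; have b4 := hM M _ (leqnn _) b2.
move: b1 b3 b4; set y := u x * q ^+ k => b1 b3 b4.
have -> : qpoch q y - 1 = (qpn q M y - 1) - (qpn q M y - qpoch q y) by ring.
apply: le_trans (cabsD _ _) _; rewrite cabsN.
have : C * cabs y <= C * (e / 2 / C) by rewrite ler_wpM2l // ltW.
by rewrite [C * (_ / _)]mulrC mulfVK ?gt_eqF //; lra.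
Qed.

Let id_bounded : bounded_on tr id.
Proof. by have [B _ hB] := curve_bounded g_cont; exists B. Qed.

Let inv_bounded : bounded_on tr (fun x => x^-1).
Proof.
have [m m0 hm] := curve_dist g_cont tr0; exists m^-1 => x /hm; rewrite subr0 => k.
by rewrite cabsV lef_pV2 ?qualifE //=; lra.
Qed.

Let theta x := qpoch q (x ^+ 2) * qpoch q (x ^- 2).

Let sqr_bounded : bounded_on tr (fun x => x ^+ 2).
Proof. exact: bounded_on_mul id_bounded id_bounded. Qed.

Let sqrV_bounded : bounded_on tr (fun x => x ^- 2).
Proof.
have [B hB] := bounded_on_mul inv_bounded inv_bounded.
by exists B => x /hB; rewrite -exprVn.
Qed.

Let qpoch_comp_bounded u : bounded_on tr u -> bounded_on tr (fun x => qpoch q (u x)).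
Proof.
move=> /bounded_on_ge0 [B B0 hB]; have [C C0 hC] := qpoch_bounded q_lt1 (ltW B0).
by exists C => x /hB /hC.
Qed.

Let theta_bounded : bounded_on tr (fun x => theta x / x).
Proof.
apply: bounded_on_mul inv_bounded.
by apply: bounded_on_mul; apply: qpoch_comp_bounded.
Qed.

(** As the parameters tend to 0, the denominator of the weight tends to 1 uniformly on the trace and
    only the numerator remains. *)
Lemma ci_weight_limit (es : seq R[i]) :
  (forall k, separating g q w0 [seq e * q ^+ k | e <- es]) ->
  (forall k, aw_integral g q [seq e * q ^+ k | e <- es] = 0) ->
  ci (fun x => theta x / x) 0.
Proof.
move=> hs h0.
have T : tends1 (fun k x => \prod_(e <- es) (qpoch q (e * x * q ^+ k) * qpoch q (e / x * q ^+ k))).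
  elim: es {hs h0} => [|e es IH].
    by move=> r r0; exists 0%N => k x _ _; rewrite big_nil subrr cabs0 ltW.
  have := tends1_mul (tends1_mul (tends1_qpoch (bounded_on_mul (F := fun=> e) _ id_bounded))
    (tends1_qpoch (bounded_on_mul (F := fun=> e) _ inv_bounded))) IH.
  have bc : bounded_on tr (fun=> e) by exists (cabs e).
  move=> /(_ bc bc) H r /H [N hN]; exists N => k x hk hx.
  by rewrite big_cons; apply: hN.
have [B B0 hB] := bounded_on_ge0 theta_bounded.
apply: ci_unif => // e e0.
have [N hN] := tends1_inv T (e := e / B) ltac:(by rewrite divr_gt0).
exists (fun x => aw_weight q [seq e * q ^+ N | e <- es] x / x), 0; split.
- have := ci_aw_weight g_cont g_closed g_rect q_neq0 q_lt1 tr0 winding0 (hs N).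
  by rewrite h0.
- move=> x hx; have b1 := hN N x (leqnn _) hx; have b2 := hB x hx.
  rewrite /aw_weight big_map -/(theta x).
  have -> : \prod_(j <- es) (qpoch q (j * q ^+ N * x) * qpoch q (j * q ^+ N / x)) =
     \prod_(e <- es) (qpoch q (e * x * q ^+ N) * qpoch q (e / x * q ^+ N)).
    by apply: eq_bigr => j _; rewrite (mulrAC j _ x) (mulrAC j _ x^-1).
  move: b1; move: (\prod_(e <- es) _)^-1 => D b1.
  have -> : theta x / x - theta x * D / x = - (theta x / x * (D - 1)) by ring.
  rewrite cabsN cabsM.
  apply: le_trans (ler_pM (cabs_ge0 _) (cabs_ge0 _) b2 b1) _.
  by rewrite mulrC mulfVK // gt_eqF.
- by rewrite subrr cabs0 ltW.
Qed.

(** The constant term in y of (y, 1/y; q)_N: multiplication by y^N makes the second product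
    polynomial and moves the constant term to index [N]. *)
Let CT N : R[i] := (\prod_(0 <= j < N) (1 - q ^+ j *: 'X) *
   \prod_(0 <= j < N) ('X - (q ^+ j)%:P) : {poly R[i]})`_N.

Lemma ci_truncated_theta N :
  ci (fun x => qpn q N (x ^+ 2) * qpn q N (x ^- 2) / x) (CT N * w0).
Proof.
rewrite /CT; set P := _ * _ : {poly R[i]}.
have mono i : ci (fun x => x ^+ (2 * i) / x ^+ (2 * N).+1) (if i == N then w0 else 0).
  case: ltngtP => [iN|Ni|->].
  - have := ci_inv_pow g_cont g_closed g_rect ((2 * (N - i)).-1) tr0.
    apply: ci_ext => x hx; have x0 := tr_neq0 tr0 hx.
    have -> : (2 * N).+1 = (2 * i + (2 * (N - i)).-1.+2)%N by lia.
    by rewrite subr0 exprD [(_ * _)^-1 in RHS]invfM [RHS]mulrA divff ?mul1r // expf_neq0.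
  - apply: ci_ext (ci_monomial g_cont g_closed g_rect 0 (2 * (i - N)).-1) => x hx.
    have x0 := tr_neq0 tr0 hx.
    have -> : (2 * i = (2 * (i - N)).-1 + (2 * N).+1)%N by lia.
    by rewrite subr0 exprD mulfK // expf_neq0.
  - apply: ci_ext winding0 => x hx; have x0 := tr_neq0 tr0 hx.
    by rewrite exprS [(_ * _)^-1]invfM mulrC mulfVK // expf_neq0.
have := @ci_sum _ g g_cont g_closed g_rect _ (index_enum 'I_(size P + N.+1))
  (fun i x => P`_i * (x ^+ (2 * i) / x ^+ (2 * N).+1)) (fun i => P`_i * (if i == N :> nat then w0 else 0))
  (fun i => ci_scale g_cont g_closed g_rect P`_i (mono i)).
have hN : (N < size P + N.+1)%N by rewrite addnS ltnS leq_addl.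
rewrite (bigD1 (Ordinal hN)) //= eqxx big1 ?addr0; last first.
  by move=> i iN; rewrite ifN ?mulr0.
apply: ci_ext => x hx; have x0 := tr_neq0 tr0 hx.
under eq_bigr => i _ do rewrite mulrA exprM.
rewrite -mulr_suml -(@horner_coef_wide _ _ _ (x ^+ 2)); last by rewrite leq_addr.
have E1 : (\prod_(0 <= j < N) (1 - q ^+ j *: 'X)).[x ^+ 2] = qpn q N (x ^+ 2).
  rewrite horner_prod /qpn; apply: eq_bigr => j _.
  by rewrite hornerD hornerN hornerZ hornerX hornerC mulrC.
have E2 : (\prod_(0 <= j < N) ('X - (q ^+ j)%:P)).[x ^+ 2] =
    x ^+ (2 * N) * qpn q N (x ^- 2).
  transitivity (\prod_(0 <= j < N) (x ^+ 2 * (1 - x ^- 2 * q ^+ j))).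
    rewrite horner_prod; apply: eq_bigr => i _.
    by rewrite hornerXsubC; field.
  by rewrite big_split /= prodr_const_nat subn0 -exprM.
rewrite /P hornerM E1 E2 (exprS x (2 * N)).
have : x ^+ (2 * N) != 0 by rewrite expf_neq0.
move: (x ^+ (2 * N)) (qpn q N (x ^+ 2)) (qpn q N (x ^- 2)) => y A B y0.
by field; rewrite x0 y0.
Qed.

Lemma constant_term_qpn n : CT n.+1 * qpn q n q = 2 * qpn q n (q ^+ n.+2).
Proof.
have -> : qpn q n q = \prod_(0 <= i < n) (1 - q ^+ i.+1).
  by apply: eq_bigr => i _; rewrite exprS.
rewrite /CT (constant_term q_neq0 q_nroot); congr (_ * _).
rewrite big_nat_rev /qpn; apply: eq_big_nat => i /andP[_ hi].
by rewrite -exprD; congr (1 - _ ^+ _); lia.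
Qed.

(** The truncations integrate to [CT N * w0], which would tend to 0. But by [constant_term_qpn],
    [CT n.+1] is 2 (q^(n+2); q)_n / (q; q)_n, where the upper product tends to 1 and the lower one
    is bounded. *)
Lemma ci_theta_neq0 : ~ ci (fun x => theta x / x) 0.
Proof.
move=> c.
have [M M0 hM] := curve_length g_rect.
have [B1 B10 hB1] := bounded_on_ge0 sqr_bounded.
have [B2 B20 hB2] := bounded_on_ge0 sqrV_bounded.
have [B3 B30 hB3] := bounded_on_ge0 inv_bounded.
have [C B1' hC] := @qpn_bounded _ _ q_lt1 1 ler01.
have [C' C'0 hC'] := @qpn_near1 _ _ q_lt1 1 ler01.
have CTlow : exists N0, forall n, (N0 <= n)%N -> 1 <= cabs (CT n.+1) * C.
  have [N0 hN0] := @expr_small _ _ q_lt1 1 (1 / 2 / C') ler01 ltac:(by rewrite divr_gt0 //; lra).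
  exists N0 => n hn; have hq : cabs q <= 1 by exact: ltW.
  have s1 : cabs (q ^+ n.+2) <= 1 / 2 / C'.
    by rewrite cabsX -[_ ^+ _]mul1r; apply: hN0; apply: leqW; apply: leqW.
  have s2 : cabs (q ^+ n.+2) <= 1.
    by rewrite cabsX exprn_ile1 ?cabs_ge0.
  have s3 := hC' n _ s2.
  have s4 : C' * cabs (q ^+ n.+2) <= 1 / 2 by rewrite mulrC -ler_pdivlMr.
  have s5 : 1 / 2 <= cabs (qpn q n (q ^+ n.+2)).
    by have := cabs_le_dist 1 (qpn q n (q ^+ n.+2)); rewrite cabs1 cabsB; lra.
  have := congr1 (@cabs R) (constant_term_qpn n); rewrite !cabsM => E.
  apply: (@le_trans _ _ (cabs (CT n.+1) * cabs (qpn q n q))).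
    have c2 : cabs (2 : R[i]) = 2 by rewrite -(rmorph_nat (@real_complex R) 2) cabs_real ger0_norm.
    by rewrite E c2; lra.
  by rewrite ler_wpM2l ?cabs_ge0 // hC.
have w00 : 0 < cabs w0 by rewrite cabs_gt0.
have [N0 hN0] := CTlow.
have [Bq Bq1 hBq] := @qpn_bounded _ _ q_lt1 B1 (ltW B10).
have [Bp Bp0 hBp] := qpoch_bounded q_lt1 (ltW B20).
(* This [e] yields [cabs (CT N.+1) * C <= 1 / 2], against the lower bound 1 from [CTlow]. *)
have [e e0 E] : exists2 e : R, 0 < e & e * M = cabs w0 / (C * 2).
  exists (cabs w0 / (C * M * 2)); first by rewrite divr_gt0 // !mulr_gt0 //; lra.
  by field; rewrite !gt_eqF //; lra.
pose e1 := e / 2 / B3 / (Bq + Bp).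
have e10 : 0 < e1 by rewrite !divr_gt0 //; lra.
have [N1 hN1] := qpoch_unif q_lt1 (ltW B10) e10.
have [N2 hN2] := qpoch_unif q_lt1 (ltW B20) e10.
pose N := maxn N0 (maxn N1 N2).
have k1 : (N1 <= N.+1)%N := leqW (leq_trans (leq_maxl N1 N2) (leq_maxr N0 _)).
have k2 : (N2 <= N.+1)%N := leqW (leq_trans (leq_maxr N1 N2) (leq_maxr N0 _)).
have ct := ci_truncated_theta N.+1.
have := ci_bound (e := e) hM _ _ (ci_lin (-1) c ct).
rewrite mulr0 add0r => /(_ (ltW e0)) H.
have : cabs (CT N.+1 * w0) <= e * M.
  apply: H => x hx.
  have x1 := hN1 N.+1 _ k1 (hB1 x hx); have x2 := hN2 N.+1 _ k2 (hB2 x hx).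
  have x3 := hB3 x hx; have x4 := hBq N.+1 _ (hB1 x hx); have x5 := hBp _ (hB2 x hx).
  rewrite /theta; move: x1 x2 x4 x5.
  move: (qpn q N.+1 (x ^+ 2)) (qpn q N.+1 (x ^- 2)) (qpoch q (x ^+ 2)) (qpoch q (x ^- 2)).
  move=> A1 A2 P1 P2 x1 x2 x4 x5.
  have -> : -1 * (P1 * P2 / x) + A1 * A2 / x = (A1 * (A2 - P2) + (A1 - P1) * P2) / x by ring.
  have y1 : cabs (A1 * (A2 - P2)) <= Bq * e1.
    by rewrite cabsM; apply: ler_pM; rewrite ?cabs_ge0.
  have y2 : cabs ((A1 - P1) * P2) <= e1 * Bp.
    by rewrite cabsM; apply: ler_pM; rewrite ?cabs_ge0.
  rewrite cabsM.
  apply: (@le_trans _ _ (e1 * (Bq + Bp) * B3)).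
    apply: ler_pM; rewrite ?cabs_ge0 //.
    by apply: le_trans (cabsD _ _) _; lra.
  rewrite /e1 mulfVK; last by rewrite gt_eqF //; lra.
  by rewrite mulfVK ?gt_eqF //; lra.
have lo := hN0 N (leq_maxl _ _).
rewrite cabsM => hi.
have hC0 : 0 < C by lra.
have : cabs w0 * 1 <= cabs w0 * (cabs (CT N.+1) * C) by rewrite ler_wpM2l // ltW.
have : (cabs (CT N.+1) * cabs w0) * C <= cabs w0 / 2.
  apply: (@le_trans _ _ (cabs w0 / (C * 2) * C)); first by rewrite ler_wpM2r ?(ltW hC0) // -E.
  by rewrite le_eqVlt; apply/orP; left; apply/eqP; field; rewrite gt_eqF.
lra.
Qed.

Lemma aw_integral_neq0 a b c d : separating g q w0 [:: a; b; c; d] ->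
  (forall m, a * b * c * d * q ^+ m != 1) -> aw_integral g q [:: a; b; c; d] != 0.
Proof.
move=> hs hn; apply/eqP => h0; apply: ci_theta_neq0.
(* Shifting the first parameter and rotating the list lets four applications shift all parameters.
   The condition on the product keeps the coefficient of the shifted integral non-zero, so vanishing
   is passed on. *)
have step x y z t k : separating g q w0 [:: x; y; z; t] ->
    (forall m, x * y * z * t * q ^+ m != 1) -> aw_integral g q [:: x; y; z; t] = 0 ->
    [/\ separating g q w0 [:: y; z; t; x * q ^+ k],
        (forall m, y * z * t * (x * q ^+ k) * q ^+ m != 1)
      & aw_integral g q [:: y; z; t; x * q ^+ k] = 0].
  move=> hs1 hn1 h1.
  have pm : perm_eq [:: x * q ^+ k; y; z; t] [:: y; z; t; x * q ^+ k].
    by apply/permP => P /=; rewrite !addn0; lia.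
  split.
  - apply: separating_perm pm _; exact: separating_shift.
  - move=> m; have := hn1 (k + m)%N; apply: contra => /eqP <-.
    by apply/eqP; rewrite exprD; ring.
  - rewrite -(aw_integral_perm g q pm).
    have := aw_integral_shiftn g_cont g_closed g_rect q_neq0 q_lt1 tr0 winding0 k hs1.
    rewrite h1 mulr0 => /eqP; rewrite mulf_eq0 => /orP[|/eqP //].
    rewrite /qpn prodf_seq_eq0 => /hasP[j _ /=].
    by rewrite subr_eq0 eq_sym => hj; have := hn1 j; rewrite hj.
have all k : separating g q w0 [:: a * q ^+ k; b * q ^+ k; c * q ^+ k; d * q ^+ k] /\
    aw_integral g q [:: a * q ^+ k; b * q ^+ k; c * q ^+ k; d * q ^+ k] = 0.
  have [s1 n1 i1] := step _ _ _ _ k hs hn h0.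
  have [s2 n2 i2] := step _ _ _ _ k s1 n1 i1.
  have [s3 n3 i3] := step _ _ _ _ k s2 n2 i2.
  by have [s4 n4 i4] := step _ _ _ _ k s3 n3 i3.
by apply: (@ci_weight_limit [:: a; b; c; d]) => k; have [] := all k.
Qed.

End AWNonzero.

(** * Laurent polynomials, the operators and their eigenfunctions *)

Section Laurent.
Variable R : realType.
Implicit Types (p f h : laurent R) (x : R[i]) (P : {poly R[i]}).

Definition degree_le n p := forall j : int, (n < `|j|)%N -> p j = 0.

Lemma degree_le_ex p : exists n, degree_le n p.
Proof.
exists (\max_(j <- finsupp p) `|j|)%N => j hj.
apply/eqP; apply: contraLR hj; rewrite -mem_finsupp -leqNgt => jp.
by rewrite (big_rem j) //= leq_maxl.
Qed.

Lemma degree_leW n m p : (n <= m)%N -> degree_le n p -> degree_le m p.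
Proof. by move=> nm h j hj; apply: h; apply: leq_ltn_trans hj. Qed.

Let window n : seq int := [seq (i%:Z - n%:Z)%R | i <- iota 0 n.*2.+1].

Let window_uniq n : uniq (window n).
Proof. by rewrite map_inj_uniq ?iota_uniq // => i j /addIr []. Qed.

Let mem_window n (j : int) : (j \in window n) = (`|j| <= n)%N.
Proof.
apply/mapP/idP => [|jn]; first by case=> i; rewrite mem_iota; lia.
by exists (absz (j + n%:Z)%R); [rewrite mem_iota; lia | lia].
Qed.

Lemma leval_window n p x : degree_le n p ->
  leval p x = \sum_(0 <= i < n.*2.+1) p (i%:Z - n%:Z) * x ^ (i%:Z - n%:Z).
Proof.
move=> hp; rewrite /leval.
transitivity (\sum_(j <- window n) p j * x ^ j); last first.
  by rewrite /window big_map /index_iota subn0.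
rewrite [RHS](bigID (fun j => j \in finsupp p)) /= [X in _ + X]big1 ?addr0; last first.
  by move=> j; rewrite mem_finsupp negbK => /eqP ->; rewrite mul0r.
rewrite -[RHS]big_filter; apply: perm_big; apply: uniq_perm.
- exact: fset_uniq.
- by rewrite filter_uniq // window_uniq.
- move=> j; rewrite mem_filter mem_window.
  case: (boolP (j \in finsupp p)) => //=; rewrite mem_finsupp leqNgt => jp.
  by symmetry; apply: contraNN jp => /hp ->.
Qed.

(** The polynomial x^n p(x); degree bounds and divisibility are treated on this side. *)
Definition lpoly n p : {poly R[i]} := \poly_(i < n.*2.+1) p (i%:Z - n%:Z).

Lemma size_lpoly n p : (size (lpoly n p) <= n.*2.+1)%N.
Proof. exact: size_poly. Qed.

Lemma leval_lpoly n p x : degree_le n p -> x != 0 ->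
  leval p x = (lpoly n p).[x] / x ^+ n.
Proof.
move=> hp x0; rewrite (leval_window _ hp) horner_poly big_mkord mulr_suml.
apply: eq_bigr => i _; rewrite -mulrA; congr (_ * _).
by rewrite expfzDr // -exprnN -exprnP.
Qed.

Lemma laurent_ext p f : (forall j, p j = f j) -> p = f.
Proof. by move=> h; apply/fsfunP. Qed.

Definition of_poly n P : laurent R :=
  [fsfun j in [fset j in window n]%fset => P`_`|(j + n%:Z)%R|].

Lemma of_polyE n P j : of_poly n P j = if (`|j| <= n)%N then P`_`|(j + n%:Z)%R| else 0.
Proof. by rewrite fsfunE in_fset mem_window. Qed.

Lemma of_poly_degree n P : degree_le n (of_poly n P).
Proof. by move=> j; rewrite of_polyE ltnNge => /negbTE ->. Qed.

Lemma of_poly_hi n P : of_poly n P n%:Z = P`_n.*2.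
Proof. by rewrite of_polyE leqnn; congr (P`_ _); lia. Qed.

Lemma of_poly_lo n P : of_poly n P (- n%:Z) = P`_0.
Proof. by rewrite of_polyE abszN leqnn addNr. Qed.

Lemma leval_of_poly n P x : (size P <= n.*2.+1)%N -> x != 0 ->
  leval (of_poly n P) x = P.[x] / x ^+ n.
Proof.
move=> sP x0; rewrite (leval_lpoly (@of_poly_degree n P)) //; congr (_.[x] / _).
apply/polyP => i; rewrite coef_poly; case: ltnP => [hi|hi].
  rewrite of_polyE; have -> : (`|i%:Z - n%:Z| <= n)%N by lia.
  by congr (P`_ _); lia.
by rewrite nth_default // (leq_trans sP).
Qed.

Lemma lpolyK n p : degree_le n p -> of_poly n (lpoly n p) = p.
Proof.
move=> hp; apply: laurent_ext => j; rewrite of_polyE; case: leqP => hj.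
  rewrite coef_poly ifT; last by lia.
  by congr (p _); lia.
by rewrite hp.
Qed.

Lemma poly_nat_eq0 P : (forall n : nat, P.[n%:R] = 0) -> P = 0.
Proof.
move=> h; apply/eqP; apply: contraT => P0.
have := @max_poly_roots _ P [seq n%:R | n <- iota 0 (size P)] P0.
rewrite size_map size_iota ltnn; apply.
  by apply/allP => _ /mapP[n _ ->]; rewrite /root h.
rewrite map_inj_uniq ?iota_uniq // => i j /eqP.
by rewrite eqr_nat => /eqP.
Qed.

Lemma laurent_eq (D : {poly R[i]}) p f : D != 0 ->
  (forall x, x != 0 -> D.[x] != 0 -> leval p x = leval f x) -> p = f.
Proof.
move=> D0 h; have [n1 h1] := degree_le_ex p; have [n2 h2] := degree_le_ex f.
pose n := maxn n1 n2.
have hp : degree_le n p by apply: degree_leW h1; rewrite leq_maxl.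
have hf : degree_le n f by apply: degree_leW h2; rewrite leq_maxr.
suff E : lpoly n p = lpoly n f by rewrite -(lpolyK hp) E lpolyK.
apply/eqP; rewrite -subr_eq0; apply/eqP.
(* The factor ['X * D] forces the product to vanish also at the natural numbers where the hypothesis
   says nothing. *)
have : (lpoly n p - lpoly n f) * ('X * D) = 0.
  apply: poly_nat_eq0 => k; rewrite !hornerM hornerX.
  have [->|k0] := eqVneq (k%:R : R[i]) 0; first by rewrite mul0r mulr0.
  have [->|d0] := eqVneq D.[k%:R] 0; first by rewrite !mulr0.
  have := h _ k0 d0; rewrite (leval_lpoly hp) // (leval_lpoly hf) //.
  move=> /(mulIf (invr_neq0 (expf_neq0 n k0))) E.
  by rewrite hornerD hornerN E subrr mul0r.
by move/eqP; rewrite !mulf_eq0 polyX_eq0 (negbTE D0) !orbF => /eqP.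
Qed.

Definition lcomb (al be : R[i]) p f : laurent R :=
  [fsfun j in (finsupp p `|` finsupp f)%fset => al * p j + be * f j].

Lemma lcombE al be p f j : lcomb al be p f j = al * p j + be * f j.
Proof.
rewrite fsfunE in_fsetU !mem_finsupp; case: eqP => [->|]; case: eqP => [->|] //=.
by rewrite !mulr0 addr0.
Qed.

Lemma lscaleE al p j : lscale al p j = al * p j.
Proof.
by rewrite /lscale fsfunE mem_finsupp; case: eqP => [->|] //=; rewrite mulr0.
Qed.

Lemma lzeroE j : lzero R j = 0.
Proof. exact: fsfun0E. Qed.

Lemma loneE (j : int) : lone R j = if j == 0 then 1 else 0.
Proof. by rewrite fsfunE inE. Qed.

Lemma degree_le_lcomb n al be p f : degree_le n p -> degree_le n f ->
  degree_le n (lcomb al be p f).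
Proof. by move=> hp hf j hj; rewrite lcombE hp // hf // !mulr0 addr0. Qed.

Lemma leval_lcomb al be p f x :
  leval (lcomb al be p f) x = al * leval p x + be * leval f x.
Proof.
have [n1 h1] := degree_le_ex p; have [n2 h2] := degree_le_ex f.
pose n := maxn n1 n2.
have hp : degree_le n p by apply: degree_leW h1; rewrite leq_maxl.
have hf : degree_le n f by apply: degree_leW h2; rewrite leq_maxr.
rewrite (leval_window _ hp) (leval_window _ hf) (leval_window _ (degree_le_lcomb al be hp hf)).
rewrite !mulr_sumr -big_split /=; apply: eq_bigr => i _.
by rewrite lcombE mulrDl !mulrA.
Qed.

Lemma lscale_lcomb al p : lscale al p = lcomb al 0 p p.
Proof. by apply: laurent_ext => j; rewrite lscaleE lcombE mul0r addr0. Qed.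

Lemma leval_lscale al p x : leval (lscale al p) x = al * leval p x.
Proof. by rewrite lscale_lcomb leval_lcomb mul0r addr0. Qed.

Lemma leval_lone x : x != 0 -> leval (lone R) x = 1.
Proof.
move=> x0; have h : degree_le 0 (lone R).
  by move=> j j0; rewrite loneE ifN // -absz_eq0 -lt0n.
by rewrite (leval_window _ h) big_nat1 loneE /= subr0 expr0z mulr1.
Qed.

End Laurent.

(** * Demazure-Lusztig operators on Laurent polynomials *)

Section DemazureLusztig.
Variable R : realType.
Implicit Types (f h : laurent R) (x : R[i]) (P Q : {poly R[i]}).

Lemma div_sqr_sub P r m : r != 0 -> P.[r] = 0 -> P.[- r] = 0 ->
  (size P <= m.+2)%N -> exists2 Q : {poly R[i]}, (size Q <= m)%N & P = Q * ('X^2 - (r ^+ 2)%:P).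
Proof.
move=> r0 h1 h2 sP.
have /factor_theorem [Q1 E1] : root P r by apply/eqP.
have /factor_theorem [Q E2] : root Q1 (- r).
  move: h2; rewrite E1 !hornerE => /eqP; rewrite mulf_eq0 => /orP[//|].
  by rewrite -opprD oppr_eq0 -mulr2n mulrn_eq0 /= (negbTE r0).
have E : P = Q * ('X^2 - (r ^+ 2)%:P).
  by rewrite E1 E2 polyCN polyC_exp; ring.
exists Q => //; have [->|Q0] := eqVneq Q 0; first by rewrite size_poly0.
have mon : 'X^2 - (r ^+ 2)%:P \is monic by exact: monicXnsubC.
by move: sP; rewrite E size_Mmonic // size_XnsubC //; lia.
Qed.

(* The operators T_1 and T_0 are instances of the Demazure-Lusztig operator
   attached to the reflection x |-> rho^2 / x, with a quadratic numerator. *)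
Variables (rho k n0 n1 n2 : R[i]).
Hypothesis rho_neq0 : rho != 0.
Hypothesis k_neq0 : k != 0.

Definition is_DL f h := forall x, x != 0 -> x ^+ 2 != rho ^+ 2 ->
  leval h x = k * leval f x + k^-1 * ((n0 + n1 * x + n2 * x ^+ 2) / (x ^+ 2 - rho ^+ 2))
    * (leval f (rho ^+ 2 / x) - leval f x).

Lemma DL_unique f h h' : is_DL f h -> is_DL f h' -> h = h'.
Proof.
move=> H H'; apply: (@laurent_eq _ ('X^2 - (rho ^+ 2)%:P)).
  by rewrite -size_poly_eq0 size_XnsubC.
move=> x x0; rewrite !hornerE subr_eq0 => x1.
by rewrite H // H'.
Qed.

(** After multiplication by x^n, the difference f(rho^2/x) - f(x) is a polynomial that vanishes at
    the fixed points [rho] and [- rho] of the reflection, so [x ^+ 2 - rho ^+ 2] divides it. The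
    extreme coefficients of the quotient give the action on the outermost monomials. *)
Lemma DL_ex n f : degree_le n f -> exists h, [/\ is_DL f h, degree_le n h,
  h n%:Z = k * f n%:Z + k^-1 * n2 * (f (- n%:Z) * rho ^- (n.*2) - f n%:Z)
  & h (- n%:Z) = k * f (- n%:Z)
      - k^-1 * n0 * rho ^- 2 * (f n%:Z * rho ^+ (n.*2) - f (- n%:Z))].
Proof.
case: n => [|n] hf.
  exists (lscale k f); split.
  - move=> x x0 x1; rewrite leval_lscale.
    have r0 : rho ^+ 2 / x != 0 by rewrite mulf_neq0 ?invr_neq0 ?expf_neq0.
    have fE y : leval f y = f 0.
      by rewrite (leval_window _ hf) big_nat1 subr0 expr0z mulr1.
    by rewrite !fE subrr mulr0 addr0.
  - by move=> j hj; rewrite lscaleE hf ?mulr0.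
  - by rewrite lscaleE oppr0 expr0 invr1 mulr1 subrr mulr0 addr0.
  - by rewrite lscaleE oppr0 expr0 mulr1 subrr mulr0 subr0.
set N := n.+1 in hf *; set P := lpoly N f.
(* The polynomial x^N f(rho^2/x): the coefficients of [P] in reverse order, rescaled. *)
pose rev : {poly R[i]} := \poly_(j < N.*2.+1) (P`_(N.*2 - j) * rho ^+ N.*2 * rho ^- j.*2).
have revE x : x != 0 -> rev.[x] = x ^+ N * x ^+ N * rho ^- N.*2 * P.[rho ^+ 2 / x].
  move=> x0; rewrite horner_poly (horner_coef_wide _ (size_lpoly N f)) mulr_sumr.
  rewrite (reindex_inj rev_ord_inj) /=; apply: eq_bigr => j _.
  have := ltn_ord j; move: (nat_of_ord j) => l; rewrite ltnS => hl.
  have [i hi] : exists i, N.*2 = (l + i)%N by exists (N.*2 - l)%N; rewrite subnKC.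
  have -> : (N.*2.+1 - l.+1 = i)%N by lia.
  have -> : (N.*2 - i = l)%N by lia.
  rewrite -exprD addnn hi -addnn !exprD expr_div_n -exprM mul2n -addnn exprD.
  have := expf_neq0 l rho_neq0; have := expf_neq0 i rho_neq0; have := expf_neq0 l x0.
  move: (rho ^+ l) (rho ^+ i) (x ^+ l) (x ^+ i) => A B C D C0 B0 A0.
  by field; rewrite A0 B0 C0.
pose M : {poly R[i]} := n0%:P + n1 *: 'X + n2 *: 'X^2.
have rho2 : rho ^+ 2 != 0 by rewrite expf_neq0.
have key x : x != 0 -> (rev - P).[x] = x ^+ N * (leval f (rho ^+ 2 / x) - leval f x).
  move=> x0; rewrite hornerD hornerN revE //.
  rewrite !(leval_lpoly hf) // -?/P; last by rewrite mulf_neq0 ?invr_neq0.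
  rewrite expr_div_n -exprM -mul2n.
  have := expf_neq0 N x0; have := expf_neq0 (2 * N) rho_neq0.
  move: (x ^+ N) (rho ^+ (2 * N)) P.[_] P.[x] => A B C D B0 A0.
  by field; rewrite A0 B0.
have vanish y : y != 0 -> rho ^+ 2 / y = y -> (rev - P).[y] = 0.
  by move=> y0 yE; rewrite key // yE subrr mulr0.
have [|||Q sQ EQ] := @div_sqr_sub (rev - P) rho n.*2.+1 rho_neq0.
- by apply: vanish => //; field.
- by apply: vanish; rewrite ?oppr_eq0 //; field.
- by apply: leq_trans (size_polyD _ _) _; rewrite geq_max size_polyN !size_poly.
have sP : (size P <= N.*2.+1)%N by exact: size_poly.
pose T : {poly R[i]} := k *: P + k^-1 *: (M * Q).
have sT : (size T <= N.*2.+1)%N.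
  apply: leq_trans (size_polyD _ _) _; rewrite geq_max; apply/andP; split.
    exact: leq_trans (size_scale_leq _ _) _.
  apply: leq_trans (size_scale_leq _ _) _; apply: leq_trans (size_polyMleq _ _) _.
  have sM : (size M <= 3)%N.
    rewrite /M; apply: leq_trans (size_polyD _ _) _; rewrite geq_max; apply/andP; split.
      apply: leq_trans (size_polyD _ _) _; rewrite geq_max; apply/andP; split.
        by apply: leq_trans (size_polyC_leq1 _) _.
      by apply: leq_trans (size_scale_leq _ _) _; rewrite size_polyX.
    by apply: leq_trans (size_scale_leq _ _) _; rewrite size_polyXn.
  by rewrite /N; lia.
have coefM2 i : (M * Q)`_i.+2 = n0 * Q`_i.+2 + n1 * Q`_i.+1 + n2 * Q`_i.
  rewrite /M !mulrDl mul_polyC -!scalerAl !coefD !coefZ [('X * Q)`_i.+2]coefXM /=.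
  by rewrite [('X^2 * Q)`_i.+2]coefXnM /= subn2.
have coefM0 : (M * Q)`_0 = n0 * Q`_0.
  rewrite /M !mulrDl mul_polyC -!scalerAl !coefD !coefZ coefXM /=.
  by rewrite coefXnM /= !mulr0 !addr0.
have Phi : P`_N.*2 = f N%:Z.
  by rewrite coef_poly ltnSn; congr (f _); lia.
have Plo : P`_0 = f (- N%:Z) by rewrite coef_poly /= sub0r.
have revhi : rev`_N.*2 = P`_0 * rho ^- N.*2.
  rewrite coef_poly ltnSn subnn -[N.*2.*2]addnn exprD.
  by field; rewrite expf_neq0.
have revlo : rev`_0 = P`_N.*2 * rho ^+ N.*2.
  by rewrite coef_poly /= subn0 expr0 invr1 mulr1.
have Qz i : (n.*2 < i)%N -> Q`_i = 0 by move=> hi; rewrite nth_default // (leq_trans sQ).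
have Qhi : Q`_n.*2 = rev`_N.*2 - P`_N.*2.
  have := congr1 (fun S : {poly R[i]} => S`_n.*2.+2) EQ.
  rewrite mulrBr !coefB coefMXn coefMC /= subn2 /= (Qz n.*2.+2) // mul0r subr0.
  by rewrite /N doubleS => ->.
have Qlo : Q`_0 = - rho ^- 2 * (rev`_0 - P`_0).
  have := congr1 (fun S : {poly R[i]} => S`_0) EQ.
  rewrite mulrBr !coefB coefMXn coefMC /= sub0r => ->.
  by field.
exists (of_poly N T); split.
- move=> x x0 x1; rewrite leval_of_poly // /T hornerD !hornerZ hornerM.
  have -> : M.[x] = n0 + n1 * x + n2 * x ^+ 2.
    by rewrite /M !hornerD !hornerZ hornerC hornerX hornerXn.
  have x2 : x ^+ 2 - rho ^+ 2 != 0 by rewrite subr_eq0.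
  have := key x x0; rewrite EQ hornerM hornerD hornerN hornerC hornerXn (leval_lpoly hf x0) -/P => E.
  move: E; move: (expf_neq0 N x0) (leval f (rho ^+ 2 / x)).
  move: (x ^+ N) P.[x] Q.[x] => A B C A0 D E.
  have -> : C = A * (D - B / A) / (x ^+ 2 - rho ^+ 2) by rewrite -E mulfK.
  by field; rewrite x2 A0 k_neq0.
- exact: of_poly_degree.
- have hiE : (M * Q)`_N.*2 = n2 * Q`_n.*2.
    by rewrite /N doubleS coefM2 (Qz n.*2.+2) // (Qz n.*2.+1) // !mulr0 !add0r.
  by rewrite of_poly_hi /T coefD !coefZ hiE Qhi revhi Phi Plo; ring.
- by rewrite of_poly_lo /T coefD !coefZ coefM0 Qlo revlo Phi Plo; ring.
Qed.

End DemazureLusztig.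

(** * Askey-Wilson polynomials and their q-difference equation *)

Section AWPolynomials.
Variable R : realType.
Variables (q a b c d : R[i]).
Hypothesis q_neq0 : q != 0.
Hypothesis q_nroot : forall i, q ^+ i.+1 != 1.
Hypothesis ab_gen : forall k : nat, a * b * q ^+ k != 1.
Hypothesis ac_gen : forall k : nat, a * c * q ^+ k != 1.
Hypothesis ad_gen : forall k : nat, a * d * q ^+ k != 1.
Implicit Types (n k : nat) (x : R[i]).

Local Notation phi := (aw_phi q a).

Definition aw_coef n k : R[i] :=
  qpn q k (q ^- n) * qpn q k (a * b * c * d / q * q ^+ n) * q ^+ k
  / (qpn q k q * qpn q k (a * b) * qpn q k (a * c) * qpn q k (a * d)).

(* The Askey-Wilson polynomial as a terminating 4phi3 series *)
Definition aw_poly n x : R[i] := \sum_(0 <= k < n.+1) aw_coef n k * phi k x.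

Lemma aw_coef0 n : aw_coef n 0 = 1.
Proof. by rewrite /aw_coef !qpn0 expr0 !mulr1 divr1. Qed.

Lemma qpn_neq0 k y : (forall j : nat, y * q ^+ j != 1) -> qpn q k y != 0.
Proof.
move=> h; rewrite /qpn prodf_seq_neq0; apply/allP => j _ /=.
by rewrite subr_eq0 eq_sym.
Qed.

Let q_gen k : q * q ^+ k != 1. Proof. by rewrite -exprS q_nroot. Qed.

Lemma aw_coefS n k : aw_coef n k.+1 * ((1 - q ^+ k.+1) * ((1 - a * b * q ^+ k)
    * (1 - a * c * q ^+ k) * (1 - a * d * q ^+ k))) =
  aw_coef n k * (q * (1 - q ^- n * q ^+ k) * (1 - a * b * c * d / q * q ^+ n * q ^+ k)).
Proof.
rewrite /aw_coef !qpnSr -[q * q ^+ k]exprS [q ^+ k.+1 in X in X / _]exprS.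
have h1 : 1 - q ^+ k.+1 != 0 by rewrite subr_eq0 eq_sym.
have h2 : 1 - a * b * q ^+ k != 0 by rewrite subr_eq0 eq_sym.
have h3 : 1 - a * c * q ^+ k != 0 by rewrite subr_eq0 eq_sym.
have h4 : 1 - a * d * q ^+ k != 0 by rewrite subr_eq0 eq_sym.
have := qpn_neq0 k q_gen; have := qpn_neq0 k ab_gen.
have := qpn_neq0 k ac_gen; have := qpn_neq0 k ad_gen.
move: h1 h2 h3 h4.
move: (1 - q ^+ k.+1) (1 - a * b * q ^+ k) (1 - a * c * q ^+ k) (1 - a * d * q ^+ k).
move=> H1 H2 H3 H4 h1 h2 h3 h4.
move: (qpn q k q) (qpn q k (a * b)) (qpn q k (a * c)) (qpn q k (a * d)).
move=> A B C D n4 n3 n2 n1.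
move: (qpn q k (q ^- n)) (qpn q k (a * b * c * d / q * q ^+ n)).
move: (a * b * c * d / q * q ^+ n) (q ^- n) (q ^+ k) => *.
by field; rewrite n1 n2 n3 n4 h1 h2 h3 h4.
Qed.

Lemma aw_phi0 x : phi 0 x = 1. Proof. by rewrite /aw_phi !qpn0 mulr1. Qed.

Lemma aw_phiS k x : phi k.+1 x = phi k x * ((1 - a * q ^+ k * x) * (1 - a * q ^+ k / x)).
Proof. by rewrite /aw_phi !qpnSr !(mulrAC a _ (q ^+ k)); ring. Qed.

Lemma aw_phi_inv k x : phi k x^-1 = phi k x.
Proof. by rewrite /aw_phi invrK mulrC. Qed.

(** The coefficient of the shift x -> q x in the Askey-Wilson q-difference operator [aw_diff]. *)
Definition awA x : R[i] := (1 - a * x) * (1 - b * x) * (1 - c * x) * (1 - d * x)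
  / ((1 - x ^+ 2) * (1 - q * x ^+ 2)).

(** The products at [q x] and at [x] differ only in their end factors, so their difference is
    [phi k x] times an elementary function. *)
Let phi_shift k x : x != 0 -> 1 - x ^+ 2 != 0 -> 1 - q * x ^+ 2 != 0 ->
  awA x * (phi k.+1 (q * x) - phi k.+1 x) =
  - (a / q) * (1 - q ^+ k.+1) * phi k x *
  (x^-1 * ((1 - a * q ^+ k * x) * (1 - b * x) * (1 - c * x) * (1 - d * x)) / (1 - x ^+ 2)).
Proof.
move=> x0 x1 x2.
pose U := qpn q k (a * x * q); pose V := qpn q k (a / x).
have e1 : phi k.+1 (q * x) = U * (1 - a * x * q * q ^+ k) * ((1 - a / (q * x)) * V).
  rewrite /aw_phi qpnSr qpnS.
  have -> : a * (q * x) = a * x * q by ring.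
  by have -> : a / (q * x) * q = a / x by field; rewrite x0 q_neq0.
have e2 : phi k.+1 x = (1 - a * x) * U * (V * (1 - a / x * q ^+ k)).
  by rewrite /aw_phi qpnS qpnSr.
have e3 : phi k x * (1 - a * q ^+ k * x) = (1 - a * x) * U * V.
  by rewrite /aw_phi mulrAC (mulrAC a _ x) -qpnSr qpnS.
transitivity (- (a / q) * (1 - q ^+ k.+1) * (phi k x * (1 - a * q ^+ k * x)) *
  (x^-1 * ((1 - b * x) * (1 - c * x) * (1 - d * x)) / (1 - x ^+ 2))); last first.
  by move: (phi k x) => W; field; rewrite x0 x1 q_neq0.
rewrite e1 e2 e3 /awA (exprS q k); clear e1 e2 e3; clearbody U V; move: (q ^+ k) => Q.
by field; rewrite x0 x1 x2 q_neq0.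
Qed.

Definition aw_diff (f : R[i] -> R[i]) x : R[i] :=
  awA x * (f (q * x) - f x) + awA x^-1 * (f (x / q) - f x).

Definition aw_generic x : Prop :=
  [/\ x != 0, 1 - x ^+ 2 != 0, 1 - q * x ^+ 2 != 0 & x ^+ 2 - q != 0].

Let lam n : R[i] := (q ^- n - 1) * (1 - a * b * c * d / q * q ^+ n).

(** The operator is bidiagonal on the basis [phi]: the contributions of the two shifts combine by
    [aw_kernel_sym] with [a] replaced by [a q^k], and [aw_kernel_shift] splits the resulting kernel
    into [phi k.+1] and [phi k]. *)
Let diff_phiS k x : aw_generic x -> aw_diff (phi k.+1) x =
  lam k.+1 * phi k.+1 x - q ^- k.+1 * (1 - q ^+ k.+1) *
   ((1 - a * b * q ^+ k) * (1 - a * c * q ^+ k) * (1 - a * d * q ^+ k)) * phi k x.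
Proof.
move=> [x0 x1 x2 x3].
have y0 : x^-1 != 0 by rewrite invr_neq0.
have y1 : 1 - x^-1 ^+ 2 != 0.
  have -> : 1 - x^-1 ^+ 2 = - (1 - x ^+ 2) / x ^+ 2 by field.
  by rewrite mulf_neq0 ?oppr_eq0 ?invr_neq0 ?expf_neq0.
have y2 : 1 - q * x^-1 ^+ 2 != 0.
  have -> : 1 - q * x^-1 ^+ 2 = (x ^+ 2 - q) / x ^+ 2 by field.
  by rewrite mulf_neq0 ?invr_neq0 ?expf_neq0.
rewrite /aw_diff phi_shift //.
have -> : phi k.+1 (x / q) = phi k.+1 (q * x^-1) by rewrite -aw_phi_inv invfM invrK mulrC.
rewrite -(aw_phi_inv k.+1 x) phi_shift // !aw_phi_inv.
have K := @aw_kernel_sym _ (a * q ^+ k) b c d x x0.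
have S := @aw_kernel_shift _ (a * q ^+ k) b c d x x0.
rewrite aw_phiS /lam.
move: K S; move: (aw_kernel _ _ _ _ _) (phi k x) => k' W K S.
have {}K : x^-1 * ((1 - a * q ^+ k * x) * (1 - b * x) * (1 - c * x) * (1 - d * x)) / (1 - x ^+ 2)
   + x * ((1 - a * q ^+ k / x) * (1 - b / x) * (1 - c / x) * (1 - d / x)) / (1 - x^-1 ^+ 2) = k'.
  apply: (@mulIf _ ((1 - x ^+ 2) * (1 - x ^- 2))).
    by rewrite mulf_neq0 // -exprVn.
  by rewrite -K -exprVn mulrDl; congr (_ + _); [rewrite mulrA mulfVK // mulrAC|
     rewrite mulrA mulrAC mulfVK // mulrAC].
transitivity (- (a / q) * (1 - q ^+ k.+1) * W * k'); first by rewrite -K !invrK; ring.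
have aq : q ^+ k != 0 by rewrite expf_neq0.
have -> : - (a / q) * (1 - q ^+ k.+1) * W * k' =
    - q ^- k.+1 * (1 - q ^+ k.+1) * W * (a * q ^+ k * k').
  by rewrite (exprS q k); field; rewrite q_neq0 aq.
have -> : a * q ^+ k * k' = (1 - a * q ^+ k * b) * (1 - a * q ^+ k * c) * (1 - a * q ^+ k * d)
   - (1 - a * q ^+ k * b * c * d) * ((1 - a * q ^+ k * x) * (1 - a * q ^+ k / x)).
  by rewrite S; ring.
rewrite (exprS q k); move: (q ^+ k) aq => Q Q0.
by field; rewrite x0 q_neq0 Q0.
Qed.

Lemma aw_poly_diff n x : aw_generic x -> aw_diff (aw_poly n) x = lam n * aw_poly n x.
Proof.
move=> gx.
(* Each partial sum is an eigenfunction up to its last term, which carries [lam m] instead of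
   [lam n]; the defect disappears at [m = n]. *)
have h m : aw_diff (fun y => \sum_(0 <= k < m.+1) aw_coef n k * phi k y) x =
    lam n * (\sum_(0 <= k < m) aw_coef n k * phi k x) + lam m * (aw_coef n m * phi m x).
  elim: m => [|m IH].
    rewrite /aw_diff !big_nat1 big_geq // !aw_phi0 /lam expr0 invr1 !subrr !mulr0 mul0r.
    by rewrite mul0r !addr0.
  have -> : aw_diff (fun y => \sum_(0 <= k < m.+2) aw_coef n k * phi k y) x =
     aw_diff (fun y => \sum_(0 <= k < m.+1) aw_coef n k * phi k y) x
     + aw_coef n m.+1 * aw_diff (phi m.+1) x.
    by rewrite /aw_diff !(big_nat_recr m.+1) //=; ring.
  rewrite IH diff_phiS // big_nat_recr //=.
  have E := aw_coefS n m.
  set L := \sum_(0 <= k < m) _.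
  transitivity (lam n * L + lam m * (aw_coef n m * phi m x) +
     (lam m.+1 * (aw_coef n m.+1 * phi m.+1 x) - q ^- m.+1 * (aw_coef n m.+1 *
      ((1 - q ^+ m.+1) * ((1 - a * b * q ^+ m) * (1 - a * c * q ^+ m) * (1 - a * d * q ^+ m)))) * phi m x)).
    by ring.
  rewrite E; suff Elam : lam m - q ^- m.+1 * (q * (1 - q ^- n * q ^+ m) *
      (1 - a * b * c * d / q * q ^+ n * q ^+ m)) = lam n.
    by rewrite -Elam; ring.
  rewrite /lam (exprS q m); have := expf_neq0 m q_neq0; have := expf_neq0 n q_neq0.
  by move: (q ^+ m) (q ^+ n) => M N N0 M0; field; rewrite q_neq0 N0 M0.
rewrite {1}/aw_poly h /aw_poly big_nat_recr //=; ring.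
Qed.

Lemma aw_poly_inv n x : aw_poly n x^-1 = aw_poly n x.
Proof. by apply: eq_bigr => k _; rewrite aw_phi_inv. Qed.

Lemma aw_poly_at_a n : a != 0 -> aw_poly n a = 1.
Proof.
move=> a0; rewrite /aw_poly big_nat_recl //= aw_coef0 aw_phi0 mul1r big1 ?addr0 //.
by move=> k _; rewrite /aw_phi divff // [qpn q k.+1 1]qpnS subrr mul0r !mulr0.
Qed.

Let phi_poly k : {poly R[i]} :=
  \prod_(0 <= j < k) ((1 - (a * q ^+ j) *: 'X) * ('X - (a * q ^+ j)%:P)).

(** The coefficient of both x^n and x^-n in [aw_poly n]: only the term [k = n] reaches that degree,
    and it is symmetric. *)
Definition aw_lead n : R[i] := aw_coef n n * \prod_(0 <= j < n) - (a * q ^+ j).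

Lemma aw_poly_laurent n : exists P : {poly R[i]}, [/\ (size P <= n.*2.+1)%N,
  P`_n.*2 = aw_lead n, P`_0 = aw_lead n
  & forall x, x != 0 -> aw_poly n x = P.[x] / x ^+ n].
Proof.
have sphi k : (size (phi_poly k) <= k.*2.+1)%N /\
    (phi_poly k)`_k.*2 = \prod_(0 <= j < k) - (a * q ^+ j).
  elim: k => [|k [IH1 IH2]].
    by rewrite /phi_poly !big_geq // size_poly1 coef1.
  rewrite /phi_poly big_nat_recr //= -/(phi_poly k) [in RHS]big_nat_recr //= -IH2.
  set r := a * q ^+ k.
  have -> : (1 - r *: 'X) * ('X - r%:P) = (1 + r ^+ 2) *: 'X - r *: 'X^2 - r%:P :> {poly R[i]}.
    by rewrite -!mul_polyC polyCD polyC_exp polyC1; ring.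
  have szM : (size ((1 + r ^+ 2) *: 'X - r *: 'X^2 - r%:P : {poly R[i]})%R <= 3)%N.
    apply: leq_trans (size_polyD _ _) _; rewrite geq_max; apply/andP; split; last first.
      by rewrite size_polyN; apply: leq_trans (size_polyC_leq1 _) _.
    apply: leq_trans (size_polyD _ _) _; rewrite geq_max size_polyN; apply/andP; split.
      by apply: leq_trans (size_scale_leq _ _) _; rewrite size_polyX.
    by apply: leq_trans (size_scale_leq _ _) _; rewrite size_polyXn.
  split.
    apply: leq_trans (size_polyMleq _ _) _; rewrite -subn1 leq_subLR.
    by apply: leq_trans (leq_add IH1 szM) _; rewrite doubleS; lia.
  rewrite doubleS mulrBr mulrBr !coefB -!scalerAr !coefZ coefMX coefMXn coefMC /= subn2 /=.
  have z1 : (phi_poly k)`_k.*2.+1 = 0 by exact: nth_default.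
  have z2 : (phi_poly k)`_k.*2.+2 = 0 by apply: nth_default; exact: leqW.
  by rewrite z1 z2; ring.
have lphi k : (phi_poly k)`_0 = \prod_(0 <= j < k) - (a * q ^+ j).
  rewrite -horner_coef0 horner_prod; apply: eq_bigr => j _.
  by rewrite hornerM !hornerD !hornerN hornerZ !hornerC hornerX mulr0 subr0 mul1r sub0r.
have ephi k x : x != 0 -> (phi_poly k).[x] = x ^+ k * phi k x.
  move=> x0; elim: k => [|k IH].
    by rewrite /phi_poly big_geq // hornerC expr0 aw_phi0 mulr1.
  rewrite /phi_poly big_nat_recr //= hornerM -/(phi_poly k) IH aw_phiS exprS.
  rewrite hornerM !hornerD !hornerN hornerZ !hornerC hornerX.
  by field.
pose P : {poly R[i]} := \sum_(0 <= k < n.+1) aw_coef n k *: ('X^(n - k) * phi_poly k).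
have sterm k : (k <= n)%N -> (size ('X^(n - k) * phi_poly k : {poly R[i]})%R <= (n + k).+1)%N.
  move=> kn; apply: leq_trans (size_polyMleq _ _) _; rewrite size_polyXn.
  rewrite addSn /=; apply: leq_trans (leq_add (leqnn _) (sphi k).1) _.
  by rewrite -addnn; lia.
exists P; split.
- rewrite /P big_nat; apply: leq_trans (size_sum _ _ _) _.
  apply/bigmax_leqP_seq => k _ /andP[_ kn].
  apply: leq_trans (size_scale_leq _ _) _; apply: leq_trans (sterm k kn) _.
  by rewrite ltnS -addnn leq_add2l.
- rewrite /P coef_sum big_nat_recr //= subnn expr0 mul1r coefZ (sphi n).2.
  rewrite big_nat big1 ?add0r // => k /andP[_ kn].
  rewrite coefZ nth_default ?mulr0 //; apply: leq_trans (sterm k (ltnW kn)) _.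
  by rewrite -addnn -addnS leq_add2l.
- rewrite /P coef_sum big_nat_recr //= subnn expr0 mul1r coefZ lphi.
  rewrite big_nat big1 ?add0r // => k /andP[_ kn].
  by rewrite coefZ coefXnM subn_gt0 kn mulr0.
- move=> x x0; rewrite /P horner_sum mulr_suml /aw_poly !big_nat.
  apply: eq_bigr => k /andP[_ kn].
  rewrite hornerZ hornerM hornerXn ephi // -[in X in _ / X](subnK (ltnSE kn)) exprD.
  have := expf_neq0 (n - k) x0; have := expf_neq0 k x0.
  by move: (x ^+ (n - k)) (x ^+ k) => A B B0 A0; field; rewrite A0 B0.
Qed.

End AWPolynomials.

Section DemazureLusztigHecke.
Variable R : realType.
Variables (rho k n0 n1 n2 : R[i]).
Hypothesis rho_neq0 : rho != 0.
Hypothesis k_neq0 : k != 0.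
Local Notation isDL := (is_DL rho k n0 n1 n2).

Lemma DL_lin al be f f' h h' : isDL f h -> isDL f' h' ->
  isDL (lcomb al be f f') (lcomb al be h h').
Proof.
move=> H H' x x0 x1; rewrite !leval_lcomb H // H' //.
move: (_ / (x ^+ 2 - rho ^+ 2)) (leval f _) (leval f' _) (leval f x) (leval f' x).
by move=> u A B C D; ring.
Qed.

Hypothesis hecke : rho ^+ 2 * n2 - n0 = rho ^+ 2 * (k ^+ 2 + 1).

(** The Hecke relation (T - k)(T + 1/k) = 0. For the coefficients [u] and [v] of the operator at [x]
    and at its reflection it amounts to [u + v = k + k^-1], which is what the hypothesis on the
    numerator provides. *)
Lemma DL_hecke f h h' : isDL f h -> isDL h h' -> h' = lcomb (k - k^-1) 1 h f.
Proof.
move=> H H'; apply: (@laurent_eq _ ('X^2 - (rho ^+ 2)%:P)).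
  by rewrite -size_poly_eq0 size_XnsubC.
move=> x x0; rewrite hornerD hornerN hornerC hornerXn => x2.
have x1 : x ^+ 2 != rho ^+ 2 by rewrite -subr_eq0.
have y0 : rho ^+ 2 / x != 0 by rewrite mulf_neq0 ?invr_neq0 ?expf_neq0.
have y2 : (rho ^+ 2 / x) ^+ 2 - rho ^+ 2 != 0.
  have -> : (rho ^+ 2 / x) ^+ 2 - rho ^+ 2 = - (rho ^+ 2 * (x ^+ 2 - rho ^+ 2) / x ^+ 2) by field.
  by rewrite oppr_eq0 !mulf_neq0 ?invr_neq0 ?expf_neq0.
have y1 : (rho ^+ 2 / x) ^+ 2 != rho ^+ 2 by rewrite -subr_eq0.
have yy : rho ^+ 2 / (rho ^+ 2 / x) = x by field; rewrite x0 rho_neq0.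
have Hx := H x x0 x1; have Hy := H _ y0 y1; rewrite yy in Hy.
rewrite leval_lcomb (H' x x0 x1) Hy.
set u := k^-1 * _ in Hx *; set v := k^-1 * _ in Hy *.
have uv : u + v = k + k^-1.
  apply: (@mulfI _ (rho ^+ 2 * k)); first by rewrite mulf_neq0 ?expf_neq0.
  transitivity (rho ^+ 2 * (k ^+ 2 + 1)); last by field.
  rewrite -hecke /u /v; field.
  rewrite k_neq0 x0 x2 /=.
  have -> : (rho ^+ 2) ^+ 2 + - rho ^+ 2 * x ^+ 2 = - (rho ^+ 2 * (x ^+ 2 - rho ^+ 2)) by ring.
  by rewrite oppr_eq0 !mulf_neq0 ?expf_neq0.
rewrite Hx; have -> : v = k + k^-1 - u by rewrite -uv; ring.
by move: (leval f x) (leval f _) => A B; field.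
Qed.

End DemazureLusztigHecke.

(** * Eigenfunctions of Y and their symmetrization *)

Section Eigenfunctions.
Variable R : realType.
Variables (q qh : R[i]) (t : params R).
Hypothesis q_neq0 : q != 0.
Hypothesis q_lt1 : cabs q < 1.
Hypothesis qh_sqrt : qh ^+ 2 = q.
Hypothesis k0_neq0 : k0 t != 0.
Hypothesis k1_neq0 : k1 t != 0.
Hypothesis u0_neq0 : u0 t != 0.
Hypothesis u1_neq0 : u1 t != 0.

Let qh_neq0 : qh != 0.
Proof. by apply: contraNneq q_neq0 => h; rewrite -qh_sqrt h expr0n. Qed.

Local Notation K0 := (k0 t).
Local Notation K1 := (k1 t).
Local Notation T1 := (opT1 t).
Local Notation T0 := (opT0 q qh t).
Local Notation Y := (opY q qh t).
Local Notation a := (aw_a t).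
Local Notation b := (aw_b t).
Local Notation c := (aw_c qh t).
Local Notation d := (aw_d qh t).

Local Notation DL1 := (is_DL 1 K1 (-1) (a + b) (K1 ^+ 2)).
Local Notation DL0 := (is_DL qh K0 (c * d) (- (c + d)) 1).

(** The operator is defined by choice, so a candidate must exist: [DL_ex] supplies it once (1 - a
    x)(1 - b x) is expanded with a b = -k1^2. *)
Lemma opT1_DL f : DL1 f (T1 f).
Proof.
have [n hn] := degree_le_ex f.
have [h0 [H _ _ _]] := @DL_ex _ 1 K1 (-1) (a + b) (K1 ^+ 2) (oner_neq0 _) k1_neq0 n f hn.
suff E h : DL1 f h <-> (forall x : R[i], x != 0 -> x ^+ 2 != 1 ->
    leval h x = k1 t * leval f x
      + (k1 t)^-1 * ((1 - k1 t * u1 t * x) * (1 + k1 t * (u1 t)^-1 * x)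
                      / (1 - x ^+ 2))
        * (leval f x^-1 - leval f x)).
  apply/E; rewrite /opT1.
  set P := (X in xget _ X).
  by have : P (xget (lzero R) P) by apply: xgetPex; exists h0; exact/E.
have F x : x ^+ 2 != 1 -> (1 - K1 * u1 t * x) * (1 + K1 * (u1 t)^-1 * x) / (1 - x ^+ 2) =
    (-1 + (a + b) * x + K1 ^+ 2 * x ^+ 2) / (x ^+ 2 - 1).
  move=> x1; have n1 : x ^+ 2 - 1 != 0 by rewrite subr_eq0.
  have n2 : 1 - x ^+ 2 != 0 by rewrite -opprB oppr_eq0.
  by rewrite /aw_a /aw_b; field; rewrite n1 n2 u1_neq0.
split=> Hh x x0 x1; have := Hh x x0; rewrite expr1n mul1r.
  by move=> /(_ x1) ->; rewrite F.
by move: x1; rewrite expr1n => x1 /(_ x1) ->; rewrite F.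
Qed.

Lemma opT0_DL f : DL0 f (T0 f).
Proof.
have [n hn] := degree_le_ex f.
have [h0 [H _ _ _]] := @DL_ex _ qh K0 (c * d) (- (c + d)) 1 qh_neq0 k0_neq0 n f hn.
suff E h : DL0 f h <-> (forall x : R[i], x != 0 -> x ^+ 2 != q ->
    leval h x = k0 t * leval f x
      + (k0 t)^-1 * ((1 - qh * k0 t * u0 t * x^-1)
                       * (1 + qh * k0 t * (u0 t)^-1 * x^-1)
                      / (1 - q * x^-1 ^+ 2))
        * (leval f (q * x^-1) - leval f x)).
  apply/E; rewrite /opT0.
  set P := (X in xget _ X).
  by have : P (xget (lzero R) P) by apply: xgetPex; exists h0; exact/E.
have F x : x != 0 -> x ^+ 2 != q ->
    (1 - qh * k0 t * u0 t * x^-1) * (1 + qh * k0 t * (u0 t)^-1 * x^-1) / (1 - q * x^-1 ^+ 2) =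
    (c * d + - (c + d) * x + 1 * x ^+ 2) / (x ^+ 2 - q).
  move=> x0 x1; have n1 : x ^+ 2 - q != 0 by rewrite subr_eq0.
  by rewrite /aw_c /aw_d; field; rewrite n1 x0 u0_neq0.
split=> Hh x x0 x1; have := Hh x x0; rewrite qh_sqrt.
  by move=> /(_ x1) ->; rewrite F.
by move: x1; rewrite qh_sqrt => x1 /(_ x1) ->; rewrite F.
Qed.

Lemma opT1_coef n f : degree_le n f -> [/\ degree_le n (T1 f),
  T1 f n%:Z = K1 * f (- n%:Z)
  & T1 f (- n%:Z) = K1 * f (- n%:Z) + K1^-1 * (f n%:Z - f (- n%:Z))].
Proof.
move=> hf.
have [h [H h1 h2 h3]] := @DL_ex _ 1 K1 (-1) (a + b) (K1 ^+ 2) (oner_neq0 _) k1_neq0 n f hf.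
rewrite (DL_unique (opT1_DL f) H) h2 h3 !expr1n; split=> //; first by field.
by rewrite invr1 !mulr1; ring.
Qed.

Lemma opT0_coef n f : degree_le n f -> [/\ degree_le n (T0 f),
  T0 f n%:Z = K0 * f n%:Z + K0^-1 * (f (- n%:Z) * q ^- n - f n%:Z)
  & T0 f (- n%:Z) = K0 * q ^+ n * f n%:Z].
Proof.
move=> hf.
have [h [H h1 h2 h3]] := @DL_ex _ qh K0 (c * d) (- (c + d)) 1 qh_neq0 k0_neq0 n f hf.
have qn : qh ^+ n.*2 = q ^+ n by rewrite -mul2n exprM qh_sqrt.
rewrite (DL_unique (opT0_DL f) H) h2 h3 qn qh_sqrt; split=> //.
  by rewrite mulr1.
have -> : c * d = - (q * K0 ^+ 2).
  by rewrite -qh_sqrt /aw_c /aw_d; field.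
by field; rewrite q_neq0 k0_neq0.
Qed.

Local Notation g n := (K0 * K1 * q ^+ n).

(** Triangularity on the outermost monomials, with the spectrum on the diagonal; uniqueness of the
    eigenfunctions rests on it. *)
Lemma opY_coef n f : degree_le n f -> [/\ degree_le n (Y f),
  Y f n%:Z = g n * f n%:Z
  & Y f (- n%:Z) = ((K0 - K0^-1) / K1 + K0 * q ^+ n * (K1 - K1^-1)) * f n%:Z
     + (g n)^-1 * f (- n%:Z)].
Proof.
move=> /opT0_coef [h1 h2 h3]; have [h4 h5 h6] := opT1_coef h1.
rewrite /opY h5 h6 h2 h3; split=> //; first by ring.
by field; rewrite k0_neq0 k1_neq0 expf_neq0.
Qed.

Lemma opT1_lin al be f h : T1 (lcomb al be f h) = lcomb al be (T1 f) (T1 h).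
Proof. exact: DL_unique (opT1_DL _) (DL_lin al be (opT1_DL f) (opT1_DL h)). Qed.

Lemma opT0_lin al be f h : T0 (lcomb al be f h) = lcomb al be (T0 f) (T0 h).
Proof. exact: DL_unique (opT0_DL _) (DL_lin al be (opT0_DL f) (opT0_DL h)). Qed.

Lemma opY_lin al be f h : Y (lcomb al be f h) = lcomb al be (Y f) (Y h).
Proof. by rewrite /opY opT0_lin opT1_lin. Qed.

Lemma opT0_hecke f : T0 (T0 f) = lcomb (K0 - K0^-1) 1 (T0 f) f.
Proof.
apply: (@DL_hecke _ qh K0 (c * d) (- (c + d)) 1) => //; try exact: opT0_DL.
by rewrite qh_sqrt -qh_sqrt /aw_c /aw_d; field.
Qed.

Hypothesis g2_gen : forall z : int, (K0 * K1) ^+ 2 != q ^ z.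
Hypothesis k0_gen : forall z : int, K0 ^+ 2 != - q ^ z.

Lemma qz_inj (i j : int) : q ^ i = q ^ j -> i = j.
Proof.
have pos (n : nat) : q ^+ n.+1 != 1 by apply: q_nroot.
have h (z : int) : q ^ z = 1 -> z = 0.
  case: z => [[|n]|n] //.
    by rewrite -exprnP => /eqP; rewrite (negbTE (pos n)).
  rewrite NegzE -exprnN => E; have := pos n.
  by rewrite -[q ^+ _]invrK E invr1 eqxx.
move=> E; apply/eqP; rewrite -subr_eq0; apply/eqP; apply: h.
by rewrite expfzDr // E -expfzDr // subrr.
Qed.

Lemma gam_nat n : gam q t n%:Z = g n.
Proof. by rewrite /gam /sgnz /= expr1z -exprnP. Qed.

Lemma gam_neg n : gam q t (- n.+1%:Z) = (g n.+1)^-1.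
Proof. by rewrite /gam /sgnz /= exprN1 -exprnN [RHS]invfM. Qed.

Let g0 : K0 * K1 != 0. Proof. by rewrite mulf_neq0. Qed.

Lemma gam_neq0 m : gam q t m != 0.
Proof.
by rewrite /gam mulf_neq0 // expfz_neq0.
Qed.

Lemma gam_inj (i j : int) : gam q t i = gam q t j -> i = j.
Proof.
(* A coincidence between indices of opposite sign would make (k0 k1)^2 a power of [q]. *)
have cross (x y : int) : K0 * K1 * q ^ x = (K0 * K1)^-1 * q ^ y -> False.
  move=> E; have := g2_gen (y - x); rewrite expfzDr // => /eqP; apply.
  have qx : q ^ x != 0 by rewrite expfz_neq0.
  have -> : q ^ y = (K0 * K1) * (K0 * K1 * q ^ x) by rewrite E mulrA divff ?mul1r.
  by rewrite -invr_expz mulrA mulfK // expr2.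
rewrite /gam /sgnz; case: ifP => hi; case: ifP => hj; rewrite ?expr1z ?exprN1.
- by move=> /(mulfI g0) /qz_inj.
- by move=> /cross.
- by move=> /esym /cross.
- by move=> /(mulfI (invr_neq0 g0)) /qz_inj.
Qed.

(** Descending induction on the degree: by triangularity the outermost coefficients, first at [n]
    and then at [- n], are multiplied by eigenvalues different from [gam q t m], hence vanish; at
    index [m] itself the vanishing is assumed. *)
Lemma opY_eigen_eq0 r m : Y r = lscale (gam q t m) r -> r m = 0 -> r = lzero R.
Proof.
move=> E rm.
have Ej j : Y r j = gam q t m * r j by rewrite E lscaleE.
have step n : degree_le n r -> forall j : int, (n <= `|j|)%N -> r j = 0.
  move=> hr j; rewrite leq_eqVlt => /predU1P[nj|]; last exact: hr.
  have [_ h1 h2] := opY_coef hr.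
  have r1 : r n%:Z = 0.
    have [<- //|nm] := eqVneq m n%:Z.
    have gn : g n - gam q t m != 0.
      rewrite subr_eq0 -gam_nat; apply: contra_neq nm => /gam_inj; exact: esym.
    by apply: (mulfI gn); rewrite mulr0 mulrBl -h1 Ej subrr.
  have [nj'|nj'] : j = n%:Z \/ j = - n%:Z by lia.
    by rewrite nj'.
  rewrite nj'; case: n {nj hr h1} r1 h2 nj' => [|n]; first by rewrite oppr0.
  move=> r1 h2 _.
  have [<- //|nm] := eqVneq m (- n.+1%:Z).
  have gn : (g n.+1)^-1 - gam q t m != 0.
    rewrite subr_eq0 -gam_neg; apply: contra_neq nm => /gam_inj; exact: esym.
  by apply: (mulfI gn); rewrite mulr0 mulrBl -Ej h2 r1 mulr0 add0r subrr.
have [n hn] := degree_le_ex r.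
elim: n hn => [|n IH] hn.
  by apply: laurent_ext => j; rewrite lzeroE; apply: step hn _ _.
apply: IH => j hj; exact: step hn _ hj.
Qed.

Lemma nonsym_PE m p : has_leading m p -> Y p = lscale (gam q t m) p ->
  nonsym_P q qh t m = p.
Proof.
move=> hp yp.
have [h1 h2] : has_leading m (nonsym_P q qh t m) /\
    Y (nonsym_P q qh t m) = lscale (gam q t m) (nonsym_P q qh t m).
  rewrite /nonsym_P; set P := (X in xget _ X).
  by have : P (xget (lzero R) P) by apply: xgetPex; exists p.
set p' := nonsym_P q qh t m in h1 h2 *.
have : lcomb 1 (-1) p' p = lzero R.
  apply: (@opY_eigen_eq0 _ m).
    rewrite opY_lin h2 yp; apply: laurent_ext => j.
    by rewrite !(lcombE, lscaleE); ring.
  by rewrite lcombE h1.1 hp.1; ring.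
move=> E; apply: laurent_ext => j.
have := congr1 (fun f : laurent R => f j) E; rewrite lcombE lzeroE mul1r mulN1r.
by move/eqP; rewrite subr_eq0 => /eqP.
Qed.

Lemma degree_le_leading n (p : laurent R) : degree_le n p -> p n%:Z = 1 -> has_leading n%:Z p.
Proof.
by move=> hp p1; split=> // j hj; apply: hp; move: hj; unfold mon_rank => /=; case: (0 <= j); lia.
Qed.

Lemma degree_le_leading_neg n (p : laurent R) : degree_le n.+1 p -> p n.+1%:Z = 0 -> p (- n.+1%:Z) = 1 ->
  has_leading (- n.+1%:Z) p.
Proof.
move=> hp p0 p1; split=> // j hj.
have [->//|jn] := eqVneq j n.+1%:Z.
apply: hp; move: hj jn; unfold mon_rank.
have -> : (0 <= - n.+1%:Z :> int) = false by lia.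
by case: (lerP 0 j) => ?; lia.
Qed.

Hypothesis q_root : forall i, q ^+ i.+1 != 1.
Hypothesis ab_gen : forall k : nat, a * b * q ^+ k != 1.
Hypothesis ac_gen : forall k : nat, a * c * q ^+ k != 1.
Hypothesis ad_gen : forall k : nat, a * d * q ^+ k != 1.
Variables (n : nat) (E : laurent R).
Local Notation L := (aw_lead q a b c d n).
Hypothesis L_neq0 : L != 0.
Hypothesis E_deg : degree_le n E.
Hypothesis E_hi : E n%:Z = L.
Hypothesis E_lo : E (- n%:Z) = L.
Hypothesis E_val : forall x, x != 0 -> leval E x = aw_poly q a b c d n x.

Lemma opT1_aw : T1 E = lscale K1 E.
Proof.
apply: DL_unique (opT1_DL E) _ => x x0 x1.
rewrite leval_lscale expr1n mul1r !E_val ?invr_neq0 // aw_poly_inv subrr mulr0 addr0.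
by [].
Qed.

Local Notation s := (g n + (g n)^-1).

(** This is (Y + 1/Y) E = s E without an inverse operator: since T1 E = k1 E, the quadratic relation
    of T0 gives Y^-1 E = (T0 E - (k0 - 1/k0) E) / k1. The equation itself is the q-difference
    equation of p_n. *)
Lemma opY_aw : Y E = lcomb (s + (K0 - K0^-1) / K1) (- K1^-1) E (T0 E).
Proof.
apply: (@laurent_eq _ (('X^2 - 1%:P) * ((1 - q *: 'X^2) * ('X^2 - q%:P)))).
  rewrite !mulf_neq0 //.
  - by rewrite -size_poly_eq0 size_XnsubC.
  - apply/eqP => h; have := congr1 (fun P : {poly R[i]} => P.[0]) h.
    rewrite hornerD hornerN hornerZ hornerXn hornerC horner0 expr0n mulr0 subr0 => /eqP.
    by rewrite oner_eq0.
  - by rewrite -size_poly_eq0 size_XnsubC.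
move=> x x0; rewrite !hornerM !(hornerD, hornerN, hornerC, hornerXn, hornerZ).
rewrite !mulf_eq0 !negb_or => /andP[x1 /andP[x2 x3]].
have gx : aw_generic q x by split=> //; rewrite -opprB oppr_eq0.
have D := aw_poly_diff q_neq0 q_root ab_gen ac_gen ad_gen n gx.
have y0 : x^-1 != 0 by rewrite invr_neq0.
have xq : q / x != 0 by rewrite mulf_neq0.
have h1 : x ^+ 2 != 1 ^+ 2 by rewrite expr1n -subr_eq0.
have h2 : x ^+ 2 != qh ^+ 2 by rewrite qh_sqrt -subr_eq0.
have e3 : x^-1 ^+ 2 - q = (1 - q * x ^+ 2) / x ^+ 2 by field.
have h3' : x^-1 ^+ 2 - q != 0 by rewrite e3 mulf_neq0 // invr_neq0 ?expf_neq0.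
have h3 : x^-1 ^+ 2 != qh ^+ 2 by rewrite qh_sqrt -subr_eq0.
rewrite leval_lcomb /opY (opT1_DL (T0 E) x0 h1) expr1n mul1r.
rewrite (opT0_DL E x0 h2) (opT0_DL E y0 h3) qh_sqrt invrK !E_val ?mulf_neq0 // aw_poly_inv.
have -> : aw_poly q a b c d n (q / x) = aw_poly q a b c d n (x / q).
  by rewrite -aw_poly_inv invfM invrK mulrC.
move: D; rewrite /aw_diff.
move: (aw_poly q a b c d n x) (aw_poly q a b c d n (q * x)) (aw_poly q a b c d n (x / q)).
move=> X Xp Xm D.
(* Here [u] and [ub] are the coefficients of T0 at x and at 1/x, and [v] is that of T1 at x. The
   coefficient of T1 at 1/x is [K1 + K1^-1 - v], so [E1] and [E2] identify the two shifts of
   [aw_diff]. *)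
set u := K0^-1 * ((_ + _ * x + _) / _); set ub := K0^-1 * _; set v := K1^-1 * _.
have ab : a * b = - K1 ^+ 2 by rewrite /aw_a /aw_b; field.
have E1 : v * ub = awA q a b c d x / (K0 * K1).
  have p1 : x ^+ 2 - 1 = - (1 - x ^+ 2) by ring.
  have p0 : 1 - x ^+ 2 != 0 by rewrite -oppr_eq0 -p1.
  have n1 : -1 + (a + b) * x + K1 ^+ 2 * x ^+ 2 = - ((1 - a * x) * (1 - b * x)).
    by have -> : K1 ^+ 2 = - (a * b) by [rewrite ab opprK]; ring.
  have n2 : c * d + - (c + d) * x^-1 + 1 * x^-1 ^+ 2 = (1 - c * x) * (1 - d * x) / x ^+ 2.
    by field.
  rewrite /v /ub /awA e3 n1 n2 p1.
  move: (1 - x ^+ 2) p0 (1 - q * x ^+ 2) x2 => p p0 r r0.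
  by field; rewrite x0 k0_neq0 k1_neq0 p0 r0.
have E2 : (K1 + K1^-1 - v) * u = awA q a b c d x^-1 / (K0 * K1).
  have F1 : K1 + K1^-1 - v = K1^-1 * ((x - a) * (x - b) / (x ^+ 2 - 1)).
    have K1v : K1 * v = (-1 + (a + b) * x + K1 ^+ 2 * x ^+ 2) / (x ^+ 2 - 1).
      by rewrite /v mulrA divff ?mul1r.
    apply: (mulfI k1_neq0); rewrite mulrBr K1v [RHS]mulrA divff // mul1r.
    have -> : (x - a) * (x - b) = x ^+ 2 - (a + b) * x + a * b by ring.
    by rewrite ab; field; rewrite x1 k1_neq0.
  rewrite F1 /u /awA.
  have -> : (1 - a / x) * (1 - b / x) * (1 - c / x) * (1 - d / x) =
     (x - a) * (x - b) * (x - c) * (x - d) / x ^+ 4 by field.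
  have -> : 1 - x^-1 ^+ 2 = (x ^+ 2 - 1) / x ^+ 2 by field.
  have -> : 1 - q * x^-1 ^+ 2 = (x ^+ 2 - q) / x ^+ 2 by field.
  move: (x ^+ 2 - 1) x1 (x ^+ 2 - q) x3 => p p0 r r0.
  by field; rewrite x0 k0_neq0 k1_neq0 p0 r0.
transitivity ((K1 + K1^-1) * K0 * X + ((K1 + K1^-1 - v) * u * (Xm - X) + v * ub * (Xp - X))
   - K1^-1 * (K0 * X + u * (Xm - X))); first by ring.
rewrite E1 E2.
transitivity ((K1 + K1^-1) * K0 * X + (awA q a b c d x * (Xp - X) + awA q a b c d x^-1 * (Xm - X)) / (K0 * K1)
   - K1^-1 * (K0 * X + u * (Xm - X))); first by field; rewrite k0_neq0 k1_neq0.
rewrite D.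
have -> : a * b * c * d / q = (K0 * K1) ^+ 2.
  by rewrite -qh_sqrt /aw_a /aw_b /aw_c /aw_d; field; rewrite u0_neq0 u1_neq0 qh_neq0.
have := expf_neq0 n q_neq0; move: (q ^+ n) (u * (Xm - X)) => Q Z Q0.
by field; rewrite k0_neq0 k1_neq0 Q0.
Qed.

(** The span of [E] and [Y E] is stable under Y, which has there the characteristic polynomial (X -
    g n)(X - 1/g n). *)
Lemma opY2_aw : Y (Y E) = lcomb s (-1) (Y E) E.
Proof.
have YT : Y (T0 E) = lcomb (K0 - K0^-1) 1 (Y E) (lscale K1 E).
  by rewrite /opY opT0_hecke opT1_lin opT1_aw.
rewrite {1}opY_aw opY_lin YT; apply: laurent_ext => j.
by rewrite !(lcombE, lscaleE); field; rewrite k1_neq0 k0_neq0 expf_neq0.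
Qed.

Let p := lscale L^-1 E.

Let p_hi : p n%:Z = 1. Proof. by rewrite lscaleE E_hi mulVf. Qed.

Let p_deg : degree_le n p.
Proof. by move=> j hj; rewrite lscaleE E_deg // mulr0. Qed.

Lemma opT1_lscale z f : T1 (lscale z f) = lscale z (T1 f).
Proof. by rewrite lscale_lcomb opT1_lin -lscale_lcomb. Qed.

Lemma opY_lscale z f : Y (lscale z f) = lscale z (Y f).
Proof. by rewrite lscale_lcomb opY_lin -lscale_lcomb. Qed.

(* The eigenvectors are (Y - 1/g) p and (Y - g) p; the latter is non-zero in
   leading order because k0^2 avoids -q^Z. *)
Let p_span : (exists al be : R[i], forall j : int,
  p j = al * nonsym_P q qh t n%:Z j + be * nonsym_P q qh t (- n%:Z) j) /\
  (n <> 0%N -> [/\ nonsym_P q qh t n%:Z n%:Z = 1, nonsym_P q qh t (- n%:Z) n%:Z = 0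
     & nonsym_P q qh t (- n%:Z) (- n%:Z) = 1]).
Proof.
have [En|n0] := eqVneq n 0%N.
  have P0 : nonsym_P q qh t n%:Z = p.
    apply: nonsym_PE; first exact: degree_le_leading.
    have [h1 h2 _] := opY_coef p_deg.
    apply: laurent_ext => j; rewrite lscaleE gam_nat.
    have [->//|jn] := eqVneq j n%:Z.
    have hj : (n < `|j|)%N by rewrite En; move: jn; rewrite En; lia.
    by rewrite h1 // p_deg // mulr0.
  by split=> [|/(_ En)//]; exists 1, 0 => j; rewrite P0; ring.
have [m nm] : exists m, n = m.+1 by exists n.-1; rewrite prednK // lt0n.
have [Yd Yhi Ylo] := opY_coef E_deg.
have gn0 : g n != 0 by rewrite -gam_nat gam_neq0.
have gg : g n - (g n)^-1 != 0.
  rewrite subr_eq0 nm -gam_neg -gam_nat; apply/eqP => /gam_inj; lia.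
pose vp := lcomb 1 (- (g n)^-1) (Y E) E.
pose vm := lcomb 1 (- g n) (Y E) E.
have Yvp : Y vp = lscale (g n) vp.
  rewrite /vp opY_lin opY2_aw; apply: laurent_ext => j.
  by rewrite !(lcombE, lscaleE); move: (g n) gn0 => G G0; field.
have Yvm : Y vm = lscale (g n)^-1 vm.
  rewrite /vm opY_lin opY2_aw; apply: laurent_ext => j.
  by rewrite !(lcombE, lscaleE); move: (g n) gn0 => G G0; field.
have vpd : degree_le n vp by exact: degree_le_lcomb.
have vmd : degree_le n vm by exact: degree_le_lcomb.
have vp_hi : vp n%:Z = (g n - (g n)^-1) * L by rewrite lcombE Yhi E_hi; ring.
have vm_hi : vm n%:Z = 0 by rewrite lcombE Yhi E_hi; ring.
have vm_lo : vm (- n%:Z) != 0.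
  rewrite lcombE Ylo E_hi E_lo.
  have qn0 : q ^+ n != 0 by rewrite expf_neq0.
  have -> : 1 * (((K0 - K0^-1) / K1 + K0 * q ^+ n * (K1 - K1^-1)) * L + (g n)^-1 * L) +
      - g n * L = L * ((1 - q ^+ n) * (K0 ^+ 2 * q ^+ n + 1) / (K0 * K1 * q ^+ n)).
    by move: (q ^+ n) qn0 L => Q Q0 L'; field; rewrite k0_neq0 k1_neq0 Q0.
  rewrite mulf_neq0 // mulf_neq0 ?invr_neq0 // mulf_neq0 //.
    by rewrite nm subr_eq0 eq_sym.
  have := k0_gen (- n%:Z); apply: contra => /eqP h.
  rewrite -exprnN -(inj_eq (mulIf qn0)) mulNr mulVf // -addr_eq0.
  by rewrite h.
have Pp : nonsym_P q qh t n%:Z = lscale (vp n%:Z)^-1 vp.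
  apply: nonsym_PE.
    apply: degree_le_leading.
      by move=> j hj; rewrite lscaleE (vpd j hj) mulr0.
    by rewrite lscaleE mulVf // vp_hi mulf_neq0.
  rewrite opY_lscale Yvp gam_nat; apply: laurent_ext => j; rewrite !lscaleE; ring.
have Pm : nonsym_P q qh t (- n%:Z) = lscale (vm (- n%:Z))^-1 vm.
  apply: nonsym_PE.
    move: vm_hi vm_lo; rewrite {1 2}nm => hi lo; rewrite nm.
    apply: degree_le_leading_neg.
    - by rewrite -nm => j hj; rewrite lscaleE (vmd j hj) mulr0.
    - by rewrite lscaleE hi mulr0.
    - by rewrite lscaleE mulVf.
  rewrite opY_lscale Yvm [in gam _ _ _]nm gam_neg -nm.
  by apply: laurent_ext => j; rewrite !lscaleE; ring.
split=> [|_]; last first.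
  by rewrite Pp Pm !lscaleE vm_hi mulr0 !mulVf // vp_hi mulf_neq0.
move: (vm (- n%:Z)) vm_lo Pm => V V0 Pm.
(* The coefficients come from [vp - vm = (g n - (g n)^-1) E]. *)
exists 1, (- V / (vp n%:Z)) => j.
rewrite Pp Pm !lscaleE vp_hi !lcombE.
move: gg L_neq0; move: (g n) gn0 L => G G0 L' gg L0.
have G2 : G * G - 1 != 0.
  have -> : G * G - 1 = (G - G^-1) * G by field.
  by rewrite mulf_neq0.
by field; rewrite ?L0 ?V0 ?G0 ?G2.
Qed.

(** For uniqueness, the difference of two candidates has no x^n by normalization, and then no x^-n
    because T1 multiplies it by k1; in the span of the two eigenfunctions this leaves only 0. *)
Lemma sym_PE : sym_P q qh t n = p.
Proof.
have T1p : T1 p = lscale K1 p.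
  by rewrite /p opT1_lscale opT1_aw; apply: laurent_ext => j; rewrite !lscaleE; ring.
have [[al [be h1]] h2 h3] : [/\ exists al be : R[i], forall j : int,
          sym_P q qh t n j = al * nonsym_P q qh t n%:Z j + be * nonsym_P q qh t (- n%:Z) j,
        has_leading n%:Z (sym_P q qh t n)
      & T1 (sym_P q qh t n) = lscale K1 (sym_P q qh t n)].
  rewrite /sym_P; set P := (X in xget _ X).
  have : P (xget (lzero R) P).
    apply: xgetPex; exists p; split=> //; last exact: degree_le_leading.
    by have [] := p_span.
  exact.
set p' := sym_P q qh t n in h1 h2 h3 *.
have d' : degree_le n p'.
  by move=> j hj; apply: h2.2; unfold mon_rank => /=; case: (0 <= j); lia.
suff z : lcomb 1 (-1) p' p = lzero R.
  apply: laurent_ext => j; have := congr1 (fun f : laurent R => f j) z.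
  by rewrite lcombE lzeroE mul1r mulN1r => /eqP; rewrite subr_eq0 => /eqP.
set r := lcomb _ _ _ _.
have rd : degree_le n r by exact: degree_le_lcomb.
have rhi : r n%:Z = 0 by rewrite lcombE h2.1 p_hi; ring.
have rlo : r (- n%:Z) = 0.
  have [_ hh _] := opT1_coef rd.
  apply: (mulfI k1_neq0); rewrite mulr0 -hh /r opT1_lin h3 T1p.
  have -> : lcomb 1 (-1) (lscale K1 p') (lscale K1 p) = lscale K1 r.
    by apply: laurent_ext => j; rewrite !(lcombE, lscaleE); ring.
  by rewrite lscaleE rhi mulr0.
have [[al0 [be0 h0]] hP] := p_span.
have [En|/eqP /hP [P1 P2 P3]] := eqVneq n 0%N.
  apply: laurent_ext => j; rewrite lzeroE; have [->|jn] := eqVneq j n%:Z; first exact: rhi.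
  by apply: rd; move: jn; rewrite En; lia.
have rE j : r j = (al - al0) * nonsym_P q qh t n%:Z j + (be - be0) * nonsym_P q qh t (- n%:Z) j.
  by rewrite lcombE h1 h0; ring.
have e1 : al - al0 = 0 by rewrite -rhi rE P1 P2; ring.
have e2 : be - be0 = 0 by rewrite -rlo rE e1 P3; ring.
by apply: laurent_ext => j; rewrite lzeroE rE e1 e2 !mul0r addr0.
Qed.

End Eigenfunctions.

Section EplusValue.
Variable R : realType.
Variables (q qh : R[i]) (t : params R).
Hypothesis q_neq0 : q != 0.
Hypothesis q_lt1 : cabs q < 1.
Hypothesis qh_sqrt : qh ^+ 2 = q.
Hypothesis k0_neq0 : k0 t != 0.
Hypothesis k1_neq0 : k1 t != 0.
Hypothesis u0_neq0 : u0 t != 0.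
Hypothesis u1_neq0 : u1 t != 0.
Hypothesis g2_gen : forall z : int, (k0 t * k1 t) ^+ 2 != q ^ z.
Hypothesis k0_gen : forall z : int, k0 t ^+ 2 != - q ^ z.
Local Notation a := (aw_a t).
Local Notation b := (aw_b t).
Local Notation c := (aw_c qh t).
Local Notation d := (aw_d qh t).
Hypothesis ab_gen : forall k : nat, a * b * q ^+ k != 1.
Hypothesis ac_gen : forall k : nat, a * c * q ^+ k != 1.
Hypothesis ad_gen : forall k : nat, a * d * q ^+ k != 1.

Let q_root i : q ^+ i.+1 != 1. Proof. exact: q_nroot. Qed.

Let a_neq0 : a != 0. Proof. by rewrite /aw_a mulf_neq0. Qed.

Lemma aw_s2 : a * b * c * d / q = (k0 t * k1 t) ^+ 2.
Proof.
have qh0 : qh != 0 by apply: contraNneq q_neq0 => h; rewrite -qh_sqrt h expr0n.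
by rewrite -qh_sqrt /aw_a /aw_b /aw_c /aw_d; field; rewrite qh0 u0_neq0 u1_neq0.
Qed.

Lemma g2_nat (k : nat) : (k0 t * k1 t) ^+ 2 * q ^+ k != 1.
Proof.
have := g2_gen (- k%:Z); apply: contra => /eqP h.
rewrite -exprnN -(inj_eq (mulIf (expf_neq0 k q_neq0))) h mulVf //.
by rewrite expf_neq0.
Qed.

Lemma aw_coef_neq0 n : aw_coef q a b c d n n != 0.
Proof.
rewrite /aw_coef aw_s2 mulf_neq0 ?invr_neq0 ?mulf_neq0 ?expf_neq0 //.
- rewrite /qpn prodf_seq_neq0; apply/allP => j; rewrite mem_index_iota => /andP[_ hj] /=.
  rewrite subr_eq0 eq_sym; have [i ->] : exists i, n = (i.+1 + j)%N.
    by exists (n - j).-1; lia.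
  rewrite exprD invfM mulfVK ?expf_neq0 //.
  by rewrite -invr1 (inj_eq invr_inj).
- by apply: qpn_neq0 => j; rewrite -mulrA -exprD g2_nat.
- by apply: qpn_neq0 => j; rewrite -exprS.
- exact: qpn_neq0.
- exact: qpn_neq0.
- exact: qpn_neq0.
Qed.

Lemma aw_lead_neq0 n : aw_lead q a b c d n != 0.
Proof.
rewrite /aw_lead mulf_neq0 ?aw_coef_neq0 // prodf_seq_neq0; apply/allP => j _ /=.
by rewrite oppr_eq0 mulf_neq0 ?expf_neq0.
Qed.

Lemma aw_laurent_ex n : exists E : laurent R, [/\ degree_le n E,
  E n%:Z = aw_lead q a b c d n, E (- n%:Z) = aw_lead q a b c d n
  & forall x, x != 0 -> leval E x = aw_poly q a b c d n x].
Proof.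
have [P [sP P1 P2 P3]] := aw_poly_laurent a b c d q_neq0 n.
exists (of_poly n P); split.
- exact: of_poly_degree.
- by rewrite of_poly_hi.
- by rewrite of_poly_lo.
- by move=> x x0; rewrite leval_of_poly // P3.
Qed.

Lemma sym_P_val n x : x != 0 -> leval (sym_P q qh t n) x =
  (aw_lead q a b c d n)^-1 * aw_poly q a b c d n x.
Proof.
move=> x0; have [E [E1 E2 E3 E4]] := aw_laurent_ex n.
rewrite (sym_PE q_neq0 q_lt1 qh_sqrt k0_neq0 k1_neq0 u0_neq0 u1_neq0 g2_gen k0_gen
  q_root ab_gen ac_gen ad_gen (aw_lead_neq0 n) E1 E2 E3 E4).
by rewrite leval_lscale E4.
Qed.

Lemma sp_gam (m : int) : sp (gam q t m) = sp (gam q t `|m|%N).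
Proof.
case: m => [n //|n]; rewrite NegzE abszN /=.
by rewrite gam_neg gam_nat /sp invrK addrC.
Qed.

(** [Eplus] chooses some degree with the given spectral value; injectivity makes it the intended
    one. *)
Lemma sp_gam_inj (m n : nat) : sp (gam q t m%:Z) = sp (gam q t n%:Z) -> m = n.
Proof.
move=> E; set x := gam q t m%:Z in E; set y := gam q t n%:Z in E.
have x0 : x != 0 by exact: gam_neq0.
have y0 : y != 0 by exact: gam_neq0.
have : (x - y) * (x * y - 1) = 0.
  have -> : (x - y) * (x * y - 1) = x * y * (sp x - sp y).
    by rewrite /sp; field; rewrite x0 y0.
  by rewrite E subrr mulr0.
move/eqP; rewrite mulf_eq0 !subr_eq0 => /orP[/eqP h|].
  by have [] := gam_inj q_neq0 q_lt1 k0_neq0 k1_neq0 g2_gen h.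
rewrite /x /y !gam_nat => /eqP h.
have := g2_nat (m + n)%N; rewrite exprD -h expr2 => /eqP; case; ring.
Qed.

Lemma Eplus_val (m : int) x : x != 0 ->
  leval (Eplus q qh t (sp (gam q t m))) x = aw_poly q a b c d `|m|%N x.
Proof.
move=> x0; rewrite sp_gam; set n := `|m|%N.
have [m' [/sp_gam_inj <- ->]] : exists m' : nat, sp (gam q t n%:Z) = sp (gam q t m'%:Z) /\
    Eplus q qh t (sp (gam q t n%:Z)) = lscale (leval (sym_P q qh t m') (k1 t * u1 t))^-1
      (sym_P q qh t m').
  rewrite /Eplus; set P := (X in xget _ X).
  have : P (xget (lzero R) P).
    apply: xgetPex; exists (lscale (leval (sym_P q qh t n) (k1 t * u1 t))^-1 (sym_P q qh t n)).
    by exists n.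
  exact.
rewrite leval_lscale !sym_P_val // -/a aw_poly_at_a // mulr1 invrK mulrA divff ?mul1r //.
exact: aw_lead_neq0.
Qed.

End EplusValue.

(** * Norms of the Askey-Wilson polynomials *)

Section QDifferences.
Variable R : realType.
Variable q : R[i].
Hypothesis q_neq0 : q != 0.
Hypothesis q_nroot : forall i, q ^+ i.+1 != 1.
Implicit Types (n k : nat) (f : R[i] -> R[i]).

(** A q-analogue of the signed binomial coefficient, in the shape in which it occurs in
    [aw_coef]. *)
Let wt n k := qpn q k (q ^- n) * q ^+ k / qpn q k q.

Let qpnq_neq0 k : qpn q k q != 0.
Proof. by apply: qpn_neq0 => j; rewrite -exprS. Qed.

(** A q-Pascal rule; it yields the recursion of the differences in [qdiffS]. *)
Let wtS n k : wt n.+1 k.+1 = wt n k.+1 - q ^- n * wt n k.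
Proof.
rewrite /wt [qpn q k.+1 (q ^- n.+1)]qpnS !qpnSr.
have -> : q ^- n.+1 * q = q ^- n by rewrite exprS; field; rewrite q_neq0 expf_neq0.
have := qpnq_neq0 k; have : 1 - q * q ^+ k != 0 by rewrite -exprS subr_eq0 eq_sym.
have := expf_neq0 n q_neq0.
rewrite !exprS; move: (qpn q k (q ^- n)) (qpn q k q) (q ^+ n) (q ^+ k) => A B N K N0 K0 B0.
by field; rewrite q_neq0 N0 B0 K0.
Qed.

Let wt_out n : wt n n.+1 = 0.
Proof. by rewrite /wt qpnSr mulVf ?expf_neq0 // subrr mulr0 !mul0r. Qed.

(* q-analogue of the n-th finite difference of f at 1 *)
Definition qdiff n f : R[i] := \sum_(0 <= k < n.+1) wt n k * f (q ^+ k).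

Lemma qdiffS n f : qdiff n.+1 f = qdiff n f - q ^- n * qdiff n (fun y => f (q * y)).
Proof.
have wt0 m : wt m 0 = 1 by rewrite /wt !qpn0 expr0 !mulr1 divr1.
rewrite {1}/qdiff big_nat_recl //= wt0 -(wt0 n).
under eq_bigr => k _ do rewrite wtS mulrBl.
rewrite sumrB addrA; congr (_ - _).
  rewrite -(big_nat_recl n.+1 0 (fun k => wt n k * f (q ^+ k))) // big_nat_recr //=.
  by rewrite wt_out mul0r addr0.
by rewrite mulr_sumr; apply: eq_bigr => k _; rewrite -mulrA exprS.
Qed.

Lemma qdiff_ext n f f' : (forall k, f (q ^+ k) = f' (q ^+ k)) -> qdiff n f = qdiff n f'.
Proof. by move=> h; apply: eq_bigr => k _; rewrite h. Qed.

Lemma qdiff_scale n z f : qdiff n (fun y => z * f y) = z * qdiff n f.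
Proof. by rewrite mulr_sumr; apply: eq_bigr => k _; rewrite mulrCA. Qed.

Lemma qdiff_add n f f' : qdiff n (fun y => f y + f' y) = qdiff n f + qdiff n f'.
Proof. by rewrite -big_split; apply: eq_bigr => k _; rewrite mulrDr. Qed.

Lemma qdiff_monomial n j : (j < n)%N -> qdiff n (fun y => y ^+ j) = 0.
Proof.
elim: n => // n IH; rewrite ltnS leq_eqVlt => jn.
have -> : qdiff n.+1 (fun y => y ^+ j) = (1 - q ^- n * q ^+ j) * qdiff n (fun y => y ^+ j).
  rewrite qdiffS (@qdiff_ext n (fun y => (q * y) ^+ j) (fun y => q ^+ j * y ^+ j)).
    by rewrite qdiff_scale; ring.
  by move=> k; rewrite exprMn.
case/predU1P: jn => [->|/IH ->]; last by rewrite mulr0.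
by rewrite mulVf ?expf_neq0 // subrr mul0r.
Qed.

Lemma qdiff_poly n (P : {poly R[i]}) : (size P <= n)%N -> qdiff n (fun y => P.[y]) = 0.
Proof.
move=> sP; rewrite (@qdiff_ext n _ (fun y => \sum_(0 <= j < n) P`_j * y ^+ j)); last first.
  by move=> k; rewrite (horner_coef_wide _ sP) big_mkord.
have h m : (m <= n)%N -> qdiff n (fun y => \sum_(0 <= j < m) P`_j * y ^+ j) = 0.
  elim: m => [|m IH] hm.
    by rewrite /qdiff big1 // => k _; rewrite big_geq // mulr0.
  rewrite (@qdiff_ext n _ (fun y => (\sum_(0 <= j < m) P`_j * y ^+ j) + P`_m * y ^+ m)).
    by rewrite qdiff_add qdiff_scale IH ?(ltnW hm) // qdiff_monomial // mulr0 addr0.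
  by move=> k; rewrite big_nat_recr.
exact: h.
Qed.

(** Induction by [qdiffS]: replacing y by q y in the function replaces [s] by [s q]. *)
Lemma qdiff_inv n s : (forall k : nat, s * q ^+ k != 1) ->
  qdiff n (fun y => (1 - s * y)^-1) = s ^+ n * qpn q n q / qpn q n.+1 s.
Proof.
elim: n s => [|n IH] s hs.
  by rewrite /qdiff big_nat1 /wt qpnSr !qpn0 !expr0 !mulr1 !mul1r invr1 !mul1r.
have hs' k : s * q * q ^+ k != 1 by rewrite -mulrA -exprS.
rewrite qdiffS IH // (@qdiff_ext n (fun y => (1 - s * (q * y))^-1) (fun y => (1 - s * q * y)^-1)).
  rewrite IH // qpnSr [qpn q n.+1 (s * q)]qpnSr [qpn q n.+2 s]qpnS [qpn q n.+1 (s * q)]qpnSr.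
  rewrite [qpn q n.+1 q]qpnSr.
  have E : qpn q n s * (1 - s * q ^+ n) = (1 - s) * qpn q n (s * q) by rewrite -qpnSr qpnS.
  have n1 : 1 - s != 0 by have := hs 0%N; rewrite expr0 mulr1 subr_eq0 eq_sym.
  have n2 : 1 - s * q * q ^+ n != 0 by rewrite subr_eq0 eq_sym.
  have n3 : qpn q n (s * q) != 0 by exact: qpn_neq0.
  rewrite E !exprS exprMn; have := expf_neq0 n q_neq0; have := n2.
  move: (qpn q n (s * q)) (qpn q n q) (q ^+ n) (s ^+ n) n3 => A B N S A0 n2' N0.
  by field; rewrite ?q_neq0 ?N0 ?n1 ?A0 ?n2'.
by move=> k; rewrite mulrA.
Qed.

(** Dividing [P] by [X - s^-1] leaves a quotient of degree below [n], killed by the difference, and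
    the constant [P.[s^-1]]. *)
Lemma qdiff_poly_inv n s (P : {poly R[i]}) : s != 0 -> (size P <= n.+1)%N ->
  (forall k : nat, s * q ^+ k != 1) ->
  qdiff n (fun y => P.[y] / (1 - s * y)) = P.[s^-1] * (s ^+ n * qpn q n q / qpn q n.+1 s).
Proof.
move=> s0 sP hs.
have /factor_theorem [Q E] : root (P - (P.[s^-1])%:P) s^-1.
  by rewrite /root hornerD hornerN hornerC subrr.
have sQ : (size Q <= n)%N.
  have [->|Q0] := eqVneq Q 0; first by rewrite size_poly0.
  have := congr1 (fun S : {poly R[i]} => size S) E; rewrite size_Mmonic ?monicXsubC // size_XsubC.
  rewrite addn2 /= => h; rewrite -ltnS -h; apply: leq_trans (size_polyD _ _) _.
  by rewrite geq_max sP size_polyN (leq_trans (size_polyC_leq1 _)).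
rewrite (@qdiff_ext n _ (fun y => - s^-1 * Q.[y] + P.[s^-1] * (1 - s * y)^-1)).
  by rewrite qdiff_add !qdiff_scale qdiff_poly // mulr0 add0r qdiff_inv.
move=> k; have n1 : 1 - s * q ^+ k != 0 by rewrite subr_eq0 eq_sym.
have := congr1 (fun S : {poly R[i]} => S.[q ^+ k]) E.
rewrite hornerM hornerXsubC hornerD hornerN hornerC => /eqP; rewrite subr_eq => /eqP ->.
by field; rewrite s0 n1.
Qed.

Lemma qpn_horner c l : exists2 P : {poly R[i]}, (size P <= l.+1)%N &
  forall y, P.[y] = qpn q l (c * y).
Proof.
elim: l => [|l [P sP hP]].
  by exists 1 => [|y]; rewrite ?size_poly1 // qpn0 hornerC.
exists (P * (1 - (c * q ^+ l) *: 'X)).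
  apply: leq_trans (size_polyMleq _ _) _.
  have s2 : (size (1 - (c * q ^+ l) *: 'X : {poly R[i]})%R <= 2)%N.
    apply: leq_trans (size_polyD _ _) _; rewrite geq_max size_polyN size_poly1 /=.
    by apply: leq_trans (size_scale_leq _ _) _; rewrite size_polyX.
  by rewrite -subn1 leq_subLR; apply: leq_trans (leq_add sP s2) _; rewrite addn2 add1n.
move=> y; rewrite hornerM hP qpnSr hornerD hornerN hornerC hornerZ hornerX.
by rewrite (mulrAC c y).
Qed.

Lemma qpn_reverse n z : z != 0 -> qpn q n (q * q ^- n / z) * \prod_(0 <= j < n) - (z * q ^+ j) =
  qpn q n z.
Proof.
move=> z0; rewrite {1}/qpn big_nat_rev -big_split /=; apply: eq_big_nat => j /andP[_ hj].
have [i ->] : exists i, n = (j + i.+1)%N by exists (n - j).-1; lia.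
have -> : (0 + (j + i.+1) - j.+1 = i)%N by lia.
rewrite exprD exprS; have := expf_neq0 i q_neq0; have := expf_neq0 j q_neq0.
by move: (q ^+ i) (q ^+ j) => I J J0 I0; field; rewrite I0 J0 q_neq0 z0.
Qed.

End QDifferences.

(** * Orthogonality and quadratic norms *)

Section AWNorm.
Variable R : realType.
Variables (q a b c d : R[i]).
Hypothesis q_neq0 : q != 0.
Hypothesis q_nroot : forall i, q ^+ i.+1 != 1.
Hypothesis a_neq0 : a != 0.
Hypothesis b_neq0 : b != 0.
Hypothesis c_neq0 : c != 0.
Hypothesis d_neq0 : d != 0.
Hypothesis ab_gen : forall k : nat, a * b * q ^+ k != 1.
Hypothesis ac_gen : forall k : nat, a * c * q ^+ k != 1.
Hypothesis ad_gen : forall k : nat, a * d * q ^+ k != 1.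
Hypothesis s2_gen : forall k : nat, a * b * c * d / q * q ^+ k != 1.

Local Notation s4 := (a * b * c * d).

Let s4_gen k : s4 * q ^+ k != 1.
Proof. by have := s2_gen k.+1; rewrite exprS mulrA mulfVK. Qed.

(** The integral of p_n (b x, b/x; q)_l against the weight, divided by the integral of the weight,
    as [aw_integral_shift2] evaluates it. *)
Definition aw_moment n l : R[i] := \sum_(0 <= k < n.+1) aw_coef q a b c d n k *
  (qpn q (k + l) (a * b) * qpn q k (a * c) * qpn q k (a * d) * qpn q l (b * c) * qpn q l (b * d)
   / qpn q (k + l) s4).

Let s2S m : s4 / q * q ^+ m.+1 = s4 * q ^+ m.
Proof. by rewrite exprS; field. Qed.

(** With n = m + 1, after cancellation the summand is the q-binomial weight times a polynomial of
    degree l + (m - l) = m in q^k, and an n-th difference kills it. *)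
Lemma aw_moment_lt n l : (l < n)%N -> aw_moment n l = 0.
Proof.
case: n => // m; rewrite ltnS => lm.
have [P1 sP1 hP1] := qpn_horner q (a * b) l.
have [P2 sP2 hP2] := qpn_horner q (s4 * q ^+ l) (m - l).
pose X := qpn q l (b * c) * qpn q l (b * d) / qpn q m s4.
have -> : aw_moment m.+1 l = X * qdiff q m.+1 (fun y => (P1 * P2).[y]).
  rewrite mulr_sumr; apply: eq_bigr => k _.
  rewrite /aw_coef s2S hornerM hP1 hP2 [(k + l)%N]addnC.
  have E1 : qpn q (l + k) (a * b) = qpn q k (a * b) * qpn q l (a * b * q ^+ k).
    by rewrite addnC qpnD.
  have E2 : qpn q m s4 * qpn q k (s4 * q ^+ m) = qpn q (l + k) s4 * qpn q (m - l) (s4 * q ^+ l * q ^+ k).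
    rewrite -qpnD -[s4 * q ^+ l * q ^+ k]mulrA -exprD -qpnD; congr (qpn q _ _); lia.
  rewrite E1 /X.
  have := qpn_neq0 k ab_gen; have := qpn_neq0 k ac_gen; have := qpn_neq0 k ad_gen.
  have := qpn_neq0 m s4_gen; have := qpn_neq0 (l + k) s4_gen.
  have q0 : qpn q k q != 0 by apply: qpn_neq0 => j; rewrite -exprS.
  have -> : qpn q k (s4 * q ^+ m) = qpn q (l + k) s4 * qpn q (m - l) (s4 * q ^+ l * q ^+ k) / qpn q m s4.
    by rewrite -E2 [RHS]mulrAC divff ?mul1r // qpn_neq0.
  move: q0; move: (qpn q k q) (qpn q (l + k) s4) (qpn q m s4) (qpn q k (a * b)) (qpn q k (a * c)) (qpn q k (a * d)).
  move: (qpn q l (a * b * q ^+ k)) (qpn q (m - l) (s4 * q ^+ l * q ^+ k)) (qpn q l (b * c)) (qpn q l (b * d)).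
  move: (qpn q k (q ^- m.+1)) (q ^+ k).
  move=> x1 x2 x3 x4 x5 x6 y1 y2 y3 y4 y5 y6 n1 n2 n3 n4 n5 n6.
  by field; rewrite n1 n2 n3 n4 n5 n6.
rewrite qdiff_poly ?mulr0 //.
apply: leq_trans (size_polyMleq _ _) _; rewrite -subn1 leq_subLR.
by apply: leq_trans (leq_add sP1 sP2) _; lia.
Qed.

(** The classical norm of the Askey-Wilson polynomial relative to [(1, 1)], for the normalization
    p_n(a) = 1. *)
Definition aw_norm n : R[i] := a ^+ (2 * n) * qpn q n q * qpn q n (b * c) * qpn q n (b * d)
  * qpn q n (c * d) * (1 - s4 / q) /
  (qpn q n (a * b) * qpn q n (a * c) * qpn q n (a * d) * qpn q n (s4 / q) *
    (1 - s4 / q * q ^+ (2 * n))).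

(** At [l = n] a single linear factor survives in the denominator, so [qdiff_poly_inv] evaluates the
    sum. *)
Let aw_moment_diag m : aw_moment m.+1 m.+1 =
  qpn q m.+1 (b * c) * qpn q m.+1 (b * d) / qpn q m s4 *
  (qpn q m.+1 (a * b / (s4 * q ^+ m)) * ((s4 * q ^+ m) ^+ m.+1 * qpn q m.+1 q / qpn q m.+2 (s4 * q ^+ m))).
Proof.
have [P sP hP] := qpn_horner q (a * b) m.+1.
have hs k : s4 * q ^+ m * q ^+ k != 1 by rewrite -mulrA -exprD.
have s0 : s4 * q ^+ m != 0 by rewrite !mulf_neq0 ?expf_neq0.
rewrite -[a * b / _]/(a * b * (s4 * q ^+ m)^-1) -hP -(qdiff_poly_inv q_neq0 q_nroot) //.
rewrite mulr_sumr; apply: eq_bigr => k _.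
rewrite /aw_coef s2S hP.
have E1 : qpn q (k + m.+1) (a * b) = qpn q k (a * b) * qpn q m.+1 (a * b * q ^+ k).
  by rewrite qpnD.
have E2 : qpn q (k + m.+1) s4 = qpn q m s4 * qpn q k (s4 * q ^+ m) * (1 - s4 * q ^+ m * q ^+ k).
  by rewrite -qpnD -[_ * q ^+ k]mulrA -exprD -qpnSr; congr (qpn q _ _); lia.
rewrite E1 E2.
have := qpn_neq0 k ab_gen; have := qpn_neq0 k ac_gen; have := qpn_neq0 k ad_gen.
have := qpn_neq0 m s4_gen; have := qpn_neq0 k hs.
have q0 : qpn q k q != 0 by apply: qpn_neq0 => j; rewrite -exprS.
have := q0; have : 1 - s4 * q ^+ m * q ^+ k != 0 by rewrite subr_eq0 eq_sym.
move: (1 - s4 * q ^+ m * q ^+ k) (qpn q k q) (qpn q k (s4 * q ^+ m)) (qpn q m s4).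
move: (qpn q k (a * b)) (qpn q k (a * c)) (qpn q k (a * d)).
move: (qpn q m.+1 (a * b * q ^+ k)) (qpn q m.+1 (b * c)) (qpn q m.+1 (b * d)).
move: (qpn q k (q ^- m.+1)) (q ^+ k).
move=> x1 x2 x3 x4 x5 y5 y6 y4 y0 y1 y2 y3 n0 n1 n2 n3 n4 n5 n6.
by field; rewrite n0 n1 n2 n3 n4 n5 n6.
Qed.

(** The first two factors form the top coefficient of p_n in the basis (b x, b/x; q)_l; by
    orthogonality only the diagonal moment contributes to the norm. *)
Lemma aw_norm_moment n : aw_coef q a b c d n n * (a / b) ^+ n * aw_moment n n = aw_norm n.
Proof.
have s21 : 1 - s4 / q != 0.
  by have := s2_gen 0%N; rewrite expr0 mulr1 subr_eq0 eq_sym.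
case: n => [|m].
  rewrite /aw_moment big_nat1 aw_coef0 addn0 /aw_norm !qpn0 muln0 !expr0 !mulr1 !mul1r.
  by rewrite ?invr1 ?mulr1 ?mul1r divff ?mulr1 ?divr1.
rewrite aw_moment_diag /aw_coef s2S.
set n := m.+1; set S := s4 * q ^+ m.
have hs k : S * q ^+ k != 1 by rewrite /S -mulrA -exprD.
have P1 : \prod_(0 <= j < n) - (q * q ^+ j) = q ^+ n * \prod_(0 <= j < n) - q ^+ j :> R[i].
  rewrite -[in q ^+ n](subn0 n) -prodr_const_nat -big_split /=.
  by apply: eq_bigr => j _; rewrite mulrN.
have P2 : \prod_(0 <= j < n) - (c * d * q ^+ j) = (c * d) ^+ n * \prod_(0 <= j < n) - q ^+ j.
  rewrite -[in (c * d) ^+ n](subn0 n) -prodr_const_nat -big_split /=.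
  by apply: eq_bigr => j _; rewrite mulrN.
have PP : (\prod_(0 <= j < n) - q ^+ j) * (\prod_(0 <= j < n) - q ^+ j) = q ^+ (m * n) :> R[i].
  rewrite [X in X * _]big_nat_rev -big_split /=.
  rewrite (eq_big_nat _ _ (F2 := fun=> q ^+ m)); last first.
    by move=> i /andP[_ hi]; rewrite mulrNN -exprD; congr (_ ^+ _); lia.
  by rewrite prodr_const_nat subn0 -exprM.
(* Reading the products backwards turns (q^-n; q)_n into (q; q)_n and (a b / S; q)_n into (c d;
   q)_n, up to powers that [PP] and [ESn] gather. *)
have R1 := qpn_reverse q_neq0 n q_neq0; rewrite mulrAC divff // mul1r P1 in R1.
have R2 := qpn_reverse q_neq0 n (mulf_neq0 c_neq0 d_neq0); rewrite P2 in R2.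
have eS : a * b / S = q * q ^- n / (c * d).
  rewrite /S /n exprS; field.
  by rewrite a_neq0 b_neq0 c_neq0 d_neq0 q_neq0 expf_neq0.
have pr0 : \prod_(0 <= j < n) - q ^+ j != 0 :> R[i].
  by rewrite prodf_seq_neq0; apply/allP => j _ /=; rewrite oppr_eq0 expf_neq0.
have E1 : qpn q n (q ^- n) = qpn q n q / (q ^+ n * \prod_(0 <= j < n) - q ^+ j).
  by rewrite -R1 mulfK // mulf_neq0 // expf_neq0.
have E2 : qpn q n (a * b / S) = qpn q n (c * d) / ((c * d) ^+ n * \prod_(0 <= j < n) - q ^+ j).
  by rewrite eS -R2 mulfK // mulf_neq0 // expf_neq0 // mulf_neq0.
have E3 : qpn q n.+1 S = qpn q n S * (1 - s4 / q * q ^+ (2 * n)).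
  rewrite qpnSr; congr (_ * (1 - _)).
  by rewrite /S mulnC muln2 -addnn exprD /n !exprS; field.
have E4 : qpn q n (s4 / q) = (1 - s4 / q) * qpn q m s4.
  by rewrite /n qpnS mulfVK.
rewrite E1 E2 E3 /aw_norm E4.
have nz1 : 1 - s4 / q * q ^+ (2 * n) != 0 by rewrite subr_eq0 eq_sym.
have nz2 : qpn q n S != 0 by exact: qpn_neq0.
have nz3 : qpn q m s4 != 0 by exact: qpn_neq0.
have nz4 : qpn q n q != 0 by apply: qpn_neq0 => j; rewrite -exprS.
have := qpn_neq0 n ab_gen; have := qpn_neq0 n ac_gen; have := qpn_neq0 n ad_gen.
have ESn : S ^+ n * (\prod_(0 <= j < n) - q ^+ j)^-1 * (\prod_(0 <= j < n) - q ^+ j)^-1 =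
    a ^+ n * b ^+ n * (c * d) ^+ n.
  rewrite -mulrA -invfM PP /S !exprMn -exprM.
  by field; rewrite expf_neq0.
have a2 : a ^+ (2 * n) = a ^+ n * a ^+ n by rewrite mulnC exprM expr2.
move: ESn; rewrite expr_div_n a2.
move: (expf_neq0 n q_neq0) (expf_neq0 n b_neq0) (expf_neq0 n (mulf_neq0 c_neq0 d_neq0)) pr0.
move: nz1 nz2 nz3 nz4 s21.
move: (1 - s4 / q * q ^+ (2 * n)) (qpn q n S) (qpn q m s4) (qpn q n q) (1 - s4 / q).
move: (qpn q n (a * b)) (qpn q n (a * c)) (qpn q n (a * d)) (qpn q n (b * c)) (qpn q n (b * d)) (qpn q n (c * d)).
move: (q ^+ n) (b ^+ n) ((c * d) ^+ n) (a ^+ n) (S ^+ n) (\prod_(0 <= j < n) - q ^+ j).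
move=> Qn Bn CD An Sn Pr xab xac xad xbc xbd xcd z1 z2 z3 z4 z5 n1 n2 n3 n4 n5 m1 m2 m3 m4 ESn k1 k2 k3.
have -> : Sn = An * Bn * CD * Pr * Pr by rewrite -ESn; field.
by field; rewrite n1 n2 n3 n4 n5 m1 m2 m3 m4 k1 k2 k3.
Qed.

(* Each (a x, a/x)_k is triangular in the basis (b x, b/x)_l. *)
Lemma aw_phi_expand k : exists e : nat -> R[i], [/\ e k = (a / b) ^+ k,
  forall l, (k < l)%N -> e l = 0
  & forall x, x != 0 -> aw_phi q a k x = \sum_(0 <= l < k.+1) e l * aw_phi q b l x].
Proof.
elim: k => [|k [e [e1 e2 e3]]].
  exists (fun l => if l == 0%N then 1 else 0); split=> [//|[]//|x x0].
  by rewrite big_nat1 !aw_phi0 mulr1.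
pose r := a * q ^+ k; pose rl l := b * q ^+ l.
have rl0 l : rl l != 0 by rewrite mulf_neq0 ?expf_neq0.
(* The constants of (1 - r x)(1 - r/x) = al + (r/s)(1 - s x)(1 - s/x), where s stands for [rl l]. *)
pose al l := 1 + r ^+ 2 - r * (1 + rl l ^+ 2) / rl l.
exists (fun l => e l * al l + (if l is l'.+1 then e l' * (r / rl l') else 0)); split.
- rewrite e2 // mul0r add0r e1 exprSr; congr (_ * _).
  by rewrite /r /rl; field; rewrite b_neq0 expf_neq0.
- by case=> // l kl; rewrite !e2 ?mul0r ?addr0 // ltnW.
- move=> x x0; rewrite aw_phiS (e3 x x0) mulr_suml.
  transitivity (\sum_(0 <= l < k.+1) (e l * al l * aw_phi q b l x +
     e l * (r / rl l) * aw_phi q b l.+1 x)).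
    apply: eq_bigr => l _; rewrite aw_phiS /al -/(rl l) -/r.
    by move: (rl l) (rl0 l) (aw_phi q b l x) => y y0 W; field; rewrite x0 y0.
  rewrite big_split /=.
  under [RHS]eq_bigr => l _ do rewrite mulrDl.
  rewrite [RHS]big_split /=; congr (_ + _).
    by rewrite [RHS]big_nat_recr //= e2 // !mul0r addr0.
  by rewrite [RHS]big_nat_recl //= mul0r add0r.
Qed.

Lemma aw_poly_expand n : exists e : nat -> R[i], e n = aw_coef q a b c d n n * (a / b) ^+ n /\
  forall x, x != 0 -> aw_poly q a b c d n x = \sum_(0 <= l < n.+1) e l * aw_phi q b l x.
Proof.
have /choice [e he] := aw_phi_expand.
exists (fun l => \sum_(0 <= k < n.+1) aw_coef q a b c d n k * e k l); split.
  have [e1 _ _] := he n; rewrite big_nat_recr //= e1 big_nat big1 ?add0r // => k /andP[_ kn].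
  by have [_ e2 _] := he k; rewrite e2 // mulr0.
move=> x x0; under [RHS]eq_bigr => l _ do rewrite mulr_suml.
rewrite exchange_big_nat /=; apply: eq_big_nat => k /andP[_ kn].
have [_ e2 ->] := he k; rewrite // mulr_sumr [RHS](big_cat_nat _ (n := k.+1)) //= [X in _ + X]big_nat.
rewrite [X in _ + X]big1 ?addr0.
  by apply: eq_bigr => l _; rewrite mulrA.
by move=> l /andP[kl _]; rewrite e2 // mulr0 mul0r.
Qed.

Variable g : R -> R[i].
Hypothesis g_cont : {within `[0, 1], continuous g}.
Hypothesis g_closed : g 0 = g 1.
Hypothesis g_rect : rectifiable g.
Variable w0 : R[i].
Hypothesis q_lt1 : cabs q < 1.
Hypothesis tr0 : ~ curve_trace g 0.
Hypothesis winding0 : is_contour_integral g (fun x => x^-1) w0.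
Hypothesis sep : separating g q w0 [:: a; b; c; d].
Local Notation ci := (is_contour_integral g).
Local Notation w := (aw_weight q [:: a; b; c; d]).

(** One copy of p_n is expanded in (a x, a/x; q)_k and the other in (b x, b/x; q)_l, so every term
    is a doubly shifted weight; only [l = n] survives. *)
Lemma ci_aw_norm n : ci (fun x => aw_poly q a b c d n x * aw_poly q a b c d n x * w x / x)
  (aw_norm n * aw_integral g q [:: a; b; c; d]).
Proof.
have [e [en he]] := aw_poly_expand n.
set I := aw_integral g q [:: a; b; c; d].
have c1 l : ci (fun x => \sum_(0 <= k < n.+1) aw_coef q a b c d n k *
    (aw_phi q a k x * aw_phi q b l x * w x / x)) (aw_moment n l * I).
  have -> : aw_moment n l * I = \sum_(0 <= k < n.+1) aw_coef q a b c d n k *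
      aw_integral g q [:: a * q ^+ k; b * q ^+ l; c; d].
    rewrite mulr_suml; apply: eq_bigr => k _; rewrite -mulrA; congr (_ * _).
    have nz : qpn q (k + l) s4 != 0 by exact: qpn_neq0.
    have E := aw_integral_shift2 g_cont g_closed g_rect q_neq0 q_lt1 tr0 winding0 k l sep.
    apply: (mulfI nz); rewrite E -/I [LHS]mulrA [X in X * I = _]mulrCA divff //.
    by rewrite mulr1.
  exact: (ci_sum g_cont g_closed g_rect (index_iota 0 n.+1) (fun k =>
    ci_scale g_cont g_closed g_rect (aw_coef q a b c d n k)
      (ci_aw_phi2 g_cont g_closed g_rect q_neq0 q_lt1 tr0 winding0 k l sep))).
have := ci_sum g_cont g_closed g_rect (index_iota 0 n.+1) (fun l => ci_scale g_cont g_closed g_rect (e l) (c1 l)).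
rewrite big_nat_recr //= big_nat big1 ?add0r; last first.
  by move=> l /andP[_ ln]; rewrite aw_moment_lt // mul0r mulr0.
rewrite en mulrA aw_norm_moment; apply: ci_ext => x hx.
have x0 := tr_neq0 tr0 hx.
transitivity (\sum_(0 <= l < n.+1) e l * aw_phi q b l x * (aw_poly q a b c d n x * w x / x)).
  apply: eq_bigr => l _; rewrite -mulrA; congr (_ * _).
  rewrite /aw_poly !mulr_suml mulr_sumr; apply: eq_bigr => k _.
  by move: (w x) (aw_phi q a k x) (aw_phi q b l x) => W A B; field.
by rewrite -mulr_suml -he // !mulrA.
Qed.

End AWNorm.

(** * Residues of the dual weight *)

Section Circles.
Variable R : realType.
Implicit Types (h s : R) (p : R[i]).

Lemma sin_cos_bounds h : 0 <= h ->
  [/\ `|sin h| <= h, `|cos h - 1| <= h ^+ 2 & `|sin h - h| <= h ^+ 3].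
Proof.
move=> h0.
have csin a b : {within `[a, b], continuous (@sin R)}.
  by apply: continuous_subspaceT => y; exact: continuous_sin.
have ccos a b : {within `[a, b], continuous (@cos R)}.
  by apply: continuous_subspaceT => y; exact: continuous_cos.
have sin_le (x : R) : 0 <= x -> `|sin x| <= x.
  move=> x0; have [c _] := MVT_segment x0 (fun y _ => is_derive_sin y) (csin 0 x).
  rewrite sin0 !subr0 => ->; rewrite normrM (ger0_norm x0).
  by rewrite ler_piMl // cos_max.
have cos_le (x : R) : 0 <= x -> `|cos x - 1| <= x ^+ 2.
  move=> x0; have [c hc] := MVT_segment x0 (fun y _ => is_derive_cos y) (ccos 0 x).
  move: hc; rewrite in_itv /= => /andP[c0 cx].
  rewrite cos0 subr0 => ->; rewrite normrM normrN (ger0_norm x0) expr2.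
  by rewrite ler_wpM2r // (le_trans (sin_le _ c0)).
split; [exact: sin_le | exact: cos_le |].
have [c hc] := MVT_segment h0 (fun y _ => is_derive_sin y) (csin 0 h).
move: hc; rewrite in_itv /= => /andP[c0 cx].
rewrite sin0 !subr0 => ->.
have -> : cos c * h - h = (cos c - 1) * h by ring.
rewrite normrM (ger0_norm h0) exprSr ler_wpM2r //.
by apply: le_trans (cos_le _ c0) _; rewrite ler_pXn2r ?qualifE //= (le_trans c0).
Qed.

Definition cexpi s : R[i] := cos s +i* sin s.

Lemma cexpiD s h : cexpi (s + h) = cexpi s * cexpi h.
Proof. by rewrite /cexpi cosD sinD; simpc; congr (_ +i* _); ring. Qed.

Lemma cexpi0 : cexpi 0 = 1.
Proof. by rewrite /cexpi cos0 sin0. Qed.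

Lemma cexpi_neq0 s : cexpi s != 0.
Proof.
have := cexpiD s (- s); rewrite subrr cexpi0 => E.
by apply: contraNneq (oner_neq0 R[i]) => h; rewrite E h mul0r.
Qed.

Lemma cabs_cexpi s : cabs (cexpi s) = 1.
Proof. by rewrite /cabs /= cos2Dsin2 sqrtr1. Qed.

Lemma cexpi_first_order h : `|h| <= 1 -> cabs (cexpi h - 1 - 'i%C * h%:C) <= 2 * h ^+ 2.
Proof.
move=> h1; apply: le_trans (cabs_ReIm _) _.
have -> : cexpi h - 1 - 'i%C * h%:C = (cos h - 1) +i* (sin h - h).
  by rewrite /cexpi; simpc.
rewrite /=; have n0 := normr_ge0 h; have [_ E1 E2] := sin_cos_bounds n0.
have -> : cos h = cos `|h| by rewrite cos_norm.
have -> : `|sin h - h| = `|sin `|h| - `|h| |.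
  have [/ger0_norm ->//|/ltr0_norm ->] := leP 0 h.
  by rewrite sinN -opprB normrN; congr `|_|; ring.
have -> : h ^+ 2 = `|h| ^+ 2 by rewrite real_normK // num_real.
have : `|h| ^+ 3 <= `|h| ^+ 2 by rewrite exprS ler_piMl // sqr_ge0.
by lra.
Qed.

Lemma cexpi_lipschitz h : cabs (cexpi h - 1) <= 3 * `|h|.
Proof.
have n0 := normr_ge0 h.
have [h1|h1] := leP `|h| 1; last first.
  apply: le_trans (cabsD _ _) _; rewrite cabsN cabs_cexpi cabs1; lra.
have E := cexpi_first_order h1.
have -> : cexpi h - 1 = (cexpi h - 1 - 'i%C * h%:C) + 'i%C * h%:C by ring.
apply: le_trans (cabsD _ _) _; rewrite cabsM cabs_real.
have -> : cabs 'i%C = 1 :> R by rewrite cabs_i.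
have : h ^+ 2 <= `|h| by rewrite -real_normK ?num_real // expr2 ler_piMl.
by lra.
Qed.

Variables (p : R[i]) (r : R).
Hypothesis r_gt0 : 0 < r.
Local Notation g := (circle_path p r).

Lemma circle_pathE s : g s = p + r%:C * cexpi (2 * pi * s). Proof. by []. Qed.

Lemma circle_trace x : curve_trace g x -> cabs (x - p) = r.
Proof.
move=> [s _ <-]; rewrite circle_pathE addrAC subrr add0r cabsM cabs_cexpi mulr1.
by rewrite cabs_real gtr0_norm.
Qed.

Lemma circle_lipschitz s s' : cabs (g s - g s') <= r * (6 * pi) * `|s - s'|.
Proof.
rewrite !circle_pathE.
have -> : 2 * pi * s = 2 * pi * s' + 2 * pi * (s - s') by ring.
rewrite cexpiD.
set u := cexpi (2 * pi * s'); set v := cexpi _.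
have -> : p + r%:C * (u * v) - (p + r%:C * u) = r%:C * (u * (v - 1)) by ring.
rewrite !cabsM cabs_cexpi mul1r cabs_real gtr0_norm // -mulrA ler_wpM2l ?(ltW r_gt0) //.
apply: le_trans (cexpi_lipschitz _) _.
by rewrite !normrM (ger0_norm (pi_ge0 R)) ger0_norm // !mulrA; lra.
Qed.

Lemma circle_continuous : {within `[0, 1], continuous g}.
Proof.
apply: continuous_subspaceT => s; apply/cvgrPdist_lt => e e0.
have eE : e = (complex.Re e)%:C by rewrite RRe_real // gtr0_real.
have e0' : 0 < complex.Re e by rewrite -ltcR -eE.
have L0 : 0 < r * (6 * pi) by rewrite !mulr_gt0 // pi_gt0.
apply/nbhs_ballP; exists (complex.Re e / (r * (6 * pi))) => /=; first by rewrite divr_gt0.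
move=> s' /= hs.
rewrite normcabs eE ltcR; apply: le_lt_trans (circle_lipschitz _ _) _.
by rewrite mulrC -ltr_pdivlMr.
Qed.

Lemma circle_closed : g 0 = g 1.
Proof.
rewrite !circle_pathE mulr0 mulr1 cexpi0.
have -> : 2 * pi = pi *+ 2 :> R by rewrite mulr2n; ring.
by rewrite /cexpi cos2pi sin2pi.
Qed.

Lemma circle_rectifiable : rectifiable g.
Proof.
exists (r * (6 * pi)) => s hs; set t := nth 1 (0 :: s).
move=> /=; have h : \sum_(0 <= j < size s) cabs (g (t j.+1) - g (t j)) <= r * (6 * pi).
  apply: (@le_trans _ _ (\sum_(0 <= j < size s) r * (6 * pi) * (t j.+1 - t j))).
    apply: ler_sum_nat => j /andP[_ hj]; apply: le_trans (circle_lipschitz _ _) _.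
    by rewrite ger0_norm // subr_ge0 ltW // partition_le.
  rewrite -mulr_sumr telescope_sumr // /t (itv_partition_nth_size 1 hs) /=.
  by rewrite subr0 mulr1.
under eq_bigr => j _ do rewrite normcabs.
by rewrite -rmorph_sum /= lecR.
Qed.

(** A direct estimate: with the tag [z] as origin, each term of the sum is a difference of two
    exponentials of small angle, whose linear part is exactly ['i] times the increment of the
    angle. *)
Lemma circle_winding : is_contour_integral g (fun x => (x - p)^-1) (two_pi_i R).
Proof.
pose W : R := 2 * pi.
have W0 : 0 < W by rewrite mulr_gt0 // pi_gt0.
apply/ciP => e e0.
have W8 : 0 < 8 * W ^+ 2 by rewrite mulr_gt0 // exprn_gt0.
have d0 : 0 < e / (8 * W ^+ 2) by rewrite divr_gt0.
(* The first bound keeps the angles at most 1; the second makes the quadratic errors, at most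
   [4 * (W * (y - x)) ^+ 2] per step, add up to [e / 2]. *)
exists (Num.min W^-1 (e / (8 * W ^+ 2))); first by rewrite lt_min invr_gt0 W0.
move=> s tau [hs hst].
pose t := nth 1 (0 :: s).
have E : \sum_(0 <= j < size s) 'i%C * (W * (t j.+1 - t j))%:C = two_pi_i R.
  rewrite -mulr_sumr -rmorph_sum -mulr_sumr telescope_sumr //.
  by rewrite /t (itv_partition_nth_size 1 hs) /= subr0 mulr1 /two_pi_i; simpc.
rewrite -[X in cabs (_ - X)]E -sumrB.
apply: le_lt_trans (cabs_sum _ _ _) _.
apply: (@le_lt_trans _ _ (\sum_(0 <= j < size s) e / 2 * (t j.+1 - t j))); last first.
  by rewrite -mulr_sumr telescope_sumr // /t (itv_partition_nth_size 1 hs) /=; lra.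
apply: ler_sum_nat => j /andP[_ hj].
have [hd /andP[h1 h2]] := hst j hj; rewrite -/t in hd h1 h2.
move: hd; rewrite lt_min => /andP[hd1 hd2].
set x := t j in h1 hd1 hd2 *; set y := t j.+1 in h2 hd1 hd2 *; set z := tau j in h1 h2 *.
pose u := W * (y - z); pose v := W * (x - z).
have yx0 : 0 <= y - x by lra.
have Wd : W * (y - x) <= 1.
  by rewrite -(@mulfV _ W) ?gt_eqF // ler_wpM2l ?(ltW W0) // ltW.
have bu : `|u| <= W * (y - x).
  have u0 : 0 <= W * (y - z) by apply: mulr_ge0; lra.
  by rewrite ger0_norm //; apply: ler_wpM2l; lra.
have bv : `|v| <= W * (y - x).
  have v0 : 0 <= W * (z - x) by apply: mulr_ge0; lra.
  have -> : v = - (W * (z - x)) by rewrite /v; ring.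
  by rewrite normrN ger0_norm //; apply: ler_wpM2l; lra.
have sq k : `|k| <= W * (y - x) -> k ^+ 2 <= (W * (y - x)) ^+ 2.
  by move=> hk; rewrite -real_normK ?num_real // ler_pXn2r ?qualifE //= (le_trans _ hk).
have -> : (g z - p)^-1 * (g y - g x) - 'i%C * (W * (y - x))%:C =
   (cexpi u - 1 - 'i%C * u%:C) - (cexpi v - 1 - 'i%C * v%:C).
  rewrite !circle_pathE -/W.
  have -> : W * y = W * z + u by rewrite /u; ring.
  have -> : W * x = W * z + v by rewrite /v; ring.
  have -> : W * (y - x) = u - v by rewrite /u /v; ring.
  rewrite !cexpiD rmorphB /=; have := cexpi_neq0 (W * z).
  have : r%:C != 0 :> R[i] by rewrite -cabs_gt0 cabs_real normr_gt0 gt_eqF.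
  move: (cexpi (W * z)) (cexpi u) (cexpi v) (u%:C) (v%:C) r%:C => A B C U V r' r0 A0.
  have -> : p + r' * A - p = r' * A by ring.
  by field; rewrite ?A0 ?r0.
apply: le_trans (cabsD _ _) _; rewrite cabsN.
have k1 := cexpi_first_order (le_trans bu Wd).
have k2 := cexpi_first_order (le_trans bv Wd).
have k3 := sq _ bu; have k4 := sq _ bv.
have k5 : 4 * (W * (y - x)) ^+ 2 <= e / 2 * (y - x).
  have -> : 4 * (W * (y - x)) ^+ 2 = (4 * W ^+ 2 * (y - x)) * (y - x) by ring.
  rewrite ler_wpM2r //.
  move: hd2; rewrite ltr_pdivlMr // => hd2.
  have -> : 4 * W ^+ 2 * (y - x) = (y - x) * (8 * W ^+ 2) / 2 by field.
  lra.
by lra.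
Qed.

End Circles.

Section Residues.
Variable R : realType.

Lemma two_pi_i_neq0 : two_pi_i R != 0.
Proof.
by rewrite /two_pi_i eq_complex /= eqxx /= mulf_neq0 ?pnatr_eq0 // gt_eqF // pi_gt0.
Qed.

Lemma residueE (F : R[i] -> R[i]) p v : is_residue F p v -> residue F p = v.
Proof.
move=> hv; have : is_residue F p (residue F p) by exact: (@getPex _ [set w | is_residue F p w] (ex_intro _ v hv)).
case: hv => r1 r10 h1 [r2 r20 h2].
have m0 : 0 < Num.min r1 r2 by rewrite lt_min r10.
have l1 : Num.min r1 r2 <= r1 by rewrite ge_min lexx.
have l2 : Num.min r1 r2 <= r2 by rewrite ge_min lexx orbT.
have c1 := h1 (Num.min r1 r2 / 2) ltac:(lra).
have c2 := h2 (Num.min r1 r2 / 2) ltac:(lra).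
exact: (mulfI two_pi_i_neq0 (ci_unique c2 c1)).
Qed.

Lemma residue_simple_pole (S : set R[i]) (F K : R[i] -> R[i]) p :
  (exists2 rho : R, 0 < rho & forall z, S z -> rho <= cabs (z - p)) -> approx S K ->
  (forall z, ~ S z -> z != p -> F z = K z / (z - p)) -> residue F p = K p.
Proof.
move=> [rho rho0 hS] aK FK; apply: residueE; exists rho => // r /andP[r0 rr].
have Sp : ~ S p by move=> /hS; rewrite subrr cabs0; lra.
have tr_r := @circle_trace R p r r0.
have trS z : S z -> ~ curve_trace (circle_path p r) z.
  by move=> /hS h /tr_r; lra.
have trp : ~ curve_trace (circle_path p r) p by move=> /tr_r; rewrite subrr cabs0; lra.
have g_cont := @circle_continuous R p r r0.
have g_closed := @circle_closed R p r.
have g_rect := @circle_rectifiable R p r r0.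
have wS z : S z -> is_contour_integral (circle_path p r) (fun x => (x - z)^-1) 0.
  move=> /hS h; apply: (winding_far g_cont g_closed g_rect (c := p) (rho := r)).
    by move=> x /tr_r ->.
  lra.
have := ci_cauchy g_cont g_closed g_rect trS wS Sp trp (@circle_winding R p r r0) aK.
apply: ci_ext => x hx; rewrite FK //; first by move=> /trS.
by apply/eqP => E; have := tr_r x hx; rewrite E subrr cabs0; lra.
Qed.

Lemma isolated_union (S1 S2 : set R[i]) p :
  (exists2 rho : R, 0 < rho & forall z, S1 z -> rho <= cabs (z - p)) ->
  (exists2 rho : R, 0 < rho & forall z, S2 z -> rho <= cabs (z - p)) ->
  exists2 rho : R, 0 < rho & forall z, (S1 z \/ S2 z) -> rho <= cabs (z - p).
Proof.
move=> [r1 r10 h1] [r2 r20 h2]; exists (Num.min r1 r2); first by rewrite lt_min r10.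
by move=> z [/h1|/h2] h; rewrite ge_min h ?orbT.
Qed.

Variable q : R[i].
Hypothesis q_neq0 : q != 0.
Hypothesis q_lt1 : cabs q < 1.

(** The flag selects the sequence tending to 0 or the one tending to infinity; the predicate [P]
    allows the index of the pole under study to be left out. *)
Definition qspiral (P : nat -> Prop) (tw : bool) (e : R[i]) : set R[i] :=
  [set z | exists2 k, P k & z = if tw then e * q ^+ k else (e * q ^+ k)^-1].

(** A sequence tending to 0 has only finitely many points near a non-zero [p]; the other kind is
    reduced to it by inversion. *)
Lemma isolated_qspiral P tw e p : e != 0 -> p != 0 -> ~ qspiral P tw e p ->
  exists2 rho : R, 0 < rho & forall z, qspiral P tw e z -> rho <= cabs (z - p).
Proof.
have isol e' p' : p' != 0 -> ~ qspiral P true e' p' ->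
    exists2 rho : R, 0 < rho & forall k, P k -> rho <= cabs (e' * q ^+ k - p').
  move=> p0 hp; have cp0 : 0 < cabs p' by rewrite cabs_gt0.
  have [N hN] := expr_small q_lt1 (cabs_ge0 e') (e := cabs p' / 2) ltac:(lra).
  have [rho rho0 hrho] : exists2 rho : R, 0 < rho &
      forall k, (k < N)%N -> P k -> rho <= cabs (e' * q ^+ k - p').
    elim: N {hN} => [|N [r r0 hr]]; first by exists 1.
    have [PN|nPN] := pselect (P N); last first.
      exists r => // k; rewrite ltnS leq_eqVlt => /predU1P[->//|]; exact: hr.
    have c0 : 0 < cabs (e' * q ^+ N - p').
      by rewrite cabs_gt0 subr_eq0; apply/eqP => h; apply: hp; exists N.
    exists (Num.min r (cabs (e' * q ^+ N - p'))); first by rewrite lt_min r0.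
    move=> k; rewrite ltnS leq_eqVlt ge_min => /predU1P[->|kN Pk].
      by rewrite lexx orbT.
    by rewrite hr.
  exists (Num.min rho (cabs p' / 2)); first by rewrite lt_min rho0; lra.
  move=> k Pk; rewrite ge_min; have [kN|Nk] := ltnP k N; first by rewrite hrho.
  have := hN k Nk; have := cabs_le_dist p' (e' * q ^+ k).
  by rewrite cabsM cabsX cabsB => h1 h2; apply/orP; right; lra.
case: tw => e0 p0 hp.
  have [rho rho0 h] := isol e p p0 hp.
  by exists rho => // z [k Pk ->]; exact: h.
have cp : 0 < cabs p by rewrite cabs_gt0.
have ce : 0 < cabs e by rewrite cabs_gt0.
have [|rho rho0 h] := isol e p^-1 ltac:(by rewrite invr_neq0).
  by move=> [k Pk E]; apply: hp; exists k => //; rewrite -E invrK.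
exists (cabs p * rho / cabs e); first by rewrite divr_gt0 // mulr_gt0.
move=> z [k Pk ->]; have z0 : e * q ^+ k != 0 by rewrite mulf_neq0 ?expf_neq0.
have -> : (e * q ^+ k)^-1 - p = - (p * (e * q ^+ k - p^-1) / (e * q ^+ k)).
  by move: (e * q ^+ k) z0 => y y0; field; rewrite y0 p0.
rewrite cabsN cabsM cabsV cabsM ler_pM //.
- by rewrite mulr_ge0 ?ltW.
- by rewrite invr_ge0 ltW.
- by rewrite ler_wpM2l ?(ltW cp) // h.
rewrite lef_pV2 ?qualifE //= ?cabs_gt0 // cabsM cabsX ler_piMr ?(ltW ce) //.
by rewrite exprn_ile1 ?cabs_ge0 // ltW.
Qed.

(** The points gamma_m^-1 with m < 0 are the inverses of those with index -m > 0; the flag treats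
    both kinds at once. *)
Definition twist (tw : bool) (x : R[i]) := if tw then x^-1 else x.

Lemma approx_qpoch_twist S tw e : S 0 -> e != 0 ->
  (forall k, S (if tw then e * q ^+ k else (e * q ^+ k)^-1)) ->
  approx S (fun x => (qpoch q (e * twist tw x))^-1).
Proof.
case: tw => S0 e0 hS; first exact: approx_qpoch_inv_div.
exact: approx_qpoch_inv_scale.
Qed.

Lemma approx_qpn_twist S tw e n : S 0 -> e != 0 ->
  (forall k, (k < n)%N -> S (if tw then e * q ^+ k else (e * q ^+ k)^-1)) ->
  approx S (fun x => (qpn q n (e * twist tw x))^-1).
Proof.
move=> S0 e0; elim: n => [|n IH] hS.
  by apply: approx_ext (approx_brational (brational_cst S 1)) => x _; rewrite qpn0 invr1.
have h1 := IH (fun k kn => hS k (ltnW kn)).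
have z0 : e * q ^+ n != 0 by rewrite mulf_neq0 ?expf_neq0.
have h2 : approx S (fun x => (1 - e * twist tw x * q ^+ n)^-1).
  have := hS n (ltnSn n); case: tw {IH hS h1} => hS.
    apply: approx_ext (approx_brational (brational_mul (brational_id S) (brational_invB hS))) => x hx.
    have x0 : x != 0 by apply/eqP => x0; apply: hx; rewrite x0.
    have -> : 1 - e * twist true x * q ^+ n = (x - e * q ^+ n) / x by rewrite /twist; field.
    by rewrite invf_div.
  apply: approx_ext (approx_brational (brational_mul (brational_cst S (- (e * q ^+ n))^-1) (brational_invB hS))) => x hx.
  by rewrite /= -invfM /twist mulNr mulrBr divff // opprB mulrAC.
by apply: approx_ext (approx_mul h1 h2) => x _; rewrite qpnSr invfM.
Qed.

(* The Askey-Wilson weight with the factor 1 - a q^n y of its denominator removed *)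
Definition aw_res a es n (y : R[i]) : R[i] := qpoch q (y ^+ 2) * qpoch q (y ^- 2) *
  ((qpn q n (a * y))^-1 * (qpoch q (a * q ^+ n.+1 * y))^-1 * (qpoch q (a / y))^-1 *
   \prod_(e <- es) ((qpoch q (e * y))^-1 * (qpoch q (e / y))^-1)).

Lemma aw_weight_res a es n y : aw_weight q (a :: es) y = aw_res a es n y / (1 - a * q ^+ n * y).
Proof.
rewrite /aw_weight /aw_res big_cons (qpoch_split q_lt1 n.+1 (a * y)) qpnSr.
have -> : a * y * q ^+ n.+1 = a * q ^+ n.+1 * y by ring.
have -> : a * y * q ^+ n = a * q ^+ n * y by ring.
have -> : \prod_(e <- es) ((qpoch q (e * y))^-1 * (qpoch q (e / y))^-1) =
    (\prod_(e <- es) (qpoch q (e * y) * qpoch q (e / y)))^-1.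
  by rewrite -prodfV; apply: eq_bigr => e _; rewrite invfM.
rewrite !invfM; ring.
Qed.

Lemma aw_weight_inv es y : aw_weight q es y^-1 = aw_weight q es y.
Proof.
rewrite /aw_weight !exprVn invrK; congr (_ / _); first by rewrite mulrC.
by apply: eq_bigr => e _; rewrite invrK mulrC.
Qed.

Variables (a : R[i]) (es : seq R[i]) (n : nat).
Hypothesis a_neq0 : a != 0.
Hypothesis es_neq0 : forall e, e \in es -> e != 0.
Hypothesis aa_gen : forall z : int, a * a != q ^ z.
Hypothesis ae_gen : forall e, e \in es -> forall z : int, a * e != q ^ z.
Hypothesis a_e_gen : forall e, e \in es -> forall z : int, a / e != q ^ z.

(** All poles of the weight and 0, except the pole whose residue is taken. *)
Let poles (tw : bool) : set R[i] := [set z | z = 0 \/ ((qspiral setT (~~ tw) a z \/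
  qspiral (fun k => k <> n) tw a z) \/ exists2 e, e \in es & (qspiral setT tw e z \/ qspiral setT (~~ tw) e z))].

Let pole tw := twist tw (a * q ^+ n)^-1.

Let pole_neq0 tw : pole tw != 0.
Proof. by rewrite /pole /twist; case: tw; rewrite !invr_eq0 mulf_neq0 ?expf_neq0. Qed.

Let approx_res tw : approx (poles tw) (fun x => aw_res a es n (twist tw x)).
Proof.
have S0 : poles tw 0 by left.
have twV x : (twist tw x)^-1 = twist (~~ tw) x by rewrite /twist; case: (tw); rewrite ?invrK.
have sq t : brational (poles tw) (fun x => twist t x ^+ 2).
  by case: t; [apply: brational_mul; exact: brational_inv | apply: brational_mul; exact: brational_id].
apply: approx_mul; first apply: approx_mul.
- exact: approx_qpoch.
- apply: approx_ext (approx_qpoch q_lt1 (sq (~~ tw))) => x _.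
  by rewrite -exprVn twV.
apply: approx_mul; first apply: approx_mul; first apply: approx_mul.
- apply: approx_qpn_twist => // k kn; right; left; right; exists k => //; lia.
- apply: approx_qpoch_twist => //; first by rewrite mulf_neq0 ?expf_neq0.
  move=> k; right; left; right; exists (n.+1 + k)%N; first lia.
  by rewrite exprD !mulrA.
- apply: approx_ext (@approx_qpoch_twist (poles tw) (~~ tw) a S0 a_neq0 _) => [x _|k].
    by rewrite twV.
  by right; left; left; exists k.
have H (es' : seq R[i]) : (forall e, e \in es' -> e \in es) ->
  approx (poles tw) (fun x => \prod_(e <- es') ((qpoch q (e * twist tw x))^-1 * (qpoch q (e / twist tw x))^-1)).
  elim: es' => [|e es' IH] hes.
    by apply: approx_ext (approx_brational (brational_cst _ 1)) => x _; rewrite big_nil.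
  have he : e \in es by apply: hes; rewrite mem_head.
  have e0 := es_neq0 he.
  have h1 : approx (poles tw) (fun x => (qpoch q (e * twist tw x))^-1).
    by apply: approx_qpoch_twist => // k; right; right; exists e => //; left; exists k.
  have h2 : approx (poles tw) (fun x => (qpoch q (e * twist (~~ tw) x))^-1).
    by apply: approx_qpoch_twist => // k; right; right; exists e => //; right; exists k.
  apply: approx_ext (approx_mul (approx_mul h1 h2) (IH _)) => [x _|z hz].
    by rewrite big_cons twV.
  by apply: hes; rewrite inE hz orbT.
exact: H.
Qed.

Let isolated_pole tw :
  exists2 rho : R, 0 < rho & forall z, poles tw z -> rho <= cabs (z - pole tw).
Proof.
have p0 := pole_neq0 tw; have P0 : a * q ^+ n != 0 by rewrite mulf_neq0 ?expf_neq0.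
have qz k m : q ^+ k / q ^+ m = q ^ (k%:Z - m%:Z) by rewrite expfzDr // exprnN.
apply: (@isolated_union [set z | z = 0]).
  exists (cabs (pole tw)); first by rewrite cabs_gt0.
  by move=> z ->; rewrite sub0r cabsN.
apply: (@isolated_union (fun z => qspiral setT (~~ tw) a z \/ qspiral (fun k => k <> n) tw a z)).
  apply: isolated_union; apply: isolated_qspiral => //.
    move=> [k _ E]; have := aa_gen (- (n + k)%:Z); rewrite -exprnN.
    suff -> : a * a = q ^- (n + k) by rewrite eqxx.
    have : a * q ^+ n * (a * q ^+ k) = 1.
      by move: E; rewrite /pole /twist; case: (tw) => /= E; rewrite ?invrK in E; 
        [rewrite E mulVf ?mulf_neq0 ?expf_neq0 | rewrite -E divff].
    by move=> h; apply: (mulIf (expf_neq0 (n + k) q_neq0)); rewrite mulVf ?expf_neq0 // -h exprD; ring.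
  move=> [k kn E]; apply: kn.
  have {}E : a * q ^+ k = a * q ^+ n.
    by move: E; rewrite /pole /twist; case: (tw) => /= E; rewrite ?invrK in E; 
       [rewrite E | apply: invr_inj; rewrite E].
  by have [] := qz_inj q_neq0 q_lt1 (mulfI a_neq0 E : q ^ k%:Z = q ^ n%:Z).
have H (es' : seq R[i]) : (forall e, e \in es' -> e \in es) -> exists2 rho : R, 0 < rho &
    forall z, (exists2 e, e \in es' & (qspiral setT tw e z \/ qspiral setT (~~ tw) e z)) ->
    rho <= cabs (z - pole tw).
  elim: es' => [|e es' IH] hes; first by exists 1 => // z [].
  have he : e \in es by apply: hes; rewrite mem_head.
  have e0 := es_neq0 he.
  have [|rho rho0 h] := IH; first by move=> e' he'; apply: hes; rewrite inE he' orbT.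
  have [||rho' rho'0 h'] := @isolated_union (qspiral setT tw e) (qspiral setT (~~ tw) e) (pole tw).
  - apply: isolated_qspiral => // -[k _ E].
    have {}E : e * q ^+ k = a * q ^+ n.
      by move: E; rewrite /pole /twist; case: (tw) => /= E; rewrite ?invrK in E; 
        [rewrite E | apply: invr_inj; rewrite E].
    have /eqP[] := a_e_gen he (k%:Z - n%:Z); rewrite -qz.
    by apply: (mulIf e0); rewrite mulfVK //; apply: (mulIf (expf_neq0 n q_neq0));
       rewrite -E; field; rewrite expf_neq0.
  - apply: isolated_qspiral => // -[k _ E].
    have {}E : a * q ^+ n * (e * q ^+ k) = 1.
      by move: E; rewrite /pole /twist; case: (tw) => /= E; rewrite ?invrK in E; 
        [rewrite E mulVf ?mulf_neq0 ?expf_neq0 | rewrite -E divff].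
    have /eqP[] := ae_gen he (- (n + k)%:Z); rewrite -exprnN.
    by apply: (mulIf (expf_neq0 (n + k) q_neq0)); rewrite mulVf ?expf_neq0 // -E exprD; ring.
  exists (Num.min rho rho'); first by rewrite lt_min rho0.
  move=> z [e']; rewrite inE => /predU1P[-> hz|he' hz]; rewrite ge_min.
    by rewrite h' ?orbT.
  by rewrite h //; exists e'.
exact: H.
Qed.

(** The weight is invariant under inversion while dz/z changes sign, so residues at inverse poles
    are opposite. *)
Lemma residue_aw_weight tw : residue (fun z => aw_weight q (a :: es) z / z) (twist tw (a * q ^+ n)^-1) =
  (if tw then 1 else -1) * aw_res a es n (a * q ^+ n)^-1.
Proof.
have P0 : a * q ^+ n != 0 by rewrite mulf_neq0 ?expf_neq0.
have inv0 : approx (poles tw) (fun x => x^-1).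
  by apply: approx_brational; apply: brational_inv; left.
(* The second factor is what remains of 1/z and the linear factor of the weight once the denominator
   is written as z minus the pole. *)
pose K x := aw_res a es n (twist tw x) * (if tw then 1 else - (a * q ^+ n)^-1 * x^-1).
have ac : approx (poles tw) (fun x => if tw then 1 else - (a * q ^+ n)^-1 * x^-1).
  move: inv0; case: (tw) => inv0; first exact: (approx_brational (brational_cst _ 1)).
  exact: approx_mul (approx_brational (brational_cst _ (- (a * q ^+ n)^-1))) inv0.
have aK : approx (poles tw) K := approx_mul (@approx_res tw) ac.
rewrite (residue_simple_pole (isolated_pole tw) aK).
  rewrite /K /pole mulrC; case: (tw); rewrite /twist /= ?invrK //; congr (_ * _).
  by rewrite mulNr mulVf.
move=> z hz zp.
have z0 : z != 0 by apply/eqP => z0; apply: hz; left.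
have -> : aw_weight q (a :: es) z = aw_weight q (a :: es) (twist tw z).
  by rewrite /twist; case: (tw); rewrite ?aw_weight_inv.
rewrite (aw_weight_res _ _ n) /K /pole -[LHS]mulrA -[RHS]mulrA; congr (_ * _).
move: zp; rewrite /pole /twist; case: (tw); rewrite ?invrK => zp.
  have zp' : z - a * q ^+ n != 0 by rewrite subr_eq0.
  move: (a * q ^+ n) P0 zp' => P P0 zp'.
  have -> : 1 - P / z = (z - P) / z by field.
  by field; rewrite z0 zp'.
have zp' : z - (a * q ^+ n)^-1 != 0 by rewrite subr_eq0.
move: (a * q ^+ n) P0 zp' => P P0 zp'.
have -> : 1 - P * z = - P * (z - P^-1) by rewrite mulNr mulrBr divff // opprB.
move: (z - P^-1) zp' => D D0; field; rewrite ?z0 ?D0 ?P0 //=.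
Qed.

End Residues.

(** * The residues as a sequence in the index, compared with the norms *)

Section ResidueNorm.
Variable R : realType.
Variables (q al be ga de : R[i]).
Hypothesis q_neq0 : q != 0.
Hypothesis q_lt1 : cabs q < 1.
Hypothesis al_neq0 : al != 0.
Hypothesis es_neq0 : forall e, e \in [:: be; ga; de] -> e != 0.
Hypothesis aa_gen : forall z : int, al * al != q ^ z.
Hypothesis ae_gen : forall e, e \in [:: be; ga; de] -> forall z : int, al * e != q ^ z.
Hypothesis a_e_gen : forall e, e \in [:: be; ga; de] -> forall z : int, al / e != q ^ z.

Definition aw_res_pole n : R[i] := aw_res q al [:: be; ga; de] n (al * q ^+ n)^-1.

Let qn0 n : q ^+ n != 0. Proof. exact: expf_neq0. Qed.

Let gen x i j : (forall z : int, x != q ^ z) -> q ^+ j - x * q ^+ i != 0.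
Proof.
move=> h; rewrite subr_eq0; apply/eqP => E; have /eqP[] := h (j%:Z - i%:Z).
by rewrite expfzDr // -exprnP -exprnN E mulfK.
Qed.

Let gen1 x i : (forall z : int, x != q ^ z) -> 1 - x * q ^+ i != 0.
Proof. by move=> /(gen i 0); rewrite expr0. Qed.

(** Passing from [P = al q^n] to [P q] moves each infinite product by one factor, and those in
    squares by two; the product that has lost its vanishing factor is (q; q)_oo at both poles. *)
Lemma aw_res_poleS n : aw_res_pole n.+1 *
    ((1 - al * q ^+ n * (al * q ^+ n)) * (1 - al * q ^+ n * (al * q ^+ n) * q) *
     ((1 - (q ^+ n.+1)^-1) * ((1 - be / (al * q ^+ n.+1)) * (1 - ga / (al * q ^+ n.+1)) *
        (1 - de / (al * q ^+ n.+1))))) =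
  aw_res_pole n * ((1 - (al * q ^+ n.+1)^-1 ^+ 2) * (1 - (al * q ^+ n.+1)^-1 ^+ 2 * q) *
     ((1 - al * (al * q ^+ n)) * ((1 - be * (al * q ^+ n)) * (1 - ga * (al * q ^+ n)) *
       (1 - de * (al * q ^+ n))))).
Proof.
have n1 : 1 - al * q ^+ n * (al * q ^+ n) != 0.
  by have := gen1 (n + n) aa_gen; rewrite exprD mulrACA.
have n2 : 1 - al * q ^+ n * (al * q ^+ n) * q != 0.
  have := gen1 (n + n).+1 aa_gen; rewrite exprSr exprD.
  by have -> : al * al * (q ^+ n * q ^+ n * q) = al * q ^+ n * (al * q ^+ n) * q by ring.
have n3 : 1 - al * (al * q ^+ n) != 0 by have := gen1 n aa_gen; rewrite mulrA.
have n4 : 1 - (q ^+ n.+1)^-1 != 0.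
  by rewrite subr_eq0 eq_sym invr_eq1 q_nroot.
have n5 e : e \in [:: be; ga; de] -> 1 - e * (al * q ^+ n) != 0.
  by move=> he; have := gen1 n (ae_gen he); rewrite mulrCA mulrA.
have n6 e : e \in [:: be; ga; de] -> 1 - e / (al * q ^+ n.+1) != 0.
  move=> he; have e0 := es_neq0 he; have := gen n.+1 0 (a_e_gen he); rewrite expr0 => h.
  have -> : 1 - e / (al * q ^+ n.+1) = - (e / (al * q ^+ n.+1)) * (1 - al / e * q ^+ n.+1).
    by move: (qn0 n.+1) => h'; field; rewrite al_neq0 e0 h'.
  by rewrite mulf_neq0 // oppr_eq0 mulf_neq0 // invr_neq0 // mulf_neq0.
rewrite /aw_res_pole /aw_res !big_cons !big_nil !mulr1.
set P := al * q ^+ n in n1 n2 n3 n5 *.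
have P0 : P != 0 by rewrite mulf_neq0.
have Pq : al * q ^+ n.+1 = P * q by rewrite exprSr mulrA.
have nz6 e : e \in [:: be; ga; de] -> 1 - e / (P * q) != 0 by rewrite -Pq; apply: n6.
have sq y : (y^-1) ^- 2 = y * y :> R[i] by rewrite exprVn invrK expr2.
rewrite !Pq !sq !invrK.
have s1 : qpoch q ((P * q)^-1 ^+ 2) = (1 - (P * q)^-1 ^+ 2) * ((1 - (P * q)^-1 ^+ 2 * q) * qpoch q (P^-1 ^+ 2)).
  rewrite !(qpochS q_lt1 ((P * q)^-1 ^+ 2)) (qpochS q_lt1 (_ * q)).
  by have -> : (P * q)^-1 ^+ 2 * q * q = P^-1 ^+ 2 by field; rewrite P0 q_neq0.
have s2 : qpoch q (P * q * (P * q)) = qpoch q (P * P) / ((1 - P * P) * (1 - P * P * q)).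
  rewrite (qpochS q_lt1 (P * P)) (qpochS q_lt1 (P * P * q)).
  have -> : P * P * q * q = P * q * (P * q) by ring.
  by move: (qpoch _ _) => X; field; rewrite n1 n2.
have s3 : (qpn q n.+1 (al / (P * q)))^-1 = (1 - (q ^+ n.+1)^-1)^-1 * (qpn q n (al / P))^-1.
  have -> : al / (P * q) = (q ^+ n.+1)^-1.
    by rewrite -Pq; field; rewrite al_neq0 qn0.
  rewrite qpnS invfM; congr (_ * (qpn q n _)^-1).
  by rewrite exprS /P; field; rewrite al_neq0 q_neq0 qn0.
have s4 : al * q ^+ n.+2 / (P * q) = P * q / P.
  by rewrite /P !exprS; field; rewrite al_neq0 q_neq0 qn0.
have s5 x : 1 - x * P != 0 -> (qpoch q (x * (P * q)))^-1 = (1 - x * P) * (qpoch q (x * P))^-1.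
  by move=> x0; rewrite (qpochS q_lt1 (x * P)) invfM [RHS]mulrA divff // mul1r mulrA.
have s6 x : (qpoch q (x / (P * q)))^-1 = (1 - x / (P * q))^-1 * (qpoch q (x / P))^-1.
  rewrite (qpochS q_lt1 (x / (P * q))) invfM; congr (_ * (qpoch q _)^-1).
  by field; rewrite P0 q_neq0.
have b1 : be \in [:: be; ga; de] by rewrite inE eqxx.
have b2 : ga \in [:: be; ga; de] by rewrite !inE eqxx orbT.
have b3 : de \in [:: be; ga; de] by rewrite !inE eqxx !orbT.
clearbody P.
rewrite s1 s2 s3 s4 (s6 be) (s6 ga) (s6 de) (s5 al n3) (s5 be (n5 _ b1)) (s5 ga (n5 _ b2)) (s5 de (n5 _ b3)).
have := nz6 _ b1; have := nz6 _ b2; have := nz6 _ b3; move: n4 n1 n2.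
clear.
move: (qpoch q (P^-1 ^+ 2)) (qpoch q (P * P)) (qpn q n (al / P))^-1 => x1 x2 x3.
move: (qpoch q (P * q / P))^-1 (qpoch q (al * P))^-1 (qpoch q (be / P))^-1 (qpoch q (ga / P))^-1 => x4 x5 x6 x7.
move: (qpoch q (de / P))^-1 (qpoch q (be * P))^-1 (qpoch q (ga * P))^-1 (qpoch q (de * P))^-1 => x8 x9 y1 y2.
move: (1 - (q ^+ n.+1)^-1) (1 - be / (P * q)) (1 - ga / (P * q)) (1 - de / (P * q)) => z1 z2 z3 z4.
move: (1 - P * P) (1 - P * P * q) (1 - (P * q)^-1 ^+ 2) (1 - (P * q)^-1 ^+ 2 * q) => w1 w2 w3 w4.
by move=> h1 h2 h3 h4 h5 h6; field; rewrite ?h1 ?h2 ?h3 ?h4 ?h5 ?h6.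
Qed.

Variables (a b c d : R[i]).
Hypothesis bcd_neq0 : [&& a != 0, b != 0, c != 0 & d != 0].
Hypothesis s2E : a * b * c * d / q = al ^+ 2.
Hypothesis abE : a * b = al * be.
Hypothesis acE : a * c = al * ga.
Hypothesis adE : a * d = al * de.

Let mem1 : be \in [:: be; ga; de]. Proof. by rewrite inE eqxx. Qed.
Let mem2 : ga \in [:: be; ga; de]. Proof. by rewrite !inE eqxx orbT. Qed.
Let mem3 : de \in [:: be; ga; de]. Proof. by rewrite !inE eqxx !orbT. Qed.

(** All products of original parameters are rewritten in the dual ones: c d = q al/be, b d = q
    al/ga, b c = q al/de and a^2 = al be ga de/q. The factors then match those of [aw_res_poleS]. *)
Lemma aw_normS n : aw_norm q a b c d n.+1 * ((1 - al * be * q ^+ n) * (1 - al * ga * q ^+ n)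
    * (1 - al * de * q ^+ n) * (1 - al ^+ 2 * q ^+ n) * (1 - al ^+ 2 * q ^+ (2 * n.+1))) =
  aw_norm q a b c d n * (al * be * ga * de / q * (1 - q ^+ n.+1) * (1 - q * al / de * q ^+ n)
    * (1 - q * al / ga * q ^+ n) * (1 - q * al / be * q ^+ n) * (1 - al ^+ 2 * q ^+ (2 * n))).
Proof.
have [a0 b0 c0 d0] := and4P bcd_neq0.
have be0 := es_neq0 mem1; have ga0 := es_neq0 mem2; have de0 := es_neq0 mem3.
have s4 : a * b * c * d = q * al ^+ 2 by rewrite -s2E [RHS]mulrC mulfVK.
have cdE : c * d = q * al / be.
  by apply: (mulfI (mulf_neq0 a0 b0)); rewrite mulrA s4 abE; field.
have bdE : b * d = q * al / ga.
  apply: (mulfI (mulf_neq0 a0 c0)); have -> : a * c * (b * d) = a * b * c * d by ring.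
  by rewrite s4 acE; field.
have bcE : b * c = q * al / de.
  apply: (mulfI (mulf_neq0 a0 d0)); have -> : a * d * (b * c) = a * b * c * d by ring.
  by rewrite s4 adE; field.
have aaE : a ^+ 2 = al * be * ga * de / q.
  apply: (mulIf (mulf_neq0 b0 c0)); have -> : a ^+ 2 * (b * c) = a * b * (a * c) by ring.
  by rewrite abE acE bcE; field; rewrite q_neq0 de0.
rewrite /aw_norm s2E abE acE adE cdE bdE bcE.
have e1 : a ^+ (2 * n.+1) = a ^+ (2 * n) * (al * be * ga * de / q).
  by rewrite -aaE -exprD addnC mulnS.
rewrite e1 !qpnSr.
have h1 := gen1 n (ae_gen mem1); have h2 := gen1 n (ae_gen mem2); have h3 := gen1 n (ae_gen mem3).
have aa k : 1 - al ^+ 2 * q ^+ k != 0 by rewrite expr2; apply: gen1.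
have h4 := aa n; have h5 := aa (2 * n)%N; have h6 := aa (2 * n.+1)%N.
rewrite (_ : q * q ^+ n = q ^+ n.+1) ?exprS // -?exprS.
move: h1 h2 h3 h4 h5 h6; clear.
move: (1 - al ^+ 2 * q ^+ (2 * n)) (1 - al ^+ 2 * q ^+ (2 * n.+1)) (1 - al ^+ 2 * q ^+ n) (1 - al ^+ 2) => x1 x2 x3 x4.
move: (1 - al * be * q ^+ n) (1 - al * ga * q ^+ n) (1 - al * de * q ^+ n) (1 - q ^+ n.+1) => y1 y2 y3 y4.
move: (1 - q * al / be * q ^+ n) (1 - q * al / ga * q ^+ n) (1 - q * al / de * q ^+ n) (al * be * ga * de / q) => z1 z2 z3 z4.
move: (a ^+ (2 * n)) (qpn q n q) (qpn q n (q * al / de)) (qpn q n (q * al / ga)) (qpn q n (q * al / be)) => w1 w2 w3 w4 w5.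
rewrite !invfM.
move: (qpn q n (al * be))^-1 (qpn q n (al * ga))^-1 (qpn q n (al * de))^-1 (qpn q n (al ^+ 2))^-1 => u1 u2 u3 u4.
by move=> h1 h2 h3 h4 h5 h6; field; rewrite ?h1 ?h2 ?h3 ?h4 ?h5 ?h6.
Qed.

Lemma aw_res_norm n : aw_res_pole n * aw_norm q a b c d n = aw_res_pole 0.
Proof.
have be0 := es_neq0 mem1; have ga0 := es_neq0 mem2; have de0 := es_neq0 mem3.
have aa k : 1 - al ^+ 2 * q ^+ k != 0 by rewrite expr2; apply: gen1.
elim: n => [|n IH].
  rewrite /aw_norm !qpn0 muln0 !expr0 s2E !mulr1 !mul1r divff ?mulr1 //.
  by have := aa 0%N; rewrite expr0 mulr1.
rewrite -IH.
have E1 := aw_res_poleS n; have E2 := aw_normS n.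
move: E1 E2; move: (aw_res_pole n.+1) (aw_res_pole n) (aw_norm _ _ _ _ _ n.+1) (aw_norm _ _ _ _ _ n) => A' A N' N.
have h1 := gen1 n (ae_gen mem1); have h2 := gen1 n (ae_gen mem2); have h3 := gen1 n (ae_gen mem3).
have h4 := aa n; have h5 := aa (n + n)%N; have h6 := aa (n + n).+2; have h7 := aa (n + n).+1.
have h8 : 1 - q ^+ n.+1 != 0 by rewrite subr_eq0 eq_sym q_nroot.
have g1 := gen n.+1 0 (a_e_gen mem1); have g2 := gen n.+1 0 (a_e_gen mem2); have g3 := gen n.+1 0 (a_e_gen mem3).
have -> : (2 * n = n + n)%N by rewrite mul2n addnn.
have -> : (2 * n.+1 = (n + n).+2)%N by rewrite mul2n doubleS addnn.
move: g1 g2 g3 h1 h2 h3 h4 h5 h6 h7 h8; rewrite !expr0 !(exprS q (n + n).+1) !(exprS q (n + n)) !(exprS q n) !(exprD q n n).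
move: (q ^+ n) (qn0 n) => Q Q0 g1 g2 g3 h1 h2 h3 h4 h5 h6 h7 h8 E1 E2.
have f e : e != 0 -> 1 - e / (al * (q * Q)) = - (e / (al * (q * Q))) * (1 - al / e * (q * Q)).
  by move=> e0; field; rewrite al_neq0 q_neq0 Q0 e0.
rewrite (f be be0) (f ga ga0) (f de de0) in E1.
have f' e : q * al / e * Q = al / e * (q * Q) by ring.
rewrite (f' be) (f' ga) (f' de) in E2.
move: E1 E2 g1 g2 g3.
have -> : 1 - al * Q * (al * Q) = 1 - al ^+ 2 * (Q * Q) by ring.
have -> : 1 - al * Q * (al * Q) * q = 1 - al ^+ 2 * (q * (Q * Q)) by ring.
have -> : 1 - al * (al * Q) = 1 - al ^+ 2 * Q by ring.
have -> : 1 - be * (al * Q) = 1 - al * be * Q by ring.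
have -> : 1 - ga * (al * Q) = 1 - al * ga * Q by ring.
have -> : 1 - de * (al * Q) = 1 - al * de * Q by ring.
have -> : 1 - (q * Q)^-1 = - (1 - q * Q) / (q * Q) by field; rewrite q_neq0 Q0.
have -> : 1 - (al * (q * Q))^-1 ^+ 2 = - (1 - al ^+ 2 * (q * (q * (Q * Q)))) / (al * (q * Q)) ^+ 2.
  by field; rewrite al_neq0 q_neq0 Q0.
have -> : 1 - (al * (q * Q))^-1 ^+ 2 * q = - (1 - al ^+ 2 * (q * (Q * Q))) / (al ^+ 2 * q * Q ^+ 2).
  by field; rewrite al_neq0 q_neq0 Q0.
move: h1 h2 h3 h4 h5 h6 h7 h8.
move: (1 - al * be * Q) (1 - al * ga * Q) (1 - al * de * Q) (1 - al ^+ 2 * Q) => x1 x2 x3 x4.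
move: (1 - al ^+ 2 * (Q * Q)) (1 - al ^+ 2 * (q * (q * (Q * Q)))) (1 - al ^+ 2 * (q * (Q * Q))) (1 - q * Q) => x5 x6 x7 x8.
move: (1 - al / be * (q * Q)) (1 - al / ga * (q * Q)) (1 - al / de * (q * Q)) => y1 y2 y3.
move=> h1 h2 h3 h4 h5 h6 h7 h8 E1 E2 g1 g2 g3.
(* The product [X * Z] is the product of the left coefficients of the two recurrences, and equally
   of the right ones: [X] collects the binomial factors and [Z] the monomial left over. *)
pose X := x5 * x7 * (x8 * (y1 * y2 * y3)) * (x1 * x2 * x3 * x4 * x6).
have X0 : X != 0 by rewrite !mulf_neq0.
pose Z := be * ga * de / (al ^+ 3 * (q * Q) ^+ 4).
have Z0 : Z != 0 by rewrite !mulf_neq0 ?invr_neq0 ?mulf_neq0 ?expf_neq0 ?mulf_neq0.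
apply: (mulIf (mulf_neq0 X0 Z0)).
have -> : A' * N' * (X * Z) = (A' * (x5 * x7 * (- x8 / (q * Q) * (- (be / (al * (q * Q))) * y1 *
   (- (ga / (al * (q * Q))) * y2) * (- (de / (al * (q * Q))) * y3))))) * (N' * (x1 * x2 * x3 * x4 * x6)).
  by rewrite /X /Z; field; rewrite al_neq0 q_neq0 Q0.
by rewrite E1 E2 /X /Z; field; rewrite al_neq0 q_neq0 Q0.
Qed.

Lemma aw_res_pole0_neq0 : aw_res_pole 0 != 0.
Proof.
have qp x : (forall j, 1 - x * q ^+ j != 0) -> qpoch q x != 0.
  move=> h; apply: qpoch_neq0 => // j; have := h j; apply: contra_neq => ->; exact: subrr.
have quot e j : e \in [:: be; ga; de] -> 1 - e / al * q ^+ j != 0.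
  move=> he; have e0 := es_neq0 he; have := gen 0 j (a_e_gen he); rewrite expr0 mulr1 => h.
  have -> : 1 - e / al * q ^+ j = - (e / al) * (q ^+ j - al / e) by field; rewrite al_neq0 e0.
  by rewrite mulf_neq0 // oppr_eq0 mulf_neq0 ?invr_neq0.
rewrite /aw_res_pole /aw_res expr0 mulr1 qpn0 !big_cons big_nil.
rewrite !mulf_neq0 ?invr_neq0 ?oner_neq0 //; apply: qp => j.
all: rewrite ?expr1 ?invrK.
- have := gen 0 j aa_gen; rewrite expr0 mulr1 => h.
  have -> : 1 - al^-1 ^+ 2 * q ^+ j = - (q ^+ j - al * al) / al ^+ 2 by field.
  by rewrite mulf_neq0 ?oppr_eq0 ?invr_neq0 ?expf_neq0.
- by rewrite exprVn invrK; exact: gen1.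
- have -> : al * q / al = q by field.
  by rewrite -exprS subr_eq0 eq_sym q_nroot.
- exact: gen1.
all: by [exact: (quot _ _ mem1) | exact: (quot _ _ mem2) | exact: (quot _ _ mem3) |
  rewrite [_ * al]mulrC; exact: gen1 (ae_gen mem1) |
  rewrite [_ * al]mulrC; exact: gen1 (ae_gen mem2) |
  rewrite [_ * al]mulrC; exact: gen1 (ae_gen mem3)].
Qed.

End ResidueNorm.

(** * The dual weights as residues *)

Section DualWeight.
Variable R : realType.
Variables (q qh : R[i]) (t : params R).
Hypothesis q_neq0 : q != 0.
Hypothesis q_lt1 : cabs q < 1.
Hypothesis qh_sqrt : qh ^+ 2 = q.
Hypothesis k0_neq0 : k0 t != 0.
Hypothesis k1_neq0 : k1 t != 0.
Hypothesis u0_neq0 : u0 t != 0.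
Hypothesis u1_neq0 : u1 t != 0.
Hypothesis k0_gen : forall z : int, k0 t ^+ 2 != - q ^ z.
Hypothesis t_gen : generic_abcd q qh t.
Hypothesis dual_gen : generic_abcd q qh (dual_params t).
Local Notation al := (aw_a (dual_params t)).
Local Notation be := (aw_b (dual_params t)).
Local Notation ga := (aw_c qh (dual_params t)).
Local Notation de := (aw_d qh (dual_params t)).

Lemma qh_neq0 : qh != 0.
Proof. by apply: contraNneq q_neq0 => h; rewrite -qh_sqrt h expr0n. Qed.

Let qh0 := qh_neq0.

Lemma dual_aE : al = k0 t * k1 t.
Proof. by rewrite /aw_a /= mulrC. Qed.

Lemma dual_neq0 e : e \in aw_abcd qh (dual_params t) -> e != 0.
Proof.
by rewrite !inE => /or4P[] /eqP ->; rewrite /aw_a /aw_b /aw_c /aw_d /= ?oppr_eq0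
  ?(mulf_neq0, invr_neq0).
Qed.

Lemma dual_aa_gen (z : int) : al * al != q ^ z.
Proof. by apply: dual_gen; rewrite mem_head. Qed.

Lemma g2_gen (z : int) : (k0 t * k1 t) ^+ 2 != q ^ z.
Proof. by rewrite -dual_aE expr2 dual_aa_gen. Qed.

Lemma dual_ae_gen e : e \in [:: be; ga; de] -> forall z : int, al * e != q ^ z.
Proof. by move=> he; apply: dual_gen; rewrite ?mem_head // inE he orbT. Qed.

(* The quotients of the dual parameters are products of the original ones. *)
Lemma dual_quot_gen e : e \in [:: be; ga; de] -> forall z : int, al / e != q ^ z.
Proof.
have H f f' : f \in aw_abcd qh t -> f' \in aw_abcd qh t -> forall z : int, f * f' / q != q ^ z.
  move=> hf hf' z; have := t_gen hf hf' (z + 1); rewrite expfzDr // expr1z.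
  by apply: contra => /eqP <-; rewrite mulfVK.
rewrite !inE => /or3P[] /eqP -> z.
(* This quotient is controlled by the condition on [k0]; the other two are products of original
   parameters divided by [q]. *)
- have -> : al / be = - k0 t ^+ 2 by rewrite /aw_a /aw_b /=; field; rewrite k0_neq0 k1_neq0.
  by rewrite eqr_oppLR k0_gen.
- have -> : al / ga = aw_b t * aw_d qh t / q.
    by rewrite -qh_sqrt /aw_a /aw_b /aw_c /aw_d /=; field; rewrite qh0 u0_neq0 u1_neq0.
  by apply: H; rewrite !inE eqxx ?orbT.
- have -> : al / de = aw_b t * aw_c qh t / q.
    by rewrite -qh_sqrt /aw_a /aw_b /aw_c /aw_d /=; field; rewrite qh0 u0_neq0 u1_neq0.
  by apply: H; rewrite !inE eqxx ?orbT.
Qed.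

(** The sign in the weight cancels the sign between residues at inverse poles, so only the absolute
    value of [m] remains. *)
Lemma w_plus_dual_gam (m : int) : w_plus_dual q qh t (gam q t m)^-1 =
  - aw_res_pole q al be ga de `|m|%N.
Proof.
have es0 e : e \in [:: be; ga; de] -> e != 0.
  by move=> he; apply: dual_neq0; rewrite inE he orbT.
have res tw n := residue_aw_weight q_neq0 q_lt1 n (dual_neq0 (mem_head _ _)) es0
  dual_aa_gen dual_ae_gen dual_quot_gen tw.
rewrite /w_plus_dual /sgn_dual.
rewrite -[fun z : R[i] => _]/(fun z => aw_weight q [:: al; be; ga; de] z / z).
case: m => n.
  rewrite asboolT; last by exists n%:Z.
  have -> : (gam q t n%:Z)^-1 = twist false (al * q ^+ n)^-1 by rewrite gam_nat dual_aE.
  by rewrite res mul1r mulN1r.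
rewrite asboolF; last first.
  move=> [m [m0 /invr_inj E]].
  by have := gam_inj q_neq0 q_lt1 k0_neq0 k1_neq0 g2_gen E => h; rewrite -h in m0.
rewrite NegzE gam_neg.
have -> : (k0 t * k1 t * q ^+ n.+1)^-1^-1 = twist true (al * q ^+ n.+1)^-1 by rewrite dual_aE.
by rewrite res mul1r mulN1r abszN.
Qed.

End DualWeight.

(** * Admissible contours and the final comparison *)

Lemma contour_separating (R : realType) (q : R[i]) (g : R -> R[i]) (es : seq R[i]) :
  {within `[0, 1], continuous g} -> g 0 = g 1 -> rectifiable g -> counterclockwise g ->
  (forall e, e \in es -> e != 0) ->
  (forall e, e \in es -> forall k : nat, jordan_interior g (e * q ^+ k) /\ jordan_exterior g (e^-1 * q ^- k)) ->
  separating g q (two_pi_i R) es.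
Proof.
move=> gc gcl gr cc e0 H e he; split=> [|k]; first exact: e0.
have [hi he'] := H e he k; rewrite -invfM in he'.
split; [exact: hi.1 | exact: he'.1 | exact: winding_interior | exact: winding_exterior].
Qed.

(* The points e q^k, around which the winding is w0, accumulate at 0. *)
Lemma winding_zero (R : realType) (q : R[i]) (g : R -> R[i]) (w0 : R[i]) (es : seq R[i]) e :
  {within `[0, 1], continuous g} -> g 0 = g 1 -> rectifiable g ->
  cabs q < 1 -> ~ curve_trace g 0 -> separating g q w0 es -> e \in es ->
  is_contour_integral g (fun x => x^-1) w0.
Proof.
move=> gc gcl gr q1 tr0 sep he; have [e0 H] := sep e he.
have [m m0 hm] := curve_dist gc tr0.
have [N hN] := expr_small q1 (cabs_ge0 e) (e := m / 4) ltac:(lra).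
have [_ _ cN _] := H N.
have hNN := hN N (leqnn _).
have hm' x : curve_trace g x -> m / 2 <= cabs (x - e * q ^+ N).
  move=> /hm; rewrite subr0 => h; have := cabs_le_dist x (e * q ^+ N).
  by rewrite cabsM cabsX; lra.
have hp : cabs (0 - e * q ^+ N) <= m / 2 / 2 by rewrite sub0r cabsN cabsM cabsX; lra.
apply: ci_ext (winding_near gc gcl gr hm' _ hp cN); last by lra.
by move=> x _; rewrite subr0.
Qed.

Theorem corollary11p7 (R : realType) (q qh : R[i]) (t : params R)
  (q_neq0 : 0 < `|q|) (q_lt1 : `|q| < 1) (qh_sqrt : qh ^+ 2 = q)
  (k0_neq0 : k0 t != 0) (k1_neq0 : k1 t != 0)
  (u0_neq0 : u0 t != 0) (u1_neq0 : u1 t != 0)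
  (k0_gen : forall j : int, k0 t ^+ 2 != q ^ j /\ k0 t ^+ 2 != - q ^ j)
  (k1_gen : forall j : int, k1 t ^+ 2 != q ^ j /\ k1 t ^+ 2 != - q ^ j)
  (u1_gen : forall j : int, u1 t ^+ 2 != q ^ j /\ u1 t ^+ 2 != - q ^ j)
  (t_gen : generic_abcd q qh t)
  (dual_gen : generic_abcd q qh (dual_params t))
  (C : R -> R[i]) (C_adm : admissible_contour q qh t C)
  (gamma : R[i]) (gamma_sigma : aw_sigma q t gamma) :
  aw_form q qh t C (Eplus q qh t (sp gamma)) (Eplus q qh t (sp gamma))
    / aw_form q qh t C (lone R) (lone R)
  = w_plus_dual q qh t (gam q t 0)^-1 / w_plus_dual q qh t gamma^-1.
Proof.
have q0 : q != 0 by rewrite -normr_gt0.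
have q1 : cabs q < 1 by rewrite -ltcR -normcabs.
have k0g z := (k0_gen z).2.
have g2 := g2_gen dual_gen.
have qh0 := qh_neq0 q0 qh_sqrt.
have [[gc gcl _] gr cc tr0 encl] := C_adm.
set a := aw_a t; set b := aw_b t; set c := aw_c qh t; set d := aw_d qh t.
have e0 e : e \in [:: a; b; c; d] -> e != 0.
  by rewrite !inE => /or4P[] /eqP ->; rewrite /a /b /c /d /aw_a /aw_b /aw_c /aw_d ?oppr_eq0
    ?(mulf_neq0, invr_neq0).
have sep : separating C q (two_pi_i R) [:: a; b; c; d] by exact: contour_separating.
have w0 := winding_zero gc gcl gr q1 tr0 sep (mem_head _ _).
have pgen e f : e \in [:: a; b; c; d] -> f \in [:: a; b; c; d] -> forall k : nat, e * f * q ^+ k != 1.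
  move=> he hf k; apply/eqP => E; have /eqP[] := t_gen _ _ he hf (- k%:Z).
  by rewrite -exprnN; apply: (mulIf (expf_neq0 k q0)); rewrite E mulVf // expf_neq0.
have ma : a \in [:: a; b; c; d] by rewrite inE eqxx.
have mb : b \in [:: a; b; c; d] by rewrite !inE eqxx !orbT.
have mc : c \in [:: a; b; c; d] by rewrite !inE eqxx !orbT.
have md : d \in [:: a; b; c; d] by rewrite !inE eqxx !orbT.
have s2E : a * b * c * d / q = (k0 t * k1 t) ^+ 2 by exact: aw_s2.
have s2g k : a * b * c * d / q * q ^+ k != 1 by rewrite s2E; exact: g2_nat.
have s4g m : a * b * c * d * q ^+ m != 1.
  by have := s2g m.+1; rewrite exprS mulrA mulfVK.
have qr i : q ^+ i.+1 != 1 by exact: q_nroot.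
pose I := aw_integral C q [:: a; b; c; d].
have I0 : I != 0 by exact: (aw_integral_neq0 gc gcl gr q0 q1 tr0 (two_pi_i_neq0 R) w0 sep s4g).
have form1 : aw_form q qh t C (lone R) (lone R) = (two_pi_i R)^-1 * I.
  rewrite /aw_form; congr (_ * _); apply: contour_integralE.
  apply: ci_ext (ci_aw_weight gc gcl gr q0 q1 tr0 w0 sep) => x hx; have x0 := tr_neq0 tr0 hx.
  by rewrite !leval_lone ?invr_neq0 // mulr1 mul1r.
case: gamma_sigma => m _ <-.
pose N := aw_norm q a b c d `|m|%N.
have formE : aw_form q qh t C (Eplus q qh t (sp (gam q t m))) (Eplus q qh t (sp (gam q t m))) =
    (two_pi_i R)^-1 * (N * I).
  rewrite /aw_form; congr (_ * _); apply: contour_integralE.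
  have := ci_aw_norm q0 qr (e0 _ ma) (e0 _ mb) (e0 _ mc) (e0 _ md) (pgen _ _ ma mb)
    (pgen _ _ ma mc) (pgen _ _ ma md) s2g gc gcl gr q1 tr0 w0 sep `|m|%N.
  apply: ci_ext => x hx; have x0 := tr_neq0 tr0 hx.
  have xV0 : x^-1 != 0 by rewrite invr_neq0.
  have ev y := Eplus_val q0 q1 qh_sqrt k0_neq0 k1_neq0 u0_neq0 u1_neq0 g2 k0g (pgen _ _ ma mb)
    (pgen _ _ ma mc) (pgen _ _ ma md) m (x := y).
  by rewrite (ev x x0) (ev x^-1 xV0) aw_poly_inv.
rewrite form1 formE !(w_plus_dual_gam q0 q1 qh_sqrt k0_neq0 k1_neq0 u0_neq0 u1_neq0 k0g t_gen dual_gen).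
set al := aw_a (dual_params t); set be := aw_b (dual_params t).
set ga := aw_c qh (dual_params t); set de := aw_d qh (dual_params t).
have d0 e : e \in [:: al; be; ga; de] -> e != 0.
  exact: dual_neq0 q0 qh_sqrt k0_neq0 k1_neq0 u0_neq0 u1_neq0 e.
have es0 e : e \in [:: be; ga; de] -> e != 0 by move=> he; apply: d0; rewrite inE he orbT.
have al0 := d0 _ (mem_head _ _).
have quot := dual_quot_gen q0 qh_sqrt k0_neq0 k1_neq0 u0_neq0 u1_neq0 k0g t_gen.
have A0 : aw_res_pole q al be ga de 0 != 0.
  exact: aw_res_pole0_neq0 q0 q1 al0 es0 (dual_aa_gen dual_gen) (dual_ae_gen dual_gen) quot.
have nz : [&& a != 0, b != 0, c != 0 & d != 0] by rewrite !e0.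
have AN : aw_res_pole q al be ga de `|m|%N * N = aw_res_pole q al be ga de 0.
  apply: (aw_res_norm q0 q1 al0 es0 (dual_aa_gen dual_gen) (dual_ae_gen dual_gen) quot) => //.
  - by rewrite s2E /al dual_aE.
  - by rewrite /a /b /al /be /aw_a /aw_b /=; field; rewrite u1_neq0 k0_neq0.
  - by rewrite /a /c /al /ga /aw_a /aw_c /=; ring.
  - by rewrite /a /d /al /de /aw_a /aw_d /=; field; rewrite u0_neq0.
have An0 : aw_res_pole q al be ga de `|m|%N != 0.
  by apply: contraNneq A0 => h; rewrite -AN h mul0r.
(* Both quotients are now visibly equal to [N]. *)
rewrite absz0 -AN; have w00 := two_pi_i_neq0 R.
clearbody N; clear form1 formE AN; clearbody I.
by move: (aw_res_pole _ _ _ _ _ _) An0 => A An0; field; rewrite ?I0 ?An0 ?w00.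
Qed.
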